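(* Let $q\ge0$, $r\ge1$, $1\le s\le\infty$, and let $\|\!|\cdot|\!\|$ be a norm on $V_h$ such that for some $\gamma\in(0,\pi/2)$ and a constant $M_h$ independent of $z$, $$\|\!|(z+\Delta_h)^{-1}\chi|\!\|\le\frac{M_h}{|z|}\|\!|\chi|\!\|\quad\text{for all }\chi\in V_h,\ z\in\mathbb{C}\setminus\Sigma_\gamma,$$ where $\Sigma_\gamma=\{z\in\mathbb{C}:|\arg z|\le\gamma\}$. Let $u_{kh}\in X^{q,r}_{k,h}$ satisfy $B(u_{kh},\varphi_{kh})=(f,\varphi_{kh})_{I\times\Omega}$ for all $\varphi_{kh}\in X^{q,r}_{k,h}$. Then there is a constant $C$ independent of $k$ and $h$ such that $$\Big(\sum_{m=1}^M\int_{I_m}\|\!|\partial_tu_{kh}(t)|\!\|^s dt\Big)^{1/s}+\Big(\sum_{m=1}^M\int_{I_m}\|\!|\Delta_hu_{kh}(t)|\!\|^s dt\Big)^{1/s}+\Big(\sum_{m=1}^Mk_m\|\!|k_m^{-1}[u_{kh}]_{m-1}|\!\|^s\Big)^{1/s}\le CM_h\ln\frac{T}{k}\Big(\int_I\|\!|P_hf(t)|\!\|^sdt\Big)^{1/s},$$ with the usual modification (suprema/maxima) for $s=\infty$, where $[u_{kh}]_0:=u_{kh,0}^+$.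
   Context: $\Omega\subset\mathbb{R}^d$ is a Lipschitz domain; $\mathcal{T}$ is an arbitrary (not necessarily quasi-uniform) partition of $\Omega$ into cells (triangles, tetrahedra, quadrilaterals or hexahedra), and $V_h\subset H^1_0(\Omega)$ consists of functions belonging to a fixed polynomial space ($P_r$ or $Q_r$) on each cell. $T>0$, $I=(0,T)$ partitioned by $0=t_0<\dots<t_M=T$, $I_m=(t_{m-1},t_m]$, $k_m=t_m-t_{m-1}$, $k=\max_mk_m$, $k_{\min}=\min_mk_m$, with (i) $k_{\min}\ge ck^\beta$ for constants $c,\beta>0$ independent of $k$; (ii) $\kappa^{-1}\le k_m/k_{m+1}\le\kappa$; (iii) $k\le T/4$. $X^{q,r}_{k,h}=\{v:v|_{I_m}\text{ polynomial of degree}\le q\text{ in }t\text{ with values in }V_h\}$; $v_m^\pm=\lim_{\varepsilon\to0^+}v(t_m\pm\varepsilon)$, $[v]_m=v_m^+-v_m^-$; $$B(u,\varphi)=\sum_{m=1}^M(\partial_tu,\varphi)_{I_m\times\Omega}+(\nabla u,\nabla\varphi)_{I\times\Omega}+\sum_{m=2}^M([u]_{m-1},\varphi_{m-1}^+)_\Omega+(u_0^+,\varphi_0^+)_\Omega.$$ $\Delta_h:V_h\to V_h$: $(-\Delta_hv_h,\chi)_\Omega=(\nabla v_h,\nabla\chi)_\Omega$ for all $\chi\in V_h$; $P_h:L^2(\Omega)\to V_h$ is the $L^2$-orthogonal projection. *)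

(* Defs.v *)
From HB Require Import structures.
From mathcomp Require Import all_boot all_order all_algebra.
From mathcomp Require Import all_classical all_reals all_analysis.
From mathcomp Require Import complex ess_sup_inf.
Set Implicit Arguments. Unset Strict Implicit. Unset Printing Implicit Defensive.
Import Order.TTheory GRing.Theory Num.Theory.
Import numFieldNormedType.Exports.
Local Open Scope classical_set_scope.
Local Open Scope ring_scope.

Section FEM.
Variable R : realType.

(* real inner product on an abstract real vector space H (playing L^2(Omega)) *)
Definition is_inner_product (H : lmodType R) (ip : H -> H -> R) : Prop :=
  [/\ forall (a : R) (x y z : H), ip (a *: x + y) z = a * ip x z + ip y z,
      forall x y : H, ip x y = ip y x &
      forall x : H, x != 0 -> 0 < ip x x].

(* e : 'I_n -> H is a basis of V_h (linearly independent family) *)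
Definition lin_indep (H : lmodType R) n (e : 'I_n -> H) : Prop :=
  forall c : 'cV[R]_n, \sum_(i < n) c i 0 *: e i = 0 -> c = 0.

Definition elem (H : lmodType R) n (e : 'I_n -> H) (x : 'cV[R]_n) : H :=
  \sum_(i < n) x i 0 *: e i.

Definition gram (H : lmodType R) n (ip : H -> H -> R) (e : 'I_n -> H) : 'M[R]_n :=
  \matrix_(i, j) ip (e i) (e j).

Definition bil n (A : 'M[R]_n) (x y : 'cV[R]_n) : R := (x^T *m A *m y) 0 0.

Definition sym_posdef n (A : 'M[R]_n) : Prop :=
  A^T = A /\ forall x : 'cV[R]_n, x != 0 -> 0 < bil A x x.

(* discrete Laplacian Delta_h in coordinates: the stiffness matrix K is the
   matrix of (grad ., grad .) on V_h, G the mass matrix, and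
   (-Delta_h v, chi) = (grad v, grad chi) gives  Delta_h = - G^{-1} K. *)
Definition dlap n (G K : 'M[R]_n) : 'M[R]_n := - (invmx G *m K).

Definition proj_coord (H : lmodType R) n (ip : H -> H -> R) (e : 'I_n -> H)
  (h : H) : 'cV[R]_n := invmx (gram ip e) *m \col_(i < n) ip h (e i).

Definition cre (z : R[i]) : R := let: Complex a _ := z in a.
Definition cim (z : R[i]) : R := let: Complex _ b := z in b.
Definition cmod (z : R[i]) : R := Num.sqrt (cre z ^+ 2 + cim z ^+ 2).
Definition toC n (x : 'cV[R]_n) : 'cV[R[i]]_n := map_mx (fun a => Complex a 0) x.
Definition toCM n (A : 'M[R]_n) : 'M[R[i]]_n := map_mx (fun a => Complex a 0) A.

(* a norm on (the complexification of) V_h *)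
Definition is_norm n (N : 'cV[R[i]]_n -> R) : Prop :=
  [/\ forall x y, N (x + y) <= N x + N y,
      forall (c : R[i]) x, N (c *: x) = cmod c * N x &
      forall x, N x = 0 -> x = 0].

(* sector Sigma_gamma = {z : |arg z| <= gamma} (containing 0); for z <> 0 and
   arg z in (-pi, pi], |arg z| <= gamma  <->  cos (arg z) >= cos gamma
   <->  Re z >= |z| cos gamma. *)
Definition in_sector (gamma : R) (z : R[i]) : Prop :=
  z = 0 \/ cmod z * cos gamma <= cre z.

Definition resolvent_estimate n (N : 'cV[R[i]]_n -> R) (D : 'M[R]_n)
  (gamma Mh : R) : Prop :=
  forall (z : R[i]) (chi : 'cV[R]_n), ~ in_sector gamma z ->
    N (invmx (z%:M + toCM D) *m toC chi) <= Mh / cmod z * N (toC chi).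

Definition time_partition (T : R) (M : nat) (tt : nat -> R) : Prop :=
  [/\ tt 0%N = 0, tt M = T & forall m, (m < M)%N -> tt m < tt m.+1].

Definition kstep (tt : nat -> R) (m : nat) : R := tt m - tt m.-1.
Definition kmax (M : nat) (tt : nat -> R) : R :=
  \big[Num.max/0]_(1 <= m < M.+1) kstep tt m.
Definition kmin (M : nat) (tt : nat -> R) : R :=
  \big[Num.min/kmax M tt]_(1 <= m < M.+1) kstep tt m.

Definition Im_ (tt : nat -> R) (m : nat) : set R := `]tt m.-1, tt m]%classic.

(* an element of X^{q,r}_{k,h} is given by coefficients U m j (m = 1..M,
   j = 0..q): on I_m it equals t |-> sum_j t^j U m j  (values in V_h) *)
Definition dgval n q (U : nat -> 'I_q.+1 -> 'cV[R]_n) (m : nat) (t : R)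
  : 'cV[R]_n := \sum_(j < q.+1) t ^+ j *: U m j.
Definition dgder n q (U : nat -> 'I_q.+1 -> 'cV[R]_n) (m : nat) (t : R)
  : 'cV[R]_n := \sum_(j < q.+1) (j%:R * t ^+ j.-1) *: U m j.
(* v_{m-1}^+ = value of the m-th piece at t_{m-1};
   v_{m-1}^- = value of the (m-1)-th piece at t_{m-1};
   jump [v]_{m-1} for m >= 2, and [v]_0 := v_0^+ *)
Definition dgjump n q (tt : nat -> R) (U : nat -> 'I_q.+1 -> 'cV[R]_n) (m : nat)
  : 'cV[R]_n :=
  if (m <= 1)%N then dgval U 1 (tt 0%N)
  else dgval U m (tt m.-1) - dgval U m.-1 (tt m.-1).

Definition Bform n q (G K : 'M[R]_n) (M : nat) (tt : nat -> R)
  (U Phi : nat -> 'I_q.+1 -> 'cV[R]_n) : R :=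
  \sum_(1 <= m < M.+1)
     Rintegral lebesgue_measure (Im_ tt m)
       (fun t => bil G (dgder U m t) (dgval Phi m t)) +
  \sum_(1 <= m < M.+1)
     Rintegral lebesgue_measure (Im_ tt m)
       (fun t => bil K (dgval U m t) (dgval Phi m t)) +
  \sum_(2 <= m < M.+1) bil G (dgjump tt U m) (dgval Phi m (tt m.-1)) +
  bil G (dgval U 1 (tt 0%N)) (dgval Phi 1 (tt 0%N)).

Definition load (H : lmodType R) n q (ip : H -> H -> R) (e : 'I_n -> H)
  (M : nat) (tt : nat -> R) (f : R -> H) (Phi : nat -> 'I_q.+1 -> 'cV[R]_n) : R :=
  \sum_(1 <= m < M.+1)
     Rintegral lebesgue_measure (Im_ tt m)
       (fun t => ip (f t) (elem e (dgval Phi m t))).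

Definition Ls_time (s : \bar R) (M : nat) (tt : nat -> R) (g : nat -> R -> R) : R :=
  match s with
  | r%:E => (\sum_(1 <= m < M.+1)
               Rintegral lebesgue_measure (Im_ tt m) (fun t => g m t `^ r)) `^ r^-1
  | _ => \big[Num.max/0]_(1 <= m < M.+1) sup [set g m t | t in Im_ tt m]
  end.

Definition ls_jump (s : \bar R) (M : nat) (tt : nat -> R) (a : nat -> R) : R :=
  match s with
  | r%:E => (\sum_(1 <= m < M.+1) kstep tt m * a m `^ r) `^ r^-1
  | _ => \big[Num.max/0]_(1 <= m < M.+1) a m
  end.

Definition Ls_I (s : \bar R) (T : R) (g : R -> R) : \bar R :=
  match s with
  | r%:E => poweR (\int[lebesgue_measure]_(t in `]0, T]%classic) ((g t `^ r)%:E)) r^-1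
  | _ => ess_sup lebesgue_measure
           (fun t => if t \in `]0, T] then (g t)%:E else 0%E)
  end.

End FEM.

(* Main.v *)
Require Import Defs.
From HB Require Import structures.
From mathcomp Require Import all_boot all_order all_algebra.
From mathcomp Require Import all_classical all_reals all_analysis.
From mathcomp Require Import complex ess_sup_inf measurable_realfun.
From mathcomp Require Import ring lra.
Set Implicit Arguments. Unset Strict Implicit. Unset Printing Implicit Defensive.
Import Order.TTheory GRing.Theory Num.Theory.
Import numFieldNormedType.Exports.
Local Open Scope classical_set_scope.
Local Open Scope ring_scope.
Local Open Scope complex_scope.

(* In coordinates - Delta_h = A = P diag(d) P^-1 with d > 0, and in the monomials of
   (t - t_(m-1)) / k_m a time step reads (S + k_m A W) X = u e_0 + F with fixed matrices
   S and W of size q + 1.  Hence Delta_h u and the increments of u on I_m are sums over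
   l <= m of functions of A applied to the data of I_l; these functions are products of
   entries of Q(k_m z), where Q(z) = (S + z W)^-1, and of stability functions r(k_p z).
   The energy identity of S yields |r(z)| (1 + c |z|) <= 1 on a sector of half angle
   theta in (gamma, pi/2), and together with the bounded step ratio it makes the l-th
   function O(|z| / (1 + c' (t_m - t_(l-1)) |z|)^2).  Cauchy's formula on the two rays
   arg z = theta and arg z = - theta, where the resolvent estimate is available, bounds the
   contribution of I_l by C M_h / (t_m - t_(l-1)) times the integral of the norm of P_h f
   over I_l.  No contour integral is taken: Riemann sums on a geometric grid of radii
   suffice, because the limit is only used to pass to an inequality between norms.
   The row and column sums of the kernel k_l / (t_m - t_(l-1)) are at most
   1 + ln (T / k_min) = O(ln (T / k)), and Schur's test with Jensen's inequality gives
   the estimate for every s. *)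

(** * Smooth functions on a sector *)

(** The resolvent estimate is given for real vectors only, and each use of it costs a factor M_h. So
    the operators of successive time steps are never bounded one by one: the whole propagator from
    I_l to I_m is a single scalar function of A, applied once to a real vector. For its mass on the
    rays to be finite this function must vanish like |z| at 0 and like 1/|z| at infinity. The factor
    z comes from A itself in A u, and from the reproduction of constants in an increment. On the
    current interval, l = m, one of the two decays fails: Q(0) = S^-1, so S^-1 / (1 + z) is split
    off, whose operator is a resolvent on the negative axis. The eigenvalues lie between the rays,
    at poles of the Cauchy kernel; difference quotients, tracked through sums and products, replace
    the theorem on removable singularities. The error of the discrete Cauchy formula may depend on
    the eigenvectors, hence on h, because it vanishes in the limit. No sign of M_h is assumed: M_h
    >= 1 is derived unless the norm is trivial. *)

Section Modulus.
Variable R : realType.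
Implicit Types x y z : R[i].

Lemma cmodE z : cmod z = Normc.normc z. Proof. by case: z. Qed.

Lemma cmodM x y : cmod (x * y) = cmod x * cmod y.
Proof. by rewrite !cmodE Normc.normcM. Qed.

Lemma cmodV x : cmod x^-1 = (cmod x)^-1.
Proof. by rewrite !cmodE Normc.normcV. Qed.

Lemma cmod_ge0 x : 0 <= cmod x. Proof. exact: sqrtr_ge0. Qed.

Lemma cmodD x y : cmod (x + y) <= cmod x + cmod y.
Proof. rewrite !cmodE; exact: (@le_normcD R x y). Qed.

Lemma cmodN x : cmod (- x) = cmod x.
Proof. rewrite !cmodE; exact: (@normcN R x). Qed.

Lemma cmodB x y : cmod (x - y) <= cmod x + cmod y.
Proof. by rewrite (le_trans (cmodD _ _)) // cmodN. Qed.

Lemma cmod0 : cmod (0 : R[i]) = 0.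
Proof. by rewrite /cmod /= expr0n addr0 sqrtr0. Qed.

Lemma cmod1 : cmod (1 : R[i]) = 1.
Proof. by rewrite /cmod /= expr0n addr0 expr1n sqrtr1. Qed.

Lemma cmod_eq0 x : (cmod x == 0) = (x == 0).
Proof.
apply/eqP/eqP => [|->]; last exact: cmod0.
by rewrite cmodE => /Normc.eq0_normc.
Qed.

Lemma cmod_gt0 x : (0 < cmod x) = (x != 0).
Proof. by rewrite lt_def cmod_eq0 cmod_ge0 andbT. Qed.

Lemma cmod_real (a : R) : cmod a%:C = `|a|.
Proof. by rewrite /cmod /= expr0n addr0 sqrtr_sqr. Qed.

Lemma cmod_realM (a : R) x : cmod (a%:C * x) = `|a| * cmod x.
Proof. by rewrite cmodM cmod_real. Qed.

Lemma cmod_sum (I : Type) (r : seq I) (P : pred I) (F : I -> R[i]) :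
  cmod (\sum_(i <- r | P i) F i) <= \sum_(i <- r | P i) cmod (F i).
Proof.
elim/big_rec2: _ => [|i a b _ h]; first by rewrite cmod0.
by rewrite (le_trans (cmodD _ _)) // lerD2l.
Qed.

Lemma cmod_prod (I : Type) (r : seq I) (P : pred I) (F : I -> R[i]) :
  cmod (\prod_(i <- r | P i) F i) = \prod_(i <- r | P i) cmod (F i).
Proof. by elim/big_rec2: _ => [|i a b _ h]; rewrite ?cmod1 // cmodM h. Qed.

Lemma cmodX x n : cmod (x ^+ n) = cmod x ^+ n.
Proof. by elim: n => [|n ih]; rewrite ?expr0 ?cmod1 // !exprS cmodM ih. Qed.

Lemma cmodJ z : cmod z^* = cmod z.
Proof. by case: z => a b; rewrite /cmod /= sqrrN. Qed.

Lemma cmod_sqr z : cmod z ^+ 2 = cre z ^+ 2 + cim z ^+ 2.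
Proof. by rewrite sqr_sqrtr // addr_ge0 // sqr_ge0. Qed.

Lemma cre_le_cmod z : `|cre z| <= cmod z.
Proof. by rewrite -sqrtr_sqr ler_wsqrtr // lerDl sqr_ge0. Qed.

Lemma creD x y : cre (x + y) = cre x + cre y. Proof. by case: x; case: y. Qed.
Lemma creMreal (a : R) z : cre (a%:C * z) = a * cre z.
Proof. by case: z => b c /=; rewrite mul0r subr0. Qed.
Lemma cre_sum (I : Type) (r : seq I) (P : pred I) (F : I -> R[i]) :
  cre (\sum_(i <- r | P i) F i) = \sum_(i <- r | P i) cre (F i).
Proof. by apply: (big_morph _ creD). Qed.

End Modulus.

Section Sector.
Variables (R : realType) (delta : R).
Hypothesis delta0 : 0 < delta.
Implicit Types (z u : R[i]) (f g : R[i] -> R[i]).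

(** The sector of half angle arccos delta around the positive axis, without its vertex. In this form
    invariance under positive dilations and Re z > 0 are immediate. *)
Definition sect z : Prop := z != 0 /\ delta * cmod z <= cre z.

Lemma sect_pos z : sect z -> 0 < cre z.
Proof. by case=> z0 h; apply: lt_le_trans h; rewrite mulr_gt0 // cmod_gt0. Qed.

Lemma sectM (k : R) z : 0 < k -> sect z -> sect (k%:C * z).
Proof.
move=> k0 [z0 h]; split; first by rewrite mulf_neq0 // eq_complex /= eqxx andbT gt_eqF.
by rewrite cmod_realM gtr0_norm // creMreal mulrCA ler_pM2l.
Qed.

Lemma sect_addl_ge z (mu : R) : sect z -> 0 < mu -> cmod z <= cmod (z + mu%:C).
Proof.
move=> /sect_pos; case: z => a b /= a0 mu0.
by rewrite /cmod /= ler_wsqrtr // addr0 lerD2r ler_sqr ?nnegrE ?ltW // ?addr_gt0 // ltrDl.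
Qed.

Lemma sect_addr_ge z (mu : R) : sect z -> 0 < mu -> mu <= cmod (z + mu%:C).
Proof.
move=> /sect_pos; case: z => a b /= a0 mu0.
apply: le_trans (cre_le_cmod _); rewrite /= gtr0_norm; last exact: addr_gt0.
by rewrite lerDr ltW.
Qed.

(* A quantitative form of holomorphy in the variable log z. *)
Definition smooth2 f : Prop := exists f' (C : R), 0 <= C /\
  forall z, sect z -> [/\ cmod (f z) <= C, cmod (f' z) <= C &
    forall u, sect (u * z) -> cmod (u - 1) <= 2^-1 ->
      cmod (f (u * z) - f z - (u - 1) * f' z) <= C * cmod (u - 1) ^+ 2].

Lemma smooth2_bound f : smooth2 f -> exists2 C, 0 <= C & forall z, sect z -> cmod (f z) <= C.
Proof. by move=> [f' [C [C0 h]]]; exists C => // z /h[]. Qed.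

Lemma smooth2_ext f g : (forall z, sect z -> f z = g z) -> smooth2 f -> smooth2 g.
Proof.
move=> fg [f' [C [C0 h]]]; exists f', C; split=> // z zs; have [h1 h2 h3] := h _ zs.
by split=> //; [rewrite -fg|move=> u us u1; rewrite -!fg //; exact: h3].
Qed.

Lemma smooth2_cst (c : R[i]) : smooth2 (fun=> c).
Proof.
exists (fun=> 0), (cmod c); split; first exact: cmod_ge0.
move=> z _; split => //; first by rewrite cmod0 cmod_ge0.
by move=> u _ _; rewrite mulr0 subrr subr0 cmod0 mulr_ge0 ?cmod_ge0 ?sqr_ge0.
Qed.

Lemma smooth2D f g : smooth2 f -> smooth2 g -> smooth2 (fun z => f z + g z).
Proof.
move=> [f' [C [C0 hf]]] [g' [D [D0 hg]]].
exists (fun z => f' z + g' z), (C + D); split; first exact: addr_ge0.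
move=> z zs; have [f1 f2 f3] := hf _ zs; have [g1 g2 g3] := hg _ zs; split.
- by apply: le_trans (cmodD _ _) _; exact: lerD.
- by apply: le_trans (cmodD _ _) _; exact: lerD.
move=> u us u1; rewrite (_ : _ - _ = (f (u * z) - f z - (u - 1) * f' z) +
   (g (u * z) - g z - (u - 1) * g' z)); last by ring.
apply: le_trans (cmodD _ _) _; rewrite [leRHS]mulrDl; apply: lerD; [exact: f3|exact: g3].
Qed.

Lemma smooth2M f g : smooth2 f -> smooth2 g -> smooth2 (fun z => f z * g z).
Proof.
move=> [f' [C [C0 hf]]] [g' [D [D0 hg]]].
exists (fun z => f' z * g z + f z * g' z), (4 * C * D); split; first by rewrite !mulr_ge0.
move=> z zs; have [f1 f2 f3] := hf _ zs; have [g1 g2 g3] := hg _ zs; split.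
- by rewrite cmodM (le_trans (ler_pM _ _ f1 g1)) ?cmod_ge0 //; nra.
- apply: le_trans (cmodD _ _) _; rewrite !cmodM.
  have := ler_pM (cmod_ge0 _) (cmod_ge0 _) f2 g1.
  have := ler_pM (cmod_ge0 _) (cmod_ge0 _) f1 g2; nra.
move=> u us u1; have e1 := f3 _ us u1; have e2 := g3 _ us u1.
have [f4 _ _] := hf _ us; set v := u - 1.
set a := f (u * z) - f z - (u - 1) * f' z in e1.
set b := g (u * z) - g z - (u - 1) * g' z in e2.
(* Here [v * f' z + a] is f(u z) - f(z), of first order. The three summands are at most 1, 2 and 1
   times C D |u - 1|^2, hence the constant 4 C D. *)
rewrite (_ : _ - _ = a * g z + v * g' z * (v * f' z + a) + f (u * z) * b); last first.
  by rewrite /a /b /v; ring.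
have v0 : 0 <= cmod v by exact: cmod_ge0.
have h1 : cmod (a * g z) <= C * cmod v ^+ 2 * D by rewrite cmodM ler_pM ?cmod_ge0.
have h3 : cmod (f (u * z) * b) <= C * (D * cmod v ^+ 2) by rewrite cmodM ler_pM ?cmod_ge0.
have h4 : cmod (v * f' z + a) <= 2 * C * cmod v.
  rewrite (le_trans (cmodD _ _)) // cmodM.
  have := ler_wpM2l v0 f2; have : C * cmod v ^+ 2 <= C * (2^-1 * cmod v).
    by rewrite expr2 ler_wpM2l // ler_wpM2r.
  have : 0 <= C * cmod v by rewrite mulr_ge0.
  move: e1; rewrite -/v; lra.
have h2 : cmod (v * g' z * (v * f' z + a)) <= cmod v * D * (2 * C * cmod v).
  by rewrite !cmodM ler_pM ?mulr_ge0 ?cmod_ge0 // ler_pM ?cmod_ge0.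
rewrite (le_trans (cmodD _ _)) // (le_trans (lerD (cmodD _ _) (lexx _))) //.
move: h1 h2 h3; rewrite expr2; lra.
Qed.

Lemma smooth2Z (c : R[i]) f : smooth2 f -> smooth2 (fun z => c * f z).
Proof. move=> h; apply: smooth2M h; exact: smooth2_cst. Qed.

Lemma smooth2_sum (I : Type) (r : seq I) (P : pred I) (F : I -> R[i] -> R[i]) :
  (forall i, smooth2 (F i)) -> smooth2 (fun z => \sum_(i <- r | P i) F i z).
Proof.
move=> h; elim: r => [|i r ih].
  by apply: smooth2_ext (smooth2_cst 0) => z _; rewrite big_nil.
case Pi : (P i); last by apply: smooth2_ext ih => z _; rewrite big_cons Pi.
by apply: smooth2_ext (smooth2D (h i) ih) => z _; rewrite big_cons Pi.
Qed.

Lemma smooth2_scale (k : R) f : 0 < k -> smooth2 f -> smooth2 (fun z => f (k%:C * z)).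
Proof.
move=> k0 [f' [C [C0 hf]]]; exists (fun z => f' (k%:C * z)), C; split=> // z zs.
have [f1 f2 f3] := hf _ (sectM k0 zs); split=> // u us u1.
by rewrite !(mulrCA k%:C) f3 // mulrCA; exact: sectM.
Qed.

Lemma half_le_cmod u : cmod (u - 1) <= 2^-1 -> 2^-1 <= cmod u.
Proof.
move=> h; have := cmodB u (u - 1); rewrite opprB addrCA subrr addr0 cmod1; lra.
Qed.

Lemma sect_addr_neq0 z (mu : R) : sect z -> 0 < mu -> z + mu%:C != 0.
Proof. by move=> zs m0; rewrite -cmod_gt0 (lt_le_trans m0) // sect_addr_ge. Qed.

(** The derivative is taken in u at u = 1, whence its factor z. The remainder is exact and carries
    (u - 1)^2; the bound 2 / mu uses |z| <= 2 |u z|, which follows from |u - 1| <= 1/2. *)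
Lemma smooth2_inv (mu : R) : 0 < mu -> smooth2 (fun z => (z + mu%:C)^-1).
Proof.
move=> m0; exists (fun z => - z / (z + mu%:C) / (z + mu%:C)), (2 / mu).
have C0 : 0 <= 2 / mu by rewrite divr_ge0 // ltW.
have m1 : 0 < mu^-1 by rewrite invr_gt0.
split=> // z zs; have z0 := sect_addr_neq0 zs m0.
have h1 : cmod (z + mu%:C)^-1 <= mu^-1.
  by rewrite cmodV lef_pV2 ?posrE ?cmod_gt0 // sect_addr_ge.
have h2 : cmod (z / (z + mu%:C)) <= 1.
  by rewrite cmodM cmodV ler_pdivrMr ?cmod_gt0 // mul1r sect_addl_ge.
split.
- by rewrite (le_trans h1) //; lra.
- rewrite mulNr mulNr cmodN cmodM (le_trans (ler_pM (cmod_ge0 _) (cmod_ge0 _) h2 h1)) //.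
  lra.
move=> u us u1; have uz0 := sect_addr_neq0 us m0.
rewrite (_ : _ - _ = (u - 1) ^+ 2 * (z / (u * z + mu%:C) * (z / (z + mu%:C) / (z + mu%:C)))).
  rewrite cmodM cmodX mulrC ler_wpM2r ?sqr_ge0 // cmodM.
  have u0 := half_le_cmod u1.
  have h3 : cmod (z / (u * z + mu%:C)) <= 2.
    rewrite cmodM cmodV ler_pdivrMr ?cmod_gt0 //.
    have := sect_addl_ge us m0; rewrite cmodM; have := cmod_ge0 z; nra.
  rewrite ler_pM ?cmod_ge0 // cmodM -[leRHS]mul1r ler_pM ?cmod_ge0 //.
by field; rewrite uz0 z0.
Qed.

Lemma smooth2_id_inv (mu : R) : 0 < mu -> smooth2 (fun z => z / (z + mu%:C)).
Proof.
move=> m0; apply: smooth2_ext (smooth2D (smooth2_cst 1)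
  (smooth2Z (- mu%:C) (smooth2_inv m0))) => z zs.
by field; exact: sect_addr_neq0.
Qed.

(* z (f z - f lam) / (z - lam) extends smoothly to the sector. *)
Definition divdiff (lam : R) f : Prop := smooth2 f /\ exists E, smooth2 E /\
  forall z, sect z -> z * (f z - f lam%:C) = (z - lam%:C) * E z.

Lemma divdiff_ext lam f g : f lam%:C = g lam%:C ->
  (forall z, sect z -> f z = g z) -> divdiff lam f -> divdiff lam g.
Proof.
move=> fgl fg [sf [E [sE h]]]; split; first exact: smooth2_ext sf.
by exists E; split=> // z zs; rewrite -fg // -fgl h.
Qed.

Lemma divdiff_cst lam (c : R[i]) : divdiff lam (fun=> c).
Proof.
split; first exact: smooth2_cst.
exists (fun=> 0); split; first exact: smooth2_cst.
by move=> z _; rewrite subrr !mulr0.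
Qed.

Lemma divdiffD lam f g : divdiff lam f -> divdiff lam g ->
  divdiff lam (fun z => f z + g z).
Proof.
move=> [sf [E [sE hE]]] [sg [G [sG hG]]]; split; first exact: smooth2D.
exists (fun z => E z + G z); split; first exact: smooth2D.
by move=> z zs; rewrite [RHS]mulrDr -hE // -hG //; ring.
Qed.

Lemma divdiffM lam f g : divdiff lam f -> divdiff lam g ->
  divdiff lam (fun z => f z * g z).
Proof.
move=> [sf [E [sE hE]]] [sg [G [sG hG]]]; split; first exact: smooth2M.
exists (fun z => f z * G z + g lam%:C * E z); split.
  by apply: smooth2D; [exact: smooth2M | exact: smooth2Z].
by move=> z zs; rewrite [RHS]mulrDr 2!(mulrCA (z - _)) -hE // -hG //; ring.
Qed.

Lemma divdiffZ lam (c : R[i]) f : divdiff lam f -> divdiff lam (fun z => c * f z).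
Proof. move=> h; apply: divdiffM h; exact: divdiff_cst. Qed.

Lemma divdiff_sum lam (I : Type) (r : seq I) (P : pred I) (F : I -> R[i] -> R[i]) :
  (forall i, divdiff lam (F i)) -> divdiff lam (fun z => \sum_(i <- r | P i) F i z).
Proof.
move=> h; elim: r => [|i r ih].
  by apply: divdiff_ext (divdiff_cst lam 0) => [|z _]; rewrite big_nil.
case Pi : (P i); last by apply: divdiff_ext ih => [|z _]; rewrite big_cons Pi.
by apply: divdiff_ext (divdiffD (h i) ih) => [|z _]; rewrite big_cons Pi.
Qed.

Lemma divdiff_prod lam (I : Type) (r : seq I) (P : pred I) (F : I -> R[i] -> R[i]) :
  (forall i, divdiff lam (F i)) -> divdiff lam (fun z => \prod_(i <- r | P i) F i z).
Proof.
move=> h; elim: r => [|i r ih].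
  by apply: divdiff_ext (divdiff_cst lam 1) => [|z _]; rewrite big_nil.
case Pi : (P i); last by apply: divdiff_ext ih => [|z _]; rewrite big_cons Pi.
by apply: divdiff_ext (divdiffM (h i) ih) => [|z _]; rewrite big_cons Pi.
Qed.

Lemma divdiff_inv lam (mu : R) : 0 < mu -> 0 < lam ->
  divdiff lam (fun z => (z + mu%:C)^-1).
Proof.
move=> m0 l0; split; first exact: smooth2_inv.
exists (fun z => - (lam%:C + mu%:C)^-1 * (z / (z + mu%:C))).
split; first exact/smooth2Z/smooth2_id_inv.
move=> z zs; field; rewrite sect_addr_neq0 //=.
by rewrite -rmorphD /= eq_complex /= eqxx andbT gt_eqF // addr_gt0.
Qed.

End Sector.

(** * A discrete Cauchy formula on two rays *)

Section RealLemmas.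
Variable R : realType.
Implicit Types x y c d rho : R.

Lemma atan_mvt x y : x <= y ->
  exists2 xi, x <= xi <= y & atan y - atan x = (1 + xi ^+ 2)^-1 * (y - x).
Proof.
move=> xy; have [//|xi] := @MVT_segment R atan (fun t => (1 + t ^+ 2)^-1) x y xy.
  by apply: continuous_subspaceT => t; exact: continuous_atan.
by rewrite in_itv /= => h ->; exists xi.
Qed.

Lemma atan_lip x y : x <= y -> atan y - atan x <= y - x.
Proof.
move=> xy; have [xi _ ->] := atan_mvt xy.
rewrite -[leRHS]mul1r ler_wpM2r ?subr_ge0 // invf_le1 ?lerDl ?sqr_ge0 //.
by rewrite ltr_pwDl // sqr_ge0.
Qed.

Lemma sin_mvt x y : x <= y ->
  exists2 xi, x <= xi <= y & sin y - sin x = cos xi * (y - x).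
Proof.
move=> xy; have [//|xi] := @MVT_segment R sin cos x y xy.
  by apply: continuous_subspaceT => t; exact: continuous_sin.
by rewrite in_itv /= => h ->; exists xi.
Qed.

Lemma cos_mvt x y : x <= y ->
  exists2 xi, x <= xi <= y & cos y - cos x = - sin xi * (y - x).
Proof.
move=> xy; have [//|xi] := @MVT_segment R cos (fun t => - sin t) x y xy.
  by apply: continuous_subspaceT => t; exact: continuous_cos.
by rewrite in_itv /= => h ->; exists xi.
Qed.

Lemma norm_sin_le x : 0 <= x -> `|sin x| <= x.
Proof.
move=> x0; have [xi _] := sin_mvt x0; rewrite sin0 !subr0 => ->.
by rewrite normrM (ger0_norm x0) -[leRHS]mul1r ler_wpM2r // cos_max.
Qed.

Lemma norm_cos_sub1_le x : 0 <= x -> `|cos x - 1| <= x.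
Proof.
move=> x0; have [xi _] := cos_mvt x0; rewrite cos0 !subr0 => ->.
by rewrite normrM normrN (ger0_norm x0) -[leRHS]mul1r ler_wpM2r // sin_max.
Qed.

Lemma atan_gt0 y : 0 < y -> 0 < atan y.
Proof. by move=> y0; rewrite -atan0 lt_atan. Qed.

(* With s = pi/2 - atan y this is s <= tan s. *)
Lemma atan_ge_pihalf y : 0 < y -> pi / 2 - y^-1 <= atan y.
Proof.
move=> y0; set a := atan y; have a0 : 0 < a := atan_gt0 y0.
have a1 : a < pi / 2 by exact: atan_ltpi2.
have ca : 0 < cos a by apply: cos_gt0_pihalf; rewrite a1 andbT (lt_trans _ a0) // oppr_lt0 (lt_trans a0).
have sa : 0 < sin a by apply: sin_gt0_pihalf; rewrite a0 a1.
have ya : y = sin a / cos a by rewrite -[y]atanK.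
have s0 : 0 <= pi / 2 - a by rewrite subr_ge0 ltW.
have [xi /andP[xi0 xi1]] := sin_mvt s0; rewrite sin0 !subr0.
have -> : sin (pi / 2 - a) = cos a.
  by rewrite sinB sin_pihalf cos_pihalf mul0r subr0 mul1r.
move=> e; have cxi : sin a <= cos xi.
  have -> : sin a = cos (pi / 2 - a).
    by rewrite cosB sin_pihalf cos_pihalf mul0r add0r mul1r.
  have pi2 : pi / 2 <= pi :> R by rewrite ler_pdivrMr // ler_peMr ?pi_ge0 // ler1n.
  have hs : pi / 2 - a <= pi by rewrite (le_trans _ pi2) // gerBl ltW.
  by rewrite leNgt ltr_cos ?in_itv /= ?s0 ?hs ?xi0 ?(le_trans xi1) // -leNgt.
rewrite lerBlDr -lerBlDl ya invf_div ler_pdivlMr // mulrC.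
by rewrite e ler_wpM2r.
Qed.

(** The subtracted fraction is the derivative of atan ((rho - c) / d) in log rho. The remainder is
    uniform in rho because (rho / d)^2 is absorbed by 1 + x^2 and x + xi by 1 + xi^2. *)
Lemma atan_step c d : 0 < d -> exists2 K, 0 <= K & forall rho eps, 0 < rho -> 0 <= eps ->
  `|atan ((rho * (1 + eps) - c) / d) - atan ((rho - c) / d)
     - eps * (rho * d / ((rho - c) ^+ 2 + d ^+ 2))| <= K * eps ^+ 2.
Proof.
move=> d0; set k := `|c| / d; have k0 : 0 <= k by rewrite divr_ge0 // ltW.
exists (2 * (1 + k ^+ 2) * (1 + k)).
  by rewrite !mulr_ge0 // addr_ge0 // sqr_ge0.
move=> rho eps r0 e0; set x := (rho - c) / d; set y := _ / d; set t := rho / d.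
have t0 : 0 < t by rewrite divr_gt0.
have yx : y - x = eps * t by rewrite /x /y /t; field; rewrite gt_eqF.
have xy : x <= y by rewrite -subr_ge0 yx mulr_ge0 // ltW.
have xe : x = t - c / d by rewrite /x /t; field; rewrite gt_eqF.
have ck : `|c / d| = k by rewrite normrM normfV (gtr0_norm d0).
have [xi /andP[h1 h2] ->] := atan_mvt xy; rewrite yx.
have p1 : 0 < 1 + xi ^+ 2 by rewrite ltr_pwDl // sqr_ge0.
have p2 : 0 < 1 + x ^+ 2 by rewrite ltr_pwDl // sqr_ge0.
have -> : rho * d / ((rho - c) ^+ 2 + d ^+ 2) = t / (1 + x ^+ 2).
  rewrite /t /x; field; rewrite (gt_eqF d0) /= gt_eqF //.
  by rewrite ltr_pwDl // ?sqr_ge0 // exprn_gt0.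
have -> : (1 + xi ^+ 2)^-1 * (eps * t) - eps * (t / (1 + x ^+ 2)) =
  eps * t * (x - xi) * (x + xi) / (1 + xi ^+ 2) / (1 + x ^+ 2).
  by field; rewrite !gt_eqF.
rewrite !normrM !normfV !(gtr0_norm p1) !(gtr0_norm p2) (ger0_norm e0) (gtr0_norm r0) (gtr0_norm d0) -/t.
rewrite !ler_pdivrMr //.
have hc : c / d <= k by rewrite -ck ler_norm.
have n1 : `|x - xi| <= eps * t by rewrite -yx ler_norml; apply/andP; split; lra.
have n2 : `|x + xi| <= 2 * `|xi| + k.
  have i1 := ler_norm xi; have i2 : - xi <= `|xi| by rewrite -normrN ler_norm.
  by rewrite ler_norml; apply/andP; split; lra.
have n3 : 2 * `|xi| + k <= (1 + k) * (1 + xi ^+ 2).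
  have : `|xi| ^+ 2 = xi ^+ 2 by rewrite real_normK ?num_real.
  have := sqr_ge0 (`|xi| - 1); have := sqr_ge0 xi; nra.
have n4 : t ^+ 2 <= 2 * (1 + k ^+ 2) * (1 + x ^+ 2).
  have tx : t <= `|x| + k by have := ler_norm x; lra.
  have : t ^+ 2 <= (`|x| + k) ^+ 2 by rewrite ler_sqr ?nnegrE ?(ltW t0) ?addr_ge0.
  have e2 : `|x| ^+ 2 = x ^+ 2 by rewrite real_normK ?num_real.
  have hk := sqr_ge0 (`|x| - k); have h0 : 0 <= k ^+ 2 * x ^+ 2 by rewrite mulr_ge0 ?sqr_ge0.
  have : (`|x| + k) ^+ 2 + (`|x| - k) ^+ 2 = 2 * x ^+ 2 + 2 * k ^+ 2.
    by rewrite -e2; ring.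
  by lra.
have m1 : eps * t * `|x - xi| <= (eps * t) ^+ 2.
  by rewrite [leRHS]expr2 ler_wpM2l // mulr_ge0 // ltW.
have m2 := le_trans n2 n3.
have m3 : 0 <= eps * t * `|x - xi| by exact: mulr_ge0 (mulr_ge0 e0 (ltW t0)) (normr_ge0 _).
apply: le_trans (ler_pM m3 (normr_ge0 _) m1 m2) _.
have n5 := ler_wpM2l (sqr_ge0 eps) n4.
have A0 : 0 <= (1 + k) * (1 + xi ^+ 2) by rewrite mulr_ge0 ?addr_ge0 // ?sqr_ge0.
have := ler_wpM2r A0 n5; rewrite -exprMn => n6; apply: le_trans n6 _.
by rewrite le_eqVlt; apply/orP; left; apply/eqP; ring.
Qed.

End RealLemmas.

Section Grid.
Variable R : realType.

Definition eix (phi : R) : R[i] := Complex (cos phi) (sin phi).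

Lemma eixD (a b : R) : eix (a + b) = eix a * eix b.
Proof. by rewrite /eix; simpc; rewrite cosD sinD (addrC (sin a * _)). Qed.

Lemma cmod_eix a : cmod (eix a) = 1.
Proof. by rewrite /cmod /= cos2Dsin2 sqrtr1. Qed.

Lemma cmod_eix_sub1 (h : R) : 0 <= h -> cmod (eix h - 1) <= 2 * h.
Proof.
move=> h0; have -> : eix h - 1 = (cos h - 1)%:C + 'i * (sin h)%:C.
  by rewrite /eix; apply/eqP; rewrite eq_complex /= !mul0r !mul1r !subr0 ?add0r ?addr0 !eqxx.
apply: le_trans (cmodD _ _) _; rewrite cmodM !cmod_real.
have -> : cmod ('i : R[i]) = 1 by rewrite /cmod /= expr0n add0r expr1n sqrtr1.
by rewrite mul1r mulr_natl mulr2n lerD ?norm_cos_sub1_le ?norm_sin_le.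
Qed.

(* The radii grho nu j, j < gnum nu, form a geometric grid of ratio 1 + geps nu that
   runs from about e^(-nu/2) to about e^(nu/2). *)
Definition geps (nu : nat) : R := (2 * nu%:R ^+ 2)^-1.
Definition grho (nu j : nat) : R := (1 + geps nu) ^+ j / (1 + geps nu) ^+ (nu ^ 3).
Definition gnum (nu : nat) : nat := (2 * nu ^ 3)%N.

Lemma geps_gt0 nu : (0 < nu)%N -> 0 < geps nu.
Proof. by move=> n0; rewrite invr_gt0 mulr_gt0 // exprn_gt0 // ltr0n. Qed.

Lemma geps_le nu : (0 < nu)%N -> geps nu <= 2^-1.
Proof.
move=> n0; rewrite lef_pV2 ?posrE ?mulr_gt0 ?exprn_gt0 ?ltr0n //.
by rewrite ler_pMr // exprn_ege1 // ler1n.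
Qed.

Lemma grho_gt0 nu j : (0 < nu)%N -> 0 < grho nu j.
Proof.
by move=> n0; rewrite divr_gt0 // exprn_gt0 // addr_gt0 // geps_gt0.
Qed.

Lemma grhoS nu j : grho nu j.+1 = grho nu j * (1 + geps nu).
Proof. by rewrite /grho exprSr mulrAC. Qed.

Lemma bernoulli_le (x : R) n : 0 <= x -> 1 + n%:R * x <= (1 + x) ^+ n.
Proof.
move=> x0; elim: n => [|n ih]; first by rewrite mul0r addr0 expr0.
rewrite exprS; have h1 : 0 <= 1 + x by rewrite addr_ge0.
have := ler_wpM2l h1 ih; have : 0 <= n%:R * x * x by rewrite !mulr_ge0.
by rewrite -[in X in _ -> _ -> X]natr1; lra.
Qed.

(** Bernoulli's inequality gives only linear growth of the largest radius, which is enough for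
    errors of order 1 / nu. *)
Lemma grho_last_ge nu : (0 < nu)%N -> nu%:R / 2 <= grho nu (gnum nu).
Proof.
move=> n0; have e0 := geps_gt0 n0.
rewrite /grho /gnum mul2n -addnn exprD mulfK; last first.
  by rewrite expf_neq0 // gt_eqF // addr_gt0.
apply: le_trans (bernoulli_le _ (ltW e0)); rewrite natrX /geps.
have n1 : nu%:R != 0 :> R by rewrite pnatr_eq0 -lt0n.
have -> : nu%:R ^+ 3 * (2 * nu%:R ^+ 2)^-1 = nu%:R / 2 :> R by field.
by rewrite lerDr.
Qed.

Lemma grho_first nu : (0 < nu)%N -> grho nu 0 = (grho nu (gnum nu))^-1.
Proof.
move=> n0; have e0 := geps_gt0 n0.
rewrite /grho /gnum mul2n -addnn exprD mulfK ?mul1r //.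
by rewrite expf_neq0 // gt_eqF // addr_gt0.
Qed.

Lemma grho_lastV_le nu : (0 < nu)%N -> (grho nu (gnum nu))^-1 <= 2 / nu%:R.
Proof.
move=> n0; have -> : 2 / nu%:R = (nu%:R / 2)^-1 :> R by rewrite invf_div.
by rewrite lef_pV2 ?posrE ?grho_gt0 ?divr_gt0 ?ltr0n // grho_last_ge.
Qed.

(** This balance fixes the grid: the range of radii grows with nu while the quadratic remainders of
    all cells still add up to O(1 / nu). *)
Lemma gnum_eps nu : (0 < nu)%N -> (gnum nu)%:R * geps nu ^+ 2 = 2^-1 / nu%:R :> R.
Proof.
move=> n0; have n1 : nu%:R != 0 :> R by rewrite pnatr_eq0 -lt0n.
by rewrite /gnum natrM natrX /geps; field.
Qed.

Lemma atan_sum_end (c d : R) : 0 <= c -> 0 < d -> exists2 K, 0 <= K &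
  forall b, 0 < b -> `|atan ((b - c) / d) + atan ((b + c) / d) - pi| <= K / b.
Proof.
move=> c0 d0; have p0 := pi_ge0 R; exists (3 * d + 4 * pi * c).
  by rewrite addr_ge0 // !mulr_ge0 // ltW.
move=> b b0; have l1 := atan_gtNpi2 ((b - c) / d); have l2 := atan_gtNpi2 ((b + c) / d).
have u1 := atan_ltpi2 ((b - c) / d); have u2 := atan_ltpi2 ((b + c) / d).
have pp : pi = 2 * (pi / 2) :> R by field.
rewrite ler0_norm; last by lra.
(* For b <= 2 c the gap is at most 2 pi <= 4 pi c / b. For larger b both arguments are positive with
   b - c >= b / 2, and the gaps to pi / 2 are at most 2 d / b and d / b. *)
have [bc|bc] := leP b (2 * c).
  rewrite ler_pdivlMr //.
  have h : 2 * pi * b <= 2 * pi * (2 * c) by rewrite ler_wpM2l // mulr_ge0.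
  have : (2 * pi - - (atan ((b - c) / d) + atan ((b + c) / d) - pi)) * b >= 0.
    by rewrite mulr_ge0 ?(ltW b0) //; lra.
  by have := ltW d0; lra.
have y1 : 0 < (b - c) / d by rewrite divr_gt0 //; lra.
have y2 : 0 < (b + c) / d by rewrite divr_gt0 //; lra.
have h1 := atan_ge_pihalf y1; have h2 := atan_ge_pihalf y2.
have k1 : ((b - c) / d)^-1 <= 2 * d / b.
  by rewrite invf_div ler_pdivlMr // mulrAC ler_pdivrMr; [have := ltW d0; nra | by rewrite -subr_gt0; lra].
have k2 : ((b + c) / d)^-1 <= d / b.
  by rewrite invf_div ler_pdivlMr // mulrAC ler_pdivrMr; [have := ltW d0; nra | by rewrite -subr_gt0; lra].
have k3 : 0 <= 4 * pi * c / b by rewrite divr_ge0 ?(ltW b0) // !mulr_ge0.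
have -> : (3 * d + 4 * pi * c) / b = 2 * d / b + d / b + 4 * pi * c / b by ring.
have h5 := le_trans (lerB (lexx (pi / 2)) k1) h1.
have h6 := le_trans (lerB (lexx (pi / 2)) k2) h2.
lra.
Qed.

(** A Riemann sum in log rho that telescopes, up to quadratic remainders, to the increment of atan
    ((rho - c) / d) + atan ((rho + c) / d). Pairing c with - c makes this vanish at rho = 0, so that
    the limit is pi whatever c and d are. *)
Lemma radial_pi (c d : R) : 0 <= c -> 0 < d -> exists2 K, 0 <= K & forall nu, (0 < nu)%N ->
  `|\sum_(j < gnum nu) geps nu *
     (grho nu j * d / ((grho nu j - c) ^+ 2 + d ^+ 2) +
      grho nu j * d / ((grho nu j + c) ^+ 2 + d ^+ 2)) - pi| <= K / nu%:R.
Proof.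
move=> c0 d0; have [K1 K10 h1] := atan_step c d0; have [K2 K20 h2] := atan_step (- c) d0.
have [K3 K30 h3] := atan_sum_end c0 d0.
exists ((K1 + K2) / 2 + 2 * K3 + 4 / d).
  by rewrite !addr_ge0 ?divr_ge0 ?mulr_ge0 ?addr_ge0 // ltW.
move=> nu n0; have e0 := geps_gt0 n0.
pose Psi t := atan ((t - c) / d) + atan ((t + c) / d).
set S := \sum_(_ < _) _.
have tel : Psi (grho nu (gnum nu)) - Psi (grho nu 0) =
    \sum_(j < gnum nu) (Psi (grho nu j.+1) - Psi (grho nu j)).
  by rewrite -(telescope_sumr (fun j => Psi (grho nu j))) // big_mkord.
have b1 : `|S - (Psi (grho nu (gnum nu)) - Psi (grho nu 0))| <= (K1 + K2) / 2 / nu%:R.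
  rewrite tel /S -sumrB; apply: le_trans (ler_norm_sum _ _ _) _.
  apply: le_trans (_ : \sum_(j < gnum nu) (K1 + K2) * geps nu ^+ 2 <= _); last first.
    rewrite sumr_const card_ord -[X in X <= _]mulr_natl.
    by rewrite [X in X <= _]mulrCA gnum_eps // mulrA.
  apply: ler_sum => j _; have r0 := grho_gt0 j n0.
  have := h1 _ _ r0 (ltW e0); have := h2 _ _ r0 (ltW e0).
  rewrite /Psi grhoS !opprK; set a1 := atan _; set a2 := atan _.
  set a3 := atan _; set a4 := atan _.
  move=> q2 q1; rewrite -normrN.
  apply: le_trans (_ : `|(a3 - a4 - geps nu * (grho nu j * d / ((grho nu j - c) ^+ 2 + d ^+ 2)))
    + (a1 - a2 - geps nu * (grho nu j * d / ((grho nu j + c) ^+ 2 + d ^+ 2)))| <= _).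
    by rewrite le_eqVlt; apply/orP; left; apply/eqP; congr `|_|; ring.
  by apply: le_trans (ler_normD _ _) _; rewrite [leRHS]mulrDl; exact: lerD.
have b0 := grho_gt0 (gnum nu) n0; have bV := grho_lastV_le n0.
have b2 : `|Psi (grho nu (gnum nu)) - pi| <= 2 * K3 / nu%:R.
  apply: le_trans (h3 _ b0) _.
  by rewrite (mulrC 2) -mulrA ler_wpM2l.
have b3 : `|Psi (grho nu 0)| <= 4 / d / nu%:R.
  rewrite /Psi grho_first //; move: bV; set a := _^-1 => aV.
  have a0 : 0 < a by rewrite invr_gt0.
  have -> : (a - c) / d = - ((c - a) / d) by rewrite -mulNr opprB.
  rewrite atanN; have hl : (c - a) / d <= (a + c) / d by rewrite ler_pM2r ?invr_gt0 //; lra.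
  have := atan_lip hl; have := hl; rewrite -subr_ge0 => hl' hh.
  have mono : atan ((c - a) / d) <= atan ((a + c) / d) by exact: le_atan.
  rewrite ger0_norm; last by lra.
  apply: le_trans (_ : (a + c) / d - (c - a) / d <= _); first by lra.
  have -> : (a + c) / d - (c - a) / d = 2 / d * a by field; rewrite gt_eqF.
  have -> : 4 / d / nu%:R = 2 / d * (2 / nu%:R) :> R.
    by field; rewrite (gt_eqF d0) pnatr_eq0 -lt0n n0.
  by rewrite ler_wpM2l // divr_ge0 // ltW.
have -> : S - pi = (S - (Psi (grho nu (gnum nu)) - Psi (grho nu 0))) +
  (Psi (grho nu (gnum nu)) - pi) - Psi (grho nu 0) by ring.
have -> : ((K1 + K2) / 2 + 2 * K3 + 4 / d) / nu%:R =
  (K1 + K2) / 2 / nu%:R + 2 * K3 / nu%:R + 4 / d / nu%:R by rewrite !mulrDl.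
apply: le_trans (ler_normB _ _) (lerD _ b3).
by apply: le_trans (ler_normD _ _) (lerD b1 b2).
Qed.

End Grid.

Section DiscreteCauchy.
Variables (R : realType) (theta : R).
Hypothesis theta_bd : 0 < theta < pi / 2.

Let delta := cos theta.

Lemma cos_theta_gt0 : 0 < cos theta.
Proof.
have /andP[h1 h2] := theta_bd; apply: cos_gt0_pihalf; rewrite h2 andbT.
by apply: lt_trans h1; rewrite oppr_lt0; apply: divr_gt0 => //; exact: pi_gt0.
Qed.

Lemma sin_theta_gt0 : 0 < sin theta.
Proof. exact: sin_gt0_pihalf. Qed.

Lemma sect_eix (rho phi : R) : 0 < rho -> `|phi| <= theta -> sect delta (rho%:C * eix phi).
Proof.
move=> r0 hphi; split.
  by rewrite -cmod_eq0 cmod_realM cmod_eix mulr1 gtr0_norm // gt_eqF.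
rewrite cmod_realM cmod_eix mulr1 gtr0_norm // creMreal mulrC ler_wpM2l ?(ltW r0) //=.
rewrite -(cos_norm phi) leNgt ltr_cos -?leNgt // in_itv /=.
  have /andP[h1 h2] := theta_bd; rewrite (ltW h1) (le_trans (ltW h2)) //.
  by rewrite ler_pdivrMr // ler_peMr ?pi_ge0 // ler1n.
rewrite normr_ge0 (le_trans hphi) //.
have /andP[h1 h2] := theta_bd; rewrite (le_trans (ltW h2)) //.
by rewrite ler_pdivrMr // ler_peMr ?pi_ge0 // ler1n.
Qed.

(** A Riemann sum for the integral of H(rho e^(i phi)) d rho / rho. *)
Definition radial (H : R[i] -> R[i]) (nu : nat) (phi : R) : R[i] :=
  (geps R nu)%:C * \sum_(j < gnum nu) H ((grho R nu j)%:C * eix phi).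

(* The rotation of the ray by a small angle changes the radial sum only at its
   two ends, up to a third-order error in the mesh width. *)
Lemma radial_step (H : R[i] -> R[i]) (H' : R[i] -> R[i]) (C B : R) nu phi h :
  (0 < nu)%N -> 0 <= C -> 0 <= B ->
  (forall z, sect delta z -> [/\ cmod (H z) <= C, cmod (H' z) <= C &
    forall u, sect delta (u * z) -> cmod (u - 1) <= 2^-1 ->
      cmod (H (u * z) - H z - (u - 1) * H' z) <= C * cmod (u - 1) ^+ 2]) ->
  (forall z, sect delta z -> cmod z * cmod (H z) <= B /\ cmod (H z) <= B * cmod z) ->
  0 <= h -> 2 * h <= geps R nu -> `|phi| <= theta -> `|phi + h| <= theta ->
  cmod (radial H nu (phi + h) - radial H nu phi) <= geps R nu * ((4 * B + C) / nu%:R).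
Proof.
move=> n0 C0 B0 hH hB h0 heps p1 p2; have e0 := geps_gt0 R n0; have e1 := geps_le R n0.
set e := geps R nu in e0 e1 heps *; pose w := eix h.
pose z j := (grho R nu j)%:C * eix phi.
have zs j : sect delta (z j) by apply: sect_eix => //; exact: grho_gt0.
have wz j : w * z j = (grho R nu j)%:C * eix (phi + h).
  by rewrite /w /z mulrCA eixD (mulrC (eix h)).
have wzs j : sect delta (w * z j).
  by rewrite wz; apply: sect_eix => //; exact: grho_gt0.
have qz j : (1 + e)%:C * z j = z j.+1 by rewrite /z grhoS -/e [in RHS]rmorphM /=; ring.
have w1 : cmod (w - 1) <= e by apply: le_trans heps; exact: cmod_eix_sub1.
have q1 : (1 + e)%:C - 1 = e%:C by rewrite rmorphD /= addrAC subrr add0r.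
have bz j : cmod (z j) = grho R nu j.
  by rewrite /z cmod_realM cmod_eix mulr1 gtr0_norm // grho_gt0.
(* A discrete Cauchy-Riemann equation: rotation by w and dilation by 1 + e expand with the same
   derivative H', so the cross-multiplied increments agree to third order, and the dilation
   increments telescope. *)
have stp (j : nat) : cmod (e%:C * (H (w * z j) - H (z j)) - (w - 1) * (H (z j.+1) - H (z j)))
    <= 2 * C * e ^+ 3.
  have [_ _ hz] := hH _ (zs j).
  have a1 := hz _ (wzs j) (le_trans w1 e1).
  have a2 : cmod (H (z j.+1) - H (z j) - e%:C * H' (z j)) <= C * e ^+ 2.
    have := hz (1 + e)%:C; rewrite qz q1 cmod_real gtr0_norm //; apply => //.
  rewrite (_ : _ - _ = e%:C * (H (w * z j) - H (z j) - (w - 1) * H' (z j)) -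
     (w - 1) * (H (z j.+1) - H (z j) - e%:C * H' (z j))); last by ring.
  apply: le_trans (cmodB _ _) _; rewrite !cmodM cmod_real gtr0_norm //.
  have b1 : e * cmod (H (w * z j) - H (z j) - (w - 1) * H' (z j)) <= e * (C * e ^+ 2).
    rewrite ler_wpM2l ?(ltW e0) //; apply: le_trans a1 _.
    by rewrite ler_wpM2l // ler_sqr ?nnegrE ?cmod_ge0 ?(ltW e0).
  have b2 : cmod (w - 1) * cmod (H (z j.+1) - H (z j) - e%:C * H' (z j)) <= e * (C * e ^+ 2).
    by apply: ler_pM => //; exact: cmod_ge0.
  by apply: le_trans (lerD b1 b2) _; rewrite le_eqVlt; apply/orP; left; apply/eqP; ring.
have nuV : 0 <= nu%:R^-1 :> R by rewrite invr_ge0.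
have last_b : cmod (H (z (gnum nu))) <= 2 * B / nu%:R.
  have [+ _] := hB _ (zs (gnum nu)); rewrite bz => hb.
  have r0 := grho_gt0 R (gnum nu) n0; have rl := grho_lastV_le R n0.
  rewrite mulrC -ler_pdivlMr // in hb; apply: le_trans hb _.
  by rewrite (mulrC 2) -mulrA ler_wpM2l.
have first_b : cmod (H (z 0%N)) <= 2 * B / nu%:R.
  have [_] := hB _ (zs 0%N); rewrite bz grho_first // => hb; apply: le_trans hb _.
  by rewrite (mulrC 2) -mulrA ler_wpM2l // grho_lastV_le.
have -> : radial H nu (phi + h) - radial H nu phi =
  \sum_(j < gnum nu) (e%:C * (H (w * z j) - H (z j)) - (w - 1) * (H (z j.+1) - H (z j)))
  + (w - 1) * (H (z (gnum nu)) - H (z 0%N)).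
  have -> : H (z (gnum nu)) - H (z 0%N) = \sum_(j < gnum nu) (H (z j.+1) - H (z j)).
    by rewrite -(telescope_sumr (fun j => H (z j))) // big_mkord.
  rewrite mulr_sumr -big_split /= /radial -/e !mulr_sumr -sumrB.
  by apply: eq_bigr => j _; rewrite wz subrK mulrBr.
have -> : e * ((4 * B + C) / nu%:R) = e * (C / nu%:R) + e * (4 * B / nu%:R) by ring.
apply: le_trans (cmodD _ _) _; apply: lerD; last first.
  rewrite cmodM; apply: le_trans (ler_pM (cmod_ge0 _) (cmod_ge0 _) w1 (cmodB _ _)) _.
  rewrite ler_wpM2l ?(ltW e0) //; apply: le_trans (lerD last_b first_b) _.
  by rewrite le_eqVlt; apply/orP; left; apply/eqP; ring.
apply: le_trans (cmod_sum _ _ _) _.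
apply: le_trans (ler_sum _ (fun (j : 'I_(gnum nu)) _ => stp j)) _.
rewrite sumr_const card_ord -[X in X <= _]mulr_natl.
have := gnum_eps R n0; rewrite -/e => hg.
have -> : (gnum nu)%:R * (2 * C * e ^+ 3) = 2 * C * e * ((gnum nu)%:R * e ^+ 2) by ring.
by rewrite hg le_eqVlt; apply/orP; left; apply/eqP; field; rewrite pnatr_eq0 -lt0n.
Qed.

Lemma radial_rotate (H : R[i] -> R[i]) (B : R) : 0 <= B -> smooth2 delta H ->
  (forall z, sect delta z -> cmod z * cmod (H z) <= B /\ cmod (H z) <= B * cmod z) ->
  exists2 K, 0 <= K & forall nu, (0 < nu)%N ->
    cmod (radial H nu theta - radial H nu (- theta)) <= K / nu%:R.
Proof.
move=> B0 [H' [C [C0 hH]]] hB; exists (8 * (4 * B + C)).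
  by rewrite mulr_ge0 // addr_ge0 // mulr_ge0.
have /andP[t0 t1] := theta_bd.
(* Since theta < 2, this many rotations satisfy 2 h <= geps nu. As n times geps nu is 8, the n
   single errors add up to O(1 / nu). *)
move=> nu n0; pose n := (16 * nu ^ 2)%N; pose h := 2 * theta / n%:R.
have n1 : nu%:R != 0 :> R by rewrite pnatr_eq0 -lt0n.
have nn : n%:R != 0 :> R by rewrite pnatr_eq0 -lt0n /n muln_gt0 expn_gt0 n0.
have nn0 : 0 < n%:R :> R by rewrite lt_def nn /=.
have h0 : 0 <= h by rewrite divr_ge0 ?(ltW nn0) // mulr_ge0 // ltW.
have he : 2 * h <= geps R nu.
  have -> : geps R nu = 8 / n%:R by rewrite /geps /n natrM natrX; field.
  rewrite /h mulrA ler_pM2r ?invr_gt0 //.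
  by have := pihalf_lt2 R; move: t1; set p := pi / 2; lra.
pose phi k := - theta + k%:R * h.
have phin : phi n = theta by rewrite /phi /h; field.
have phi0 : phi 0%N = - theta by rewrite /phi mul0r addr0.
have phib k : (k <= n)%N -> `|phi k| <= theta.
  move=> kn; have kn' : k%:R <= n%:R :> R by rewrite ler_nat.
  have k1 : 0 <= k%:R * h by rewrite mulr_ge0.
  have k2 : k%:R * h <= 2 * theta.
    by rewrite /h mulrCA -[leRHS]mulr1 ler_wpM2l ?ler_pdivrMr ?mul1r // mulr_ge0 // ltW.
  by rewrite /phi ler_norml; apply/andP; split; lra.
have phiS k : phi k.+1 = phi k + h by rewrite /phi -natr1; ring.
suff : cmod (radial H nu (phi n) - radial H nu (phi 0%N)) <= 8 * (4 * B + C) / nu%:R.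
  by rewrite phin phi0.
have -> : radial H nu (phi n) - radial H nu (phi 0%N) =
  \sum_(k < n) (radial H nu (phi k.+1) - radial H nu (phi k)).
  by rewrite -(telescope_sumr (fun k => radial H nu (phi k))) // big_mkord.
apply: le_trans (cmod_sum _ _ _) _.
apply: le_trans (_ : \sum_(k < n) geps R nu * ((4 * B + C) / nu%:R) <= _).
  apply: ler_sum => k _; rewrite phiS; apply: radial_step hH hB h0 he _ _ => //.
    by apply: phib; exact: ltnW.
  by rewrite -phiS; exact: phib.
rewrite sumr_const card_ord -[X in X <= _]mulr_natl mulrA.
have -> : n%:R * geps R nu = 8 by rewrite /geps /n natrM natrX; field.
by rewrite mulrA.
Qed.

(** The contour counterclockwise around lam goes out along - theta and back along theta; the factor
    i / (2 pi) = - 1 / (2 pi i) accounts for the opposite order of the difference. The factor z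
    compensates d rho / rho. *)
Definition cauchy_sum (F : R[i] -> R[i]) (nu : nat) (lam : R) : R[i] :=
  (2 * pi)^-1%:C * 'i * (radial (fun z => z * F z / (z - lam%:C)) nu theta -
                     radial (fun z => z * F z / (z - lam%:C)) nu (- theta)).

(** K has the same simple pole at lam as z / (z - lam) but vanishes at 0 and at infinity. On
    conjugate rays the products of its denominators are |z - lam|^2 and |z + lam|^2, which yields
    the integrand of [radial_pi]. *)
Lemma kernel_diff (lam rho : R) : 0 < lam -> 0 < rho ->
  let d := lam * sin theta in let c := lam * cos theta in
  let K z := z / (z - lam%:C) - z / (z + lam%:C) in
  K (rho%:C * eix theta) - K (rho%:C * eix (- theta)) =
  - (2 *: 'i) * (rho * d / ((rho - c) ^+ 2 + d ^+ 2) +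
                 rho * d / ((rho + c) ^+ 2 + d ^+ 2))%:C.
Proof.
move=> l0 r0 d c K; have s0 := sin_theta_gt0; have d0 : 0 < d by rewrite mulr_gt0.
have D1 : 0 < (rho - c) ^+ 2 + d ^+ 2 by rewrite ltr_wpDl ?sqr_ge0 // exprn_gt0.
have D2 : 0 < (rho + c) ^+ 2 + d ^+ 2 by rewrite ltr_wpDl ?sqr_ge0 // exprn_gt0.
have c1 : cos theta ^+ 2 = 1 - sin theta ^+ 2 by rewrite -(cos2Dsin2 theta); ring.
set z := rho%:C * eix theta; set zb := rho%:C * eix (- theta).
have p1 : (z - lam%:C) * (zb - lam%:C) = ((rho - c) ^+ 2 + d ^+ 2)%:C.
  apply/eqP; rewrite eq_complex /z /zb /eix /= cosN sinN /c /d; apply/andP; split; apply/eqP; last by ring.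
  by ring: c1.
have p2 : (z + lam%:C) * (zb + lam%:C) = ((rho + c) ^+ 2 + d ^+ 2)%:C.
  apply/eqP; rewrite eq_complex /z /zb /eix /= cosN sinN /c /d; apply/andP; split; apply/eqP; last by ring.
  by ring: c1.
have zz : lam%:C * (z - zb) = (2 *: 'i) * (rho * d)%:C.
  by apply/eqP; rewrite eq_complex /z /zb /eix /= cosN sinN /d; apply/andP; split; apply/eqP; ring.
have n1 : z - lam%:C != 0.
  apply/eqP => h; move: p1; rewrite h mul0r => /eqP; rewrite eq_complex /= eqxx andbT eq_sym.
  by rewrite gt_eqF.
have n2 : zb - lam%:C != 0.
  apply/eqP => h; move: p1; rewrite h mulr0 => /eqP; rewrite eq_complex /= eqxx andbT eq_sym.
  by rewrite gt_eqF.
have n3 : z + lam%:C != 0.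
  apply/eqP => h; move: p2; rewrite h mul0r => /eqP; rewrite eq_complex /= eqxx andbT eq_sym.
  by rewrite gt_eqF.
have n4 : zb + lam%:C != 0.
  apply/eqP => h; move: p2; rewrite h mulr0 => /eqP; rewrite eq_complex /= eqxx andbT eq_sym.
  by rewrite gt_eqF.
have -> : K z - K zb = - (lam%:C * (z - zb)) * (((z - lam%:C) * (zb - lam%:C))^-1 +
   ((z + lam%:C) * (zb + lam%:C))^-1).
  by rewrite /K; field; rewrite n1 n2 n3 n4.
rewrite p1 p2 zz; set X := _ + _ ^+ 2; set Y := _ + _ ^+ 2.
have -> : (rho * d / X + rho * d / Y)%:C = (rho * d)%:C * (X%:C^-1 + Y%:C^-1).
  by rewrite rmorphD mulrDr !(rmorphM, fmorphV).
by rewrite !mulNr -(mulrA (2 *: 'i)).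
Qed.

Theorem discrete_cauchy (F : R[i] -> R[i]) (lam B : R) :
  0 < lam -> divdiff delta lam F ->
  (forall z, sect delta z -> cmod z * cmod (F z) <= B) ->
  exists2 K, 0 <= K & forall nu, (0 < nu)%N ->
    cmod (cauchy_sum F nu lam - F lam%:C) <= K / nu%:R.
Proof.
move=> l0 [sF [E [sE hE]]] hB.
have [CF CF0 bF] := smooth2_bound sF; have [CE CE0 bE] := smooth2_bound sE.
(* H equals z F / (z - lam) - F(lam) K, with the pole removed. Rotating the ray does not change the
   sums of H in the limit, so the Cauchy sum reduces to that of F(lam) K, which is known exactly. *)
pose H z := E z + F lam%:C * (z / (z + lam%:C)).
have d0 := cos_theta_gt0.
have sH : smooth2 delta H by apply: smooth2D => //; apply/smooth2Z/smooth2_id_inv.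
have [CH CH0 bH] := smooth2_bound sH.
have nl z : sect delta z -> z + lam%:C != 0 by move=> zs; exact: (sect_addr_neq0 d0).
have hH z : sect delta z -> (z - lam%:C) * H z =
    z * F z - F lam%:C * (2 * lam%:C * (z / (z + lam%:C))).
  move=> zs; rewrite /H mulrDr -hE //; field; exact: nl.
set f := cmod (F lam%:C); have f0 : 0 <= f := cmod_ge0 _.
have hz1 z : sect delta z -> cmod (z / (z + lam%:C)) <= 1.
  move=> zs; rewrite cmodM cmodV ler_pdivrMr ?cmod_gt0 ?nl // mul1r.
  exact: (sect_addl_ge d0).
have hz2 z : sect delta z -> lam * cmod (z / (z + lam%:C)) <= cmod z.
  move=> zs; rewrite cmodM cmodV mulrCA ler_piMr ?cmod_ge0 //.
  by rewrite ler_pdivrMr ?cmod_gt0 ?nl // mul1r (sect_addr_ge d0).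
have clam : cmod lam%:C = lam by rewrite cmod_real gtr0_norm.
have B0 : 0 <= B.
  have zs := sect_eix ltr01 (_ : `|0| <= theta); apply: le_trans (hB _ (zs _)).
    by rewrite mulr_ge0 ?cmod_ge0.
  by rewrite normr0; case/andP: theta_bd => /ltW.
(* Decay at infinity comes from |z| |F| <= B, decay at 0 from (z - lam) H = O(z); both are read off
   from [hH], after trading z - lam for z or for - lam. *)
have hfin : exists2 B', 0 <= B' & forall z, sect delta z ->
    cmod z * cmod (H z) <= B' /\ cmod (H z) <= B' * cmod z.
  exists (B + 2 * f * lam + lam * CH + (CF + 2 * f + CH) / lam).
    by rewrite !addr_ge0 ?divr_ge0 ?addr_ge0 ?mulr_ge0 // ltW.
  move=> z zs; have m0 := cmod_ge0 z.
  have t1 : 0 <= lam * CH by rewrite mulr_ge0 // ltW.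
  have t2 : 0 <= (CF + 2 * f + CH) / lam by rewrite divr_ge0 ?addr_ge0 ?mulr_ge0 // ltW.
  have t3 : 0 <= 2 * f * lam by rewrite !mulr_ge0 // ltW.
  have e1 : cmod ((z - lam%:C) * H z) <= cmod (z * F z) + f * (2 * (lam * cmod (z / (z + lam%:C)))).
    rewrite hH //; apply: le_trans (cmodB _ _) _; rewrite lerD2l 3!cmodM clam -/f.
    by rewrite ler_wpM2l // (_ : 2 = (2 : R)%:C) ?cmod_real ?gtr0_norm ?mulrA // rmorph_nat.
  split.
    have : cmod (z * H z) <= cmod ((z - lam%:C) * H z) + lam * CH.
      have -> : z * H z = (z - lam%:C) * H z + lam%:C * H z by ring.
      apply: le_trans (cmodD _ _) _; rewrite lerD2l cmodM clam.
      by rewrite ler_wpM2l ?bH // ltW.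
    rewrite -cmodM => e2; apply: le_trans e2 _.
    have e3 := hB _ zs; rewrite -cmodM in e3.
    have e4 : f * (2 * (lam * cmod (z / (z + lam%:C)))) <= 2 * f * lam.
      rewrite mulrA (mulrC f) ler_wpM2l ?mulr_ge0 // -[leRHS]mulr1.
      by rewrite ler_wpM2l ?hz1 // ltW.
    lra.
  have e5 : lam * cmod (H z) <= (CF + 2 * f + CH) * cmod z.
    have : cmod (lam%:C * H z) <= cmod z * CH + cmod ((z - lam%:C) * H z).
      have -> : lam%:C * H z = z * H z - (z - lam%:C) * H z by ring.
      by apply: le_trans (cmodB _ _) _; rewrite lerD2r cmodM ler_wpM2l ?bH.
    rewrite cmodM clam => e6; apply: le_trans e6 _.
    have e7 : cmod (z * F z) <= cmod z * CF by rewrite cmodM ler_wpM2l ?bF.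
    have e8 : f * (2 * (lam * cmod (z / (z + lam%:C)))) <= f * (2 * cmod z).
      by rewrite !ler_wpM2l // hz2.
    lra.
  rewrite mulrC -ler_pdivlMr // in e5; apply: le_trans e5 _.
  by rewrite mulrAC ler_wpM2r // lerDr !addr_ge0.
have [B' B'0 hB'] := hfin.
have [K1 K10 h1] := radial_rotate B'0 sH hB'.
have s0 := sin_theta_gt0; have c0 := d0.
have [K2 K20 h2] := @radial_pi R (lam * cos theta) (lam * sin theta)
   (ltW (mulr_gt0 l0 c0)) (mulr_gt0 l0 s0).
have p0 := pi_gt0 R.
exists ((K1 + 2 * f * K2) / (2 * pi)).
  by rewrite divr_ge0 ?addr_ge0 ?mulr_ge0 // ltW.
move=> nu n0; have e0 := geps_gt0 R n0.
have h2' := h2 _ n0; set PS := \sum_(j < _) _ in h2'.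
pose Kz z : R[i] := z / (z - lam%:C) - z / (z + lam%:C).
have thb : `|theta| <= theta by rewrite ger0_norm //; case/andP: theta_bd => /ltW.
have thb' : `|- theta| <= theta by rewrite normrN.
have nl2 z : sect delta z -> cim z != 0 -> z - lam%:C != 0.
  by move=> _; apply: contra => /eqP/(congr1 (@cim R)); case: z => a b /=; rewrite subr0 => ->.
have HK z : sect delta z -> cim z != 0 -> H z = z * F z / (z - lam%:C) - F lam%:C * Kz z.
  move=> zs iz; have n1 := nl2 _ zs iz; have n2 := nl _ zs.
  apply: (mulfI n1); rewrite hH // /Kz; field; by rewrite n1 n2.
have im1 j : cim ((grho R nu j)%:C * eix theta) != 0.
  by rewrite /= mul0r addr0 gt_eqF // mulr_gt0 // grho_gt0.
have im2 j : cim ((grho R nu j)%:C * eix (- theta)) != 0.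
  by rewrite /= mul0r addr0 sinN mulrN oppr_eq0 gt_eqF // mulr_gt0 // grho_gt0.
pose X := radial (fun z => z * F z / (z - lam%:C)) nu theta -
   radial (fun z => z * F z / (z - lam%:C)) nu (- theta).
have eqX : radial H nu theta - radial H nu (- theta) = X + F lam%:C * (2 *: 'i) * PS%:C.
  have -> : F lam%:C * (2 *: 'i) * PS%:C =
     - (F lam%:C * (radial Kz nu theta - radial Kz nu (- theta))).
    have -> : radial Kz nu theta - radial Kz nu (- theta) = - (2 *: 'i) * PS%:C.
      rewrite /radial -mulrBr -sumrB /PS rmorph_sum !mulr_sumr; apply: eq_bigr => j _.
      rewrite (kernel_diff l0 (grho_gt0 R j n0) : Kz _ - Kz _ = _) (rmorphM _ (geps R nu)).
      by rewrite (mulrCA (- (2 *: 'i))).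
    by rewrite mulNr mulrN opprK -mulrA.
  have hr phi : (phi = theta \/ phi = - theta) -> radial H nu phi =
      radial (fun z => z * F z / (z - lam%:C)) nu phi - F lam%:C * radial Kz nu phi.
    move=> hphi; rewrite /radial mulrCA -mulrBr; congr (_ * _).
    rewrite mulr_sumr -sumrB; apply: eq_bigr => j _; apply: HK.
      by apply: sect_eix; [exact: grho_gt0 | case: hphi => ->].
    by case: hphi => ->.
  by rewrite !hr; [rewrite /X; ring | right | left].
have h1' := h1 _ n0.
have -> : cauchy_sum F nu lam - F lam%:C = (2 * pi)^-1%:C * 'i *
   (radial H nu theta - radial H nu (- theta) - F lam%:C * (2 *: 'i) * (PS - pi)%:C).
  rewrite eqX /cauchy_sum -/X rmorphB /=.
  have i2 : (2 *: 'i : R[i]) = 2 * 'i.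
    by apply/eqP; rewrite eq_complex /=; apply/andP; split; apply/eqP; ring.
  have ii : ('i : R[i]) * 'i = -1 by rewrite -expr2 sqr_i.
  have pv : (2 * pi)^-1%:C * (2 * pi%:C) = 1 :> R[i].
    have -> : 2 * pi%:C = (2 * pi)%:C :> R[i] by rewrite rmorphM rmorph_nat.
    by rewrite -rmorphM mulVf ?rmorph1 // gt_eqF // mulr_gt0.
  rewrite i2; set a := (2 * pi)^-1%:C in pv *; set F1 := F _.
  have -> : a * 'i * (X + F1 * (2 * 'i) * PS%:C - F1 * (2 * 'i) * (PS%:C - pi%:C)) =
    a * 'i * X + (a * (2 * pi%:C)) * F1 * ('i * 'i) by ring.
  by rewrite pv ii; ring.
rewrite 2!cmodM cmod_real.
have ci : cmod ('i : R[i]) = 1 by rewrite /cmod /= expr0n add0r expr1n sqrtr1.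
rewrite ci mulr1 gtr0_norm ?invr_gt0 ?mulr_gt0 //.
rewrite mulrC [leRHS]mulrAC ler_wpM2r ?invr_ge0 ?mulr_ge0 ?(ltW p0) //.
have c2 : cmod (2 *: 'i : R[i]) = 2.
  have -> : (2 *: 'i : R[i]) = Complex 0 2.
    by apply/eqP; rewrite eq_complex /=; apply/andP; split; apply/eqP; ring.
  by rewrite /cmod /= expr0n add0r sqrtr_sqr gtr0_norm.
have c3 : cmod (F lam%:C * (2 *: 'i) * (PS - pi)%:C) = 2 * f * `|PS - pi|.
  by rewrite cmodM (cmodM (F lam%:C)) c2 cmod_real -/f (mulrC f).
apply: le_trans (cmodB _ _) _; rewrite c3 [leRHS]mulrDl lerD // -[leRHS]mulrA.
by rewrite ler_wpM2l // mulr_ge0.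
Qed.

End DiscreteCauchy.

(** * The matrices of one time step *)

Section Hilbert.
Variable (R : realType).

Definition hilb n : 'M[R]_n := \matrix_(i, j) (i + j).+1%:R^-1.

Definition qform n (A : 'M[R]_n) (a : 'I_n -> R) : R :=
  \sum_i \sum_j A i j * (a i * a j).

(** This lets antiderivatives of polynomials take the place of integrals when positivity of the
    Hilbert matrix is shown. *)
Lemma poly_ge0_antideriv (P : {poly R}) x y : x <= y ->
  (forall t, 0 <= P^`().[t]) -> P.[x] <= P.[y].
Proof.
move=> xy h; have [//|t _ e] := @MVT_segment R (horner P) (horner P^`()) x y xy.
  by apply: continuous_subspaceT => t; exact: continuous_horner.
by rewrite -subr_ge0 e mulr_ge0 // subr_ge0.
Qed.

Lemma poly_eq0_itv01 (P : {poly R}) : (forall t, 0 <= t <= 1 -> P.[t] = 0) -> P = 0.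
Proof.
move=> h; apply: (@roots_geq_poly_eq0 _ _ [seq k.+1%:R^-1 | k <- iota 0 (size P)]).
- apply/allP => _ /mapP[k _ ->]; apply/eqP; apply: h.
  by rewrite invr_ge0 ler0n invf_le1 ?ltr0Sn // ler1n.
- rewrite map_inj_uniq ?iota_uniq // => i j /invr_inj/eqP.
  by rewrite eqr_nat => /eqP[].
- by rewrite size_map size_iota.
Qed.

(* The quadratic form of the Hilbert matrix is the integral over [0,1] of p^2. *)
Lemma qform_hilb_antideriv n (a : 'I_n -> R) :
  let p := \sum_i (a i)%:P * 'X^i in
  exists P : {poly R}, [/\ P^`() = p ^+ 2, P.[0] = 0 & P.[1] = qform (hilb n) a].
Proof.
move=> p; exists (\sum_i \sum_j (hilb n i j * (a i * a j))%:P * 'X^((i + j).+1)); split.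
- rewrite [LHS]raddf_sum expr2 {1}/p mulr_suml; apply: eq_bigr => i _.
  rewrite [LHS]raddf_sum /p mulr_sumr; apply: eq_bigr => j _; rewrite /=.
  rewrite derivM derivC mul0r add0r derivXn -mulr_natr mulrACA -exprD.
  rewrite mulrCA mulrC; congr (_ * _).
  rewrite -polyC_natr -polyCM -polyCM mxE; congr (_%:P).
  have : (i + j).+1%:R != 0 :> R by rewrite pnatr_eq0.
  by set N := _.+1%:R => N0; field.
- rewrite horner_sum big1 // => i _; rewrite horner_sum big1 // => j _.
  by rewrite hornerM hornerXn expr0n mulr0.
- rewrite horner_sum; apply: eq_bigr => i _; rewrite horner_sum; apply: eq_bigr => j _.
  by rewrite hornerM hornerXn hornerC expr1n mulr1.
Qed.

Lemma qform_hilb_ge0 n (a : 'I_n -> R) : 0 <= qform (hilb n) a.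
Proof.
have [P [dP P0 <-]] := qform_hilb_antideriv a; rewrite -P0.
apply: poly_ge0_antideriv => // t; rewrite dP hornerE; exact: sqr_ge0.
Qed.

Lemma qform_hilb_eq0 n (a : 'I_n -> R) : qform (hilb n) a = 0 -> forall i, a i = 0.
Proof.
have [P [dP P0 <-]] := qform_hilb_antideriv a; set p := (\sum_i _) in dP => P1 i.
have hP t : 0 <= P^`().[t] by rewrite dP hornerE; exact: sqr_ge0.
have Peq : P = 0.
  apply: poly_eq0_itv01 => t /andP[t0 t1]; apply: le_anti.
  by apply/andP; split; [rewrite -P1 | rewrite -P0]; exact: poly_ge0_antideriv.
have : p ^+ 2 = 0 by rewrite -dP Peq linear0.
move=> /eqP; rewrite expf_eq0 /= => /eqP p0.
have : p`_i = 0 by rewrite p0 coef0.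
rewrite /p coef_sum (bigD1 i) //= coefCM coefXn eqxx mulr1 big1 ?addr0 //.
move=> j ji; rewrite coefCM coefXn eq_sym (_ : (j == i :> nat) = false) ?mulr0 //.
exact/negbTE.
Qed.

Lemma mulmx_ker_unit (F : fieldType) n (A : 'M[F]_n) :
  (forall x : 'cV[F]_n, A *m x = 0 -> x = 0) -> A \in unitmx.
Proof.
move=> h; rewrite -unitmx_tr unitmxE unitfE; apply/det0P => -[v v0 hv].
move/eqP: v0; apply; apply: trmx_inj; rewrite trmx0; apply: h.
by apply: trmx_inj; rewrite trmx_mul trmxK hv trmx0.
Qed.

Lemma qformE n (A : 'M[R]_n) (x : 'cV[R]_n) :
  qform A (fun i => x i 0) = (x^T *m (A *m x)) 0 0.
Proof.
rewrite mxE; apply: eq_bigr => i _; rewrite !mxE mulr_sumr; apply: eq_bigr => j _.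
by ring.
Qed.

Lemma hilb_unit n : hilb n \in unitmx.
Proof.
apply: mulmx_ker_unit => x hx; apply/matrixP => i j; rewrite ord1 [RHS]mxE.
apply: (@qform_hilb_eq0 n (fun i => x i 0)).
by rewrite qformE hx mulmx0 mxE.
Qed.

Lemma hilb_sym n i j : hilb n i j = hilb n j i.
Proof. by rewrite !mxE addnC. Qed.

(* Cauchy-Schwarz for the form of W, applied to x and to W^-1 e_i. *)
Lemma hilb_coercive n : exists2 c : R, 0 < c &
  forall a : 'I_n -> R, c * \sum_i a i ^+ 2 <= qform (hilb n) a.
Proof.
set V := invmx (hilb n).
have hV i (a : 'I_n -> R) : a i ^+ 2 <= V i i * qform (hilb n) a.
  pose b t := a i * V t i.
  have key : forall k, \sum_j hilb n k j * V j i = (k == i)%:R.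
    move=> k; have := mulmxV (hilb_unit n) => /matrixP/(_ k i).
    by rewrite !mxE.
  have key2 : forall k, \sum_j hilb n j k * V j i = (k == i)%:R.
    by move=> k; rewrite -key; apply: eq_bigr => j _; rewrite hilb_sym.
  pose s : R := qform (hilb n) a.
  have Vii : V i i = qform (hilb n) (V ^~ i).
    rewrite /qform.
    transitivity (\sum_j V j i * \sum_k hilb n j k * V k i).
      rewrite (bigD1 i) //= key eqxx mulr1 big1 ?addr0 // => j ji.
      by rewrite key (negbTE ji) mulr0.
    by apply: eq_bigr => j _; rewrite mulr_sumr; apply: eq_bigr => k _; ring.
  have Vi0 : 0 < V i i.
    rewrite lt_neqAle Vii qform_hilb_ge0 andbT; apply/eqP => /esym h.
    have h0 := qform_hilb_eq0 h; have := key i; rewrite eqxx big1.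
      by move=> /eqP; rewrite eq_sym oner_eq0.
    by move=> j _; rewrite h0 mulr0.
  (* The minimizer of the form of a - t V e_i; since W V e_i = e_i, the cross term is a_i and the
     minimum is the form of a minus a_i^2 / V_ii. *)
  pose t := a i / V i i.
  have := qform_hilb_ge0 (fun k => a k - t * V k i).
  have -> : qform (hilb n) (fun k => a k - t * V k i) =
     qform (hilb n) a - 2 * t * a i + t ^+ 2 * V i i.
    have e1 : \sum_j \sum_k hilb n j k * (a j * V k i) = a i.
      transitivity (\sum_j a j * \sum_k hilb n j k * V k i).
        by apply: eq_bigr => j _; rewrite mulr_sumr; apply: eq_bigr => k _; ring.
      rewrite (bigD1 i) //= key eqxx mulr1 big1 ?addr0 // => j ji.
      by rewrite key (negbTE ji) mulr0.
    have e2 : \sum_j \sum_k hilb n j k * (V j i * a k) = a i.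
      rewrite exchange_big /= -[RHS]e1; apply: eq_bigr => j _; apply: eq_bigr => k _.
      by rewrite hilb_sym; ring.
    have -> : 2 * t * a i = t * (\sum_j \sum_k hilb n j k * (a j * V k i)) +
        t * (\sum_j \sum_k hilb n j k * (V j i * a k)) by rewrite e1 e2; ring.
    rewrite {1}Vii opprD addrA.
    transitivity (\sum_j (\sum_k hilb n j k * (a j * a k) -
      t * (\sum_k hilb n j k * (a j * V k i)) - t * (\sum_k hilb n j k * (V j i * a k)) +
      t ^+ 2 * (\sum_k hilb n j k * (V j i * V k i)))).
      apply: eq_bigr => j _; rewrite !mulr_sumr -!sumrB -big_split /=.
      by apply: eq_bigr => k _; ring.
    by rewrite big_split /= 2!sumrB -!mulr_sumr.
  have -> : qform (hilb n) a - 2 * t * a i + t ^+ 2 * V i i = qform (hilb n) a - a i ^+ 2 / V i i.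
    by rewrite /t; field; rewrite gt_eqF.
  by rewrite subr_ge0 ler_pdivrMr // mulrC.
have V0 i : 0 <= V i i.
  have := hV i (fun k => V k i); have := qform_hilb_ge0 (fun k => V k i).
  rewrite leNgt => h1 h2; rewrite leNgt; apply/negP => h3.
  have : V i i ^+ 2 <= 0 by apply: le_trans h2 _; rewrite nmulr_rle0 // leNgt.
  by rewrite leNgt exprn_even_gt0 //= lt_eqF.
exists (1 + \sum_i V i i)^-1; first by rewrite invr_gt0 ltr_pwDl // sumr_ge0.
move=> a; rewrite mulrC ler_pdivrMr ?ltr_pwDl ?sumr_ge0 //.
rewrite mulrDr mulr1 mulr_sumr; apply: le_trans (_ : \sum_i V i i * qform (hilb n) a <= _).
  exact: ler_sum.
rewrite -[leLHS]add0r lerD ?qform_hilb_ge0 //.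
by under eq_bigr do rewrite mulrC.
Qed.

End Hilbert.

Section DGMatrix.
Variables (R : realType) (q : nat).
Local Notation n := q.+1.
Local Notation W := (hilb R n).

(** The fraction is the integral over [0, 1] of x^i times the derivative of x^j. At i = j = 0 it
    reads 0 / 0 = 0, which is the right value; the second summand is the product of the values at x
    = 0. *)
Definition stf : 'M[R]_n :=
  \matrix_(i, j) (j%:R / (i + j)%:R + ((i == 0%N :> nat) && (j == 0%N :> nat))%:R).

(** Integration by parts: the boundary terms are 1 at x = 1 and - 1 at x = 0 if i = j = 0, and there
    the jump adds 2. *)
Lemma stf_sum (i j : 'I_n) : stf i j + stf j i = 1 + ((i == ord0) && (j == ord0))%:R.
Proof.
rewrite !mxE -!val_eqE /= (addnC j i) (andbC (j == 0%N :> nat)).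
have [ij0|ij] := eqVneq (i + j)%N 0%N.
  move: (ij0) => /eqP; rewrite addn_eq0 => /andP[/eqP -> /eqP ->] /=.
  by rewrite !mul0r !add0r.
have -> : (i == 0%N :> nat) && (j == 0%N :> nat) = false by rewrite -addn_eq0; exact/negbTE.
by rewrite !addr0 -mulrDl -natrD addnC mulfV // pnatr_eq0.
Qed.

(** For p with coefficients a the right side is p(1)^2 + p(0)^2: the new end value and the upwind
    value at the left end. *)
Lemma qform_stf (a : 'I_n -> R) :
  2 * qform stf a = (\sum_i a i) ^+ 2 + a ord0 ^+ 2.
Proof.
have -> : 2 * qform stf a = qform stf a + \sum_i \sum_j stf j i * (a i * a j).
  rewrite mulr_natl mulr2n; congr (_ + _); rewrite /qform exchange_big /=.
  by apply: eq_bigr => i _; apply: eq_bigr => j _; rewrite (mulrC (a j)).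
rewrite /qform -big_split /=.
transitivity (\sum_i (a i * (\sum_j a j) + \sum_j ((i == ord0) && (j == ord0))%:R * (a i * a j))).
  apply: eq_bigr => i _; rewrite mulr_sumr -!big_split /=; apply: eq_bigr => j _.
  by rewrite -mulrDl stf_sum; ring.
rewrite big_split /= -mulr_suml expr2; congr (_ + _).
rewrite (bigD1 ord0) //= [X in _ + X]big1 ?addr0.
  rewrite (bigD1 ord0) //= big1 ?addr0 ?mul1r ?expr2 // => j j0.
  by rewrite (negbTE j0) mul0r.
by move=> i i0; rewrite big1 // => j _; rewrite (negbTE i0) mul0r.
Qed.

(** If S x = 0, the form of S gives p(0) = 0. Then the jump drops out, and p' is orthogonal to every
    monomial, hence zero by definiteness of the Hilbert matrix. *)
Lemma stf_unit : stf \in unitmx.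
Proof.
apply: mulmx_ker_unit => x hx.
have h0 : x ord0 0 = 0.
  have := qform_stf (fun i => x i 0); rewrite qformE hx mulmx0 mxE mulr0 => /esym/eqP.
  by rewrite paddr_eq0 ?sqr_ge0 // => /andP[_]; rewrite sqrf_eq0 => /eqP.
(* The coefficients of p', padded by 0 in the top degree q so that the Hilbert matrix of size q + 1
   applies. *)
pose b (k : 'I_n) : R := if insub k.+1 is Some j then k.+1%:R * x (j : 'I_n) 0 else 0.
have hb : forall k, b k = 0.
  apply: qform_hilb_eq0; rewrite /qform big1 // => i _.
  transitivity (b i * \sum_j W i j * b j).
    by rewrite mulr_sumr; apply: eq_bigr => j _; ring.
  have -> : \sum_j W i j * b j = 0; last by rewrite mulr0.
  have := congr1 (fun A : 'cV_n => A i 0) hx; rewrite mxE [RHS]mxE.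
  rewrite big_ord_recl h0 mulr0 add0r => h.
  rewrite big_ord_recr /= {2}/b insubF /= ?mulr0 ?addr0 ?ltnn // -[RHS]h.
  apply: eq_bigr => j _; rewrite /b /= insubT /= => [|jq]; first by rewrite ltnS.
  rewrite !mxE /= andbF addr0 (_ : Sub _ _ = lift ord0 j); last exact: val_inj.
  rewrite /bump leq0n add1n addnS.
  by rewrite mulrA; congr (_ * _); rewrite mulrC.
apply/matrixP => i j; rewrite ord1 [RHS]mxE.
case: (unliftP ord0 i) => [k|] -> //.
have hk : ((widen_ord (leqnSn q) k).+1 < n)%N by rewrite ltnS; exact: (ltn_ord k).
have := hb (widen_ord (leqnSn q) k); rewrite /b insubT => /eqP.
rewrite mulf_eq0 pnatr_eq0 /= => /eqP <-; congr (x _ 0); exact: val_inj.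
Qed.

(* In the monomials of (t - t_(m-1)) / k_m a time step reads (S + k_m A W) X = u e_0 + F,
   where u is the value at t_(m-1)^-, W = hilb is the mass matrix, and S = stf comes from
   the time derivative together with the upwind jump term. *)
Definition dgmx (z : R[i]) : 'M[R[i]]_n := toCM stf + z *: toCM W.
Lemma dgmxE z i j : dgmx z i j = (stf i j)%:C + z * (W i j)%:C.
Proof.
by rewrite /dgmx mxE [X in X + _]mxE [X in _ + X]mxE [X in _ * X]mxE.
Qed.

Definition dginv (z : R[i]) : 'M[R[i]]_n := invmx (dgmx z).
Definition wform (x : 'cV[R[i]]_n) : R :=
  qform W (fun i => cre (x i 0)) + qform W (fun i => cim (x i 0)).
Definition nsq (x : 'cV[R[i]]_n) : R := \sum_i cmod (x i 0) ^+ 2.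

Lemma wform_coercive : exists2 c : R, 0 < c & forall x, c * nsq x <= wform x.
Proof.
have [c c0 h] := hilb_coercive R n; exists c => // x.
rewrite /nsq /wform; under eq_bigr do rewrite cmod_sqr.
by rewrite big_split /= mulrDr lerD.
Qed.

Lemma cre_hermitian (A : 'M[R]_n) (x : 'cV[R[i]]_n) :
  cre (\sum_i \sum_j (x i 0)^* * ((A i j)%:C * x j 0)) =
  qform A (fun i => cre (x i 0)) + qform A (fun i => cim (x i 0)).
Proof.
rewrite cre_sum /qform -big_split /=; apply: eq_bigr => i _.
rewrite cre_sum -big_split /=; apply: eq_bigr => j _.
by case: (x i 0) => a b; case: (x j 0) => c d /=; ring.
Qed.

Lemma hilb_hermitian (x : 'cV[R[i]]_n) :
  \sum_i \sum_j (x i 0)^* * ((W i j)%:C * x j 0) = (wform x)%:C.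
Proof.
apply/eqP; rewrite eq_complex; apply/andP; split; apply/eqP.
  by rewrite -[LHS]/(cre _) cre_hermitian.
set s := LHS; suff : s = - s by move=> /eqP; rewrite -addr_eq0 -mulr2n mulrn_eq0 => /eqP.
have imD (u v : R[i]) : complex.Im (u + v) = complex.Im u + complex.Im v by case: u; case: v.
have im_sum (F : 'I_n -> R[i]) : complex.Im (\sum_i F i) = \sum_i complex.Im (F i).
  exact: (big_morph _ imD).
rewrite /s {1}exchange_big /= !im_sum -sumrN; apply: eq_bigr => i _.
rewrite !im_sum -sumrN; apply: eq_bigr => j _; rewrite hilb_sym.
by move: (hilb _ _ _ _) => w; case: (x i 0) => a b; case: (x j 0) => c d /=; ring.
Qed.

(** The step tested with its own solution: twice the real part of the Hermitian pairing of x with (S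
    + z W) x. *)
Lemma dg_energy z (x y : 'cV[R[i]]_n) : dgmx z *m x = y ->
  cmod (\sum_i x i 0) ^+ 2 + cmod (x ord0 0) ^+ 2 + 2 * (cre z * wform x) =
  2 * cre (\sum_i (x i 0)^* * y i 0).
Proof.
move=> <-.
have -> : \sum_i (x i 0)^* * (dgmx z *m x) i 0 =
  \sum_i \sum_j (x i 0)^* * ((stf i j)%:C * x j 0) + (wform x)%:C * z.
  rewrite -hilb_hermitian mulr_suml -big_split /=; apply: eq_bigr => i _.
  rewrite mxE mulr_sumr mulr_suml -big_split /=; apply: eq_bigr => j _.
  by rewrite dgmxE; ring.
rewrite creD cre_hermitian creMreal.
rewrite [RHS]mulrDr [X in _ = X + _]mulrDr !qform_stf.
rewrite !cmod_sqr cre_sum.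
have -> : cim (\sum_i x i 0) = \sum_i cim (x i 0).
  by apply: (big_morph (@cim R) _ erefl); case=> a b; case.
by ring.
Qed.

End DGMatrix.

Section MatrixBounds.
Variable R : realType.

Definition mxbd m n (C : R) (A : 'M[R[i]]_(m, n)) := forall i j, cmod (A i j) <= C.

Lemma mxbdM m n p (C D : R) (A : 'M[R[i]]_(m, n)) (B : 'M[R[i]]_(n, p)) : 0 <= C ->
  mxbd C A -> mxbd D B -> mxbd (n%:R * (C * D)) (A *m B).
Proof.
move=> C0 hA hB i j; rewrite mxE; apply: le_trans (cmod_sum _ _ _) _.
apply: le_trans (_ : \sum_(k < n) C * D <= _); last first.
  by rewrite sumr_const card_ord mulr_natl.
by apply: ler_sum => k _; rewrite cmodM ler_pM // cmod_ge0.
Qed.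

Lemma mxbdB m n (C D : R) (A B : 'M[R[i]]_(m, n)) :
  mxbd C A -> mxbd D B -> mxbd (C + D) (A - B).
Proof.
by move=> hA hB i j; rewrite !mxE; apply: le_trans (cmodB _ _) _; apply: lerD.
Qed.

Lemma mxbd_ex m n (A : 'M[R[i]]_(m, n)) : exists2 C, 0 <= C & mxbd C A.
Proof.
exists (\sum_i \sum_j cmod (A i j)).
  by rewrite !sumr_ge0 // => i _; rewrite sumr_ge0 // => j _; exact: cmod_ge0.
move=> i j; rewrite (bigD1 i) //= (bigD1 j) //= -addrA lerDl addr_ge0 //.
  by rewrite sumr_ge0 // => k _; exact: cmod_ge0.
by rewrite sumr_ge0 // => k _; rewrite sumr_ge0 // => l _; exact: cmod_ge0.
Qed.

End MatrixBounds.

(** * Bounds for the inverse of S + z W on a sector *)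

Section DGBounds.
Variables (R : realType) (q : nat) (delta : R).
Hypothesis delta0 : 0 < delta.
Local Notation n := q.+1.
Local Notation W := (toCM (hilb R n)).
Local Notation S := (toCM (stf R q)).
Local Notation Q := (@dginv R q).
Local Notation sect := (sect delta).

Lemma toCM_unit m (A : 'M[R]_m) : A \in unitmx -> toCM A \in unitmx.
Proof. by move=> h; rewrite -[toCM A]/(map_mx (real_complex R) A) map_unitmx. Qed.

Lemma nsq_ge m (x : 'cV[R[i]]_m.+1) i : cmod (x i 0) ^+ 2 <= nsq x.
Proof.
by rewrite /nsq (bigD1 i) //= lerDl sumr_ge0 // => k _; exact: sqr_ge0.
Qed.

Lemma nsq_ge0 m (x : 'cV[R[i]]_m.+1) : 0 <= nsq x.
Proof. by rewrite sumr_ge0 // => k _; exact: sqr_ge0. Qed.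

Lemma dgmx_unit z : sect z -> dgmx q z \in unitmx.
Proof.
move=> zs; apply: mulmx_ker_unit => x hx.
have [c c0 hc] := wform_coercive R q.
have := dg_energy hx; rewrite [RHS](_ : _ = 0); last first.
  by rewrite big1 ?mulr0 // => i _; rewrite mxE mulr0.
move=> e; have z0 := sect_pos delta0 zs.
have h : nsq x <= 0.
  have w0 : cre z * wform x <= 0.
    by have := sqr_ge0 (cmod (\sum_i x i 0)); have := sqr_ge0 (cmod (x ord0 0)); lra.
  rewrite pmulr_rle0 // in w0; have := hc x; rewrite -(pmulr_rle0 _ c0); lra.
apply/matrixP => i j; rewrite ord1 [RHS]mxE; apply/eqP.
rewrite -cmod_eq0 -sqrf_eq0 eq_le sqr_ge0 andbT; exact: le_trans (nsq_ge x i) h.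
Qed.

Lemma dginvK z (y : 'cV[R[i]]_n) : sect z -> dgmx q z *m (Q z *m y) = y.
Proof. by move=> zs; rewrite mulmxA mulmxV ?mul1mx // dgmx_unit. Qed.

Lemma dginv_col z i j : Q z i j = (Q z *m delta_mx j (0 : 'I_1)) i 0.
Proof.
rewrite mxE (bigD1 j) //= mxE !eqxx mulr1 big1 ?addr0 // => k kj.
by rewrite mxE (negbTE kj) mulr0.
Qed.

Lemma dg_energy_le z j (x : 'cV[R[i]]_n) : sect z -> x = Q z *m delta_mx j (0 : 'I_1) ->
  cmod (\sum_i x i 0) ^+ 2 + cmod (x ord0 0) ^+ 2 + 2 * (cre z * wform x) <= 2 * cmod (x j 0).
Proof.
move=> zs ->; rewrite (dg_energy (dginvK _ zs)); move: (_ *m _) => w; rewrite (bigD1 j) //= mxE !eqxx mulr1.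
rewrite big1 ?addr0; last by move=> k kj; rewrite mxE (negbTE kj) mulr0.
rewrite ler_wpM2l // -(cmodJ (w j 0)); apply: le_trans (cre_le_cmod _); exact: ler_norm.
Qed.

(** For |z| >= r the energy bounds |x|^2 by a multiple of |x_j|. For |z| < r the inverse is a
    perturbation of S^-1, and r is chosen so that the perturbation takes at most half of the sum of
    the |x_a|. *)
Lemma dginv_bounded : exists2 C : R, 0 <= C & forall z, sect z -> mxbd C (Q z).
Proof.
have [c c0 hc] := wform_coercive R q.
pose S0 := invmx S; have uS : S \in unitmx by exact/toCM_unit/stf_unit.
pose K := \sum_i \sum_j cmod (S0 i j).
have K0 : 0 <= K by rewrite !sumr_ge0 // => i _; rewrite sumr_ge0 // => j _; exact: cmod_ge0.
pose r := (2 * n%:R * K + 1)^-1.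
have r1 : 0 < 2 * n%:R * K + 1 by rewrite ltr_wpDl // !mulr_ge0.
have r0 : 0 < r by rewrite invr_gt0.
pose k := (delta * r * c)^-1.
have k0 : 0 < delta * r * c by rewrite !mulr_gt0.
exists (k + 2 * n%:R * K); first by rewrite addr_ge0 ?invr_ge0 ?mulr_ge0 // ltW.
move=> z zs i j; rewrite dginv_col; set x := _ *m _.
have [rz|zr] := leP r (cmod z).
  have e := dg_energy_le zs (erefl x).
  have e1 : delta * r * c * nsq x <= cmod (x j 0).
    have h1 : cre z * wform x <= cmod (x j 0).
      by have := sqr_ge0 (cmod (\sum_i x i 0)); have := sqr_ge0 (cmod (x ord0 0)); lra.
    apply: le_trans h1; rewrite -mulrA; apply: ler_pM (hc x).
    - by rewrite mulr_ge0 // ltW.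
    - by rewrite mulr_ge0 ?nsq_ge0 // ltW.
    by case: zs => _; apply: le_trans; rewrite ler_wpM2l // ltW.
  have m0 := cmod_ge0 (x j 0).
  have e2 : cmod (x j 0) <= k.
    have [->|mz] := eqVneq (cmod (x j 0)) 0; first by rewrite invr_ge0 ltW.
    have mp : 0 < cmod (x j 0) by rewrite lt_def mz.
    rewrite -[k]mul1r ler_pdivlMr // -(ler_pM2r mp) mul1r mulrAC -expr2 mulrC.
    by apply: le_trans e1; rewrite ler_wpM2l ?nsq_ge // ltW.
  have e3 : cmod (x i 0) ^+ 2 <= k ^+ 2.
    apply: le_trans (nsq_ge x i) _; rewrite expr2 {1}/k mulrC ler_pdivlMr // mulrC.
    exact: le_trans e1 e2.
  rewrite ler_sqr ?nnegrE ?cmod_ge0 ?invr_ge0 ?(ltW k0) // in e3.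
  by apply: le_trans e3 _; rewrite lerDl !mulr_ge0.
pose m := \sum_a cmod (x a 0).
have m0 : 0 <= m by rewrite sumr_ge0 // => a _; exact: cmod_ge0.
have hx : x = S0 *m (delta_mx j 0 - z *: (W *m x)).
  have := dginvK (delta_mx j (0 : 'I_1)) zs; rewrite -/x /dgmx mulmxDl => <-.
  by rewrite -scalemxAl addrK mulmxA mulVmx // mul1mx.
have hx1 a : cmod (x a 0) <= K * (1 + r * m).
  rewrite hx mxE; apply: le_trans (cmod_sum _ _ _) _.
  apply: le_trans (_ : \sum_b cmod (S0 a b) * (1 + r * m) <= _).
    apply: ler_sum => b _; rewrite cmodM ler_wpM2l ?cmod_ge0 //.
    rewrite mxE; apply: le_trans (cmodD _ _) _; apply: lerD.
      by rewrite mxE; case: (_ && _); rewrite ?cmod1 ?cmod0.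
    rewrite !mxE cmodN cmodM; apply: ler_pM; rewrite ?cmod_ge0 //; first exact: ltW.
    apply: le_trans (cmod_sum _ _ _) _; apply: ler_sum => d _.
    rewrite cmodM mxE cmod_real ler_piMl ?cmod_ge0 //.
    by rewrite mxE ger0_norm ?invr_ge0 // invf_le1 ?ltr0Sn // ler1n.
  rewrite -mulr_suml ler_wpM2r ?addr_ge0 ?mulr_ge0 ?(ltW r0) //.
  rewrite /K [leRHS](bigD1 a) //= lerDl sumr_ge0 // => b _.
  by rewrite sumr_ge0 // => d _; exact: cmod_ge0.
have hm : m <= n%:R * (K * (1 + r * m)).
  apply: le_trans (ler_sum _ (fun a _ => hx1 a)) _.
  by rewrite sumr_const card_ord -[X in X <= _]mulr_natl.
have hm2 : m <= 2 * n%:R * K.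
  have h3 : 2 * n%:R * K * r <= 1.
    by rewrite /r ler_pdivrMr // mul1r lerDl.
  have := ler_wpM2r m0 h3; lra.
apply: le_trans (_ : m <= _); last by apply: le_trans hm2 _; rewrite lerDr invr_ge0 ltW.
by rewrite /m (bigD1 i) //= lerDl sumr_ge0 // => a _; exact: cmod_ge0.
Qed.

(** Solving (S + z W) Q = 1 for z Q removes the unbounded factor z: bounds and smoothness of z Q
    follow from those of Q. *)
Lemma dginv_scaled z : sect z -> z *: Q z = invmx W *m (1%:M - S *m Q z).
Proof.
move=> zs; have uW : W \in unitmx by exact/toCM_unit/hilb_unit.
have -> : 1%:M = dgmx q z *m Q z by rewrite mulmxV // dgmx_unit.
by rewrite /dgmx mulmxDl addrAC subrr add0r -scalemxAl -scalemxAr mulmxA mulVmx // mul1mx.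
Qed.

Lemma dginv_scaled_bounded : exists2 C : R, 0 <= C & forall z, sect z -> mxbd C (z *: Q z).
Proof.
have [C C0 hC] := dginv_bounded; have [A A0 hA] := mxbd_ex (invmx W).
have [B B0 hB] := mxbd_ex S; have [D D0 hD] := mxbd_ex (1%:M : 'M[R[i]]_n).
exists (n%:R * (A * (D + n%:R * (B * C)))).
  by rewrite !mulr_ge0 // addr_ge0 // !mulr_ge0.
move=> z zs; rewrite dginv_scaled //; apply: mxbdM => //; apply: mxbdB => //.
by apply: mxbdM => //; exact: hC.
Qed.

Lemma dginv_decay : exists2 C : R, 0 <= C & forall z i j, sect z -> cmod (Q z i j) <= C / (1 + cmod z).
Proof.
have [C C0 hC] := dginv_bounded; have [D D0 hD] := dginv_scaled_bounded.
exists (C + D); first exact: addr_ge0.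
move=> z i j zs; rewrite ler_pdivlMr ?ltr_pwDl ?cmod_ge0 // mulrDr mulr1 lerD ?hC //.
by have := hD _ zs i j; rewrite mxE cmodM mulrC.
Qed.

(* dgstab 0 is the stability function of the scheme: it maps u_(m-1)^- to u_m^-. *)
Definition dgstab (i : 'I_n) (z : R[i]) : R[i] := \sum_j Q z j i.

Lemma dgstab_decay : exists2 C : R, 0 <= C & forall z i, sect z -> cmod (dgstab i z) <= C / (1 + cmod z).
Proof.
have [C C0 hC] := dginv_decay; exists (n%:R * C); first exact: mulr_ge0.
move=> z i zs; apply: le_trans (cmod_sum _ _ _) _.
apply: le_trans (ler_sum _ (fun j _ => hC _ j i zs)) _.
by rewrite sumr_const card_ord -[X in X <= _]mulr_natl mulrA.
Qed.

(* The energy identity gives |r|^2 (1 + A |z|) <= 1, which controls small |z|;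
   |z| |r| <= B controls large |z|. *)
Lemma dgstab_contractive : exists2 c : R, 0 < c &
  forall z, sect z -> cmod (dgstab ord0 z) * (1 + c * cmod z) <= 1.
Proof.
have [c c0 hc] := wform_coercive R q; have [B B0 hB] := dgstab_decay.
pose A := 2 * delta * c / n%:R ^+ 2; have A0 : 0 < A by rewrite divr_gt0 ?mulr_gt0 // exprn_gt0 // ltr0n.
pose B1 := B + 1; have B10 : 0 < B1 by rewrite ltr_wpDl.
(* For |z| <= 2 B1 one has c' |z| <= 1, so (1 + c' |z|)^2 <= 1 + 3 c' |z| <= 1 + A |z|. For larger
   |z| both |r| and c' |z| |r| are at most 1/2. *)
pose c' := Num.min (A / 3) (2 * B1)^-1.
have c'0 : 0 < c' by rewrite lt_min divr_gt0 // invr_gt0 mulr_gt0.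
have c'A : 3 * c' <= A by rewrite mulrC -ler_pdivlMr // ge_min lexx.
have c'B : 2 * B1 * c' <= 1.
  by rewrite mulrC -ler_pdivlMr ?mulr_gt0 // mul1r ge_min lexx orbT.
exists c' => // z zs; set r := cmod (dgstab _ _); set p := cmod z.
have r0 : 0 <= r := cmod_ge0 _; have p0 : 0 <= p := cmod_ge0 _.
have h1 : r ^+ 2 * (1 + A * p) <= 1.
  pose x := Q z *m delta_mx ord0 (0 : 'I_1); have e := dg_energy_le zs (erefl x).
  have rx : \sum_i x i 0 = dgstab ord0 z by apply: eq_bigr => i _; rewrite dginv_col.
  (* The right-hand side is e_0, so the data term is 2 |x_0|, and 2 |x_0| - |x_0|^2 <= 1. *)
  rewrite rx -/r in e; have e2 : r ^+ 2 + 2 * (cre z * wform x) <= 1.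
    by have := sqr_ge0 (cmod (x ord0 0) - 1); rewrite sqrrB1; lra.
  have e3 : r ^+ 2 <= n%:R ^+ 2 * nsq x.
    have -> : n%:R ^+ 2 * nsq x = (n%:R * Num.sqrt (nsq x)) ^+ 2.
      by rewrite exprMn sqr_sqrtr // nsq_ge0.
    rewrite ler_sqr ?nnegrE ?mulr_ge0 ?sqrtr_ge0 //.
    rewrite /r -rx; apply: le_trans (cmod_sum _ _ _) _.
    apply: le_trans (_ : \sum_(i < n) Num.sqrt (nsq x) <= _); last first.
      by rewrite sumr_const card_ord -[X in X <= _]mulr_natl.
    apply: ler_sum => i _; rewrite -[leLHS]ger0_norm ?cmod_ge0 // -sqrtr_sqr.
    by rewrite ler_wsqrtr // nsq_ge.
  have e4 : delta * p * (c * nsq x) <= cre z * wform x.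
    apply: ler_pM (hc x); first by rewrite mulr_ge0 // ltW.
      by rewrite mulr_ge0 ?nsq_ge0 // ltW.
    by case: zs.
  have e5 : A * p * r ^+ 2 <= 2 * (delta * p * (c * nsq x)).
    have -> : 2 * (delta * p * (c * nsq x)) = A * p * (n%:R ^+ 2 * nsq x).
      by rewrite /A; field; rewrite addrC natr1 pnatr_eq0.
    by rewrite ler_wpM2l // mulr_ge0 // ltW.
  by lra.
have h2 : p * r <= B1.
  have := hB _ ord0 zs; rewrite -/r -/p ler_pdivlMr ?ltr_pwDl // mulrDr mulr1 /B1; nra.
suff : (r * (1 + c' * p)) ^+ 2 <= 1 ^+ 2.
  by rewrite ler_sqr ?nnegrE ?ler01 // mulr_ge0 // addr_ge0 // mulr_ge0 // ltW.
rewrite expr1n exprMn; have [pB|pB] := leP p (2 * B1).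
  apply: le_trans h1; rewrite ler_wpM2l ?sqr_ge0 //.
  have : c' * p * (c' * p) <= c' * p * 1.
    rewrite ler_wpM2l ?mulr_ge0 ?(ltW c'0) //; apply: le_trans c'B.
    by rewrite mulrC ler_wpM2r // ltW.
  have := ler_wpM2r p0 c'A; rewrite sqrrD expr1n expr2; lra.
rewrite -exprMn -[leRHS](expr1n _ 2) ler_sqr ?nnegrE ?ler01 ?mulr_ge0 ?addr_ge0 ?mulr_ge0 ?(ltW c'0) //.
rewrite mulrDr mulr1.
have r1 : r <= 2^-1.
  have : r * (2 * B1) <= r * p by rewrite ler_wpM2l // ltW.
  by rewrite (mulrC r p) => h; have := le_trans h h2; rewrite mulrA -[X in _ <= X]mul1r ler_pM2r //; lra.
have r2 : r * (c' * p) <= 2^-1.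
  by have := ler_wpM2l (ltW c'0) h2; lra.
lra.
Qed.

End DGBounds.

(** * Lower bounds for products over comparable steps *)

Section Products.
Variable R : realType.

(* Splitting the factors alternately into two classes gives two comparable
   partial sums L and X, whence the square. *)
Lemma prod_ge_sqr (kap : R) (x : nat -> R) l m : 0 < kap -> (l < m)%N ->
  (forall p, (l <= p <= m)%N -> 0 <= x p) ->
  (forall p, (l <= p < m)%N -> x p <= kap * x p.+1 /\ x p.+1 <= kap * x p) ->
  (1 + (1 + 2 * kap)^-1 * \sum_(l <= p < m.+1) x p) ^+ 2 <= \prod_(l <= p < m.+1) (1 + x p).
Proof.
move=> k0 lm x0 xk.
(* [L] is the class that contains the last term, [X] the other one; a new term joins the former [X]
   and the roles swap. Each term is dominated by kap times its predecessor, except the first. Once d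
   > 0 this gives L <= 2 kap X, hence the factor 1 + 2 kap. *)
have inv : forall d, (l + d <= m)%N -> exists L X,
    ([/\ 0 <= L, 0 <= X, L + X = \sum_(l <= p < (l + d).+1) x p &
    (1 + L) * (1 + X) <= \prod_(l <= p < (l + d).+1) (1 + x p)] /\
    [/\ X <= kap * L, L <= kap * X + x (l + d)%N & x (l + d)%N <= L]) /\
    ((0 < d)%N -> x (l + d)%N <= kap * X).
  elim=> [|d ih] hd.
    exists (x l), 0; rewrite addn0 !big_nat1 !addr0 !mulr1 mulr0 add0r.
    have xl : 0 <= x l by apply: x0; rewrite leqnn ltnW.
    by do !split=> //; rewrite mulr_ge0 // ltW.
  have [|L [X [[[L0 X0 e1 e2] [e3 e4 e5]] _]]] := ih; first by apply: leq_trans hd; rewrite leq_add2l.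
  rewrite addnS in hd *; set p := (l + d)%N in e1 e2 e4 e5 hd *.
  have lp : (l <= p)%N by rewrite leq_addr.
  have xp0 : 0 <= x p.+1 by rewrite x0 // hd andbT ltnW.
  have [xk1 xk2] : x p <= kap * x p.+1 /\ x p.+1 <= kap * x p by apply: xk; rewrite lp hd.
  exists (X + x p.+1), L; split; [split; split=> // |].
  - exact: addr_ge0.
  - by rewrite big_nat_recr /= -?e1 ?ltnS //; [ring | exact: leqW].
  - rewrite big_nat_recr /=; last exact: leqW.
    have h1 : 0 <= 1 + x p.+1 by rewrite addr_ge0.
    apply: le_trans (ler_wpM2r h1 e2).
    rewrite mulrC -mulrA ler_wpM2l ?addr_ge0 //.
    by have := mulr_ge0 X0 xp0; lra.
  - by lra.
  - by lra.
  - by lra.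
  by move=> _; apply: le_trans xk2 _; rewrite ler_wpM2l ?(ltW k0).
have [|L [X [[[L0 X0 e1 e2] [e3 e4 e5]] e6]]] := inv (m - l)%N; first by rewrite subnKC // ltnW.
rewrite subnKC ?(ltnW lm) // in e1 e2 e4 e5 e6.
rewrite subn_gt0 in e6; have {}e6 := e6 lm.
rewrite -e1; apply: le_trans e2; rewrite expr2.
have k1 : 0 < 1 + 2 * kap by rewrite ltr_pwDl // mulr_ge0 // ltW.
have hL : (1 + 2 * kap)^-1 * (L + X) <= L.
  by rewrite mulrC ler_pdivrMr //; have := mulr_ge0 (ltW k0) L0; lra.
have hX : (1 + 2 * kap)^-1 * (L + X) <= X.
  by rewrite mulrC ler_pdivrMr //; have := mulr_ge0 (ltW k0) X0; lra.
have h0 : 0 <= (1 + 2 * kap)^-1 * (L + X) by rewrite mulr_ge0 ?invr_ge0 ?(ltW k1) ?addr_ge0.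
by apply: ler_pM; rewrite ?lerD2l // addr_ge0.
Qed.

End Products.

(** * Smoothness of the functions of one time step *)

Section DGSmooth.
Variables (R : realType) (q : nat) (delta : R).
Hypotheses (delta0 : 0 < delta) (delta1 : delta <= 1).
Local Notation n := q.+1.
Local Notation W := (toCM (hilb R n)).
Local Notation S := (toCM (stf R q)).
Local Notation Q := (@dginv R q).
Local Notation sect := (sect delta).
Local Notation smooth2 := (smooth2 delta).
Local Notation divdiff := (divdiff delta).

Lemma sect_real (lam : R) : 0 < lam -> sect lam%:C.
Proof.
move=> l0; split; first by rewrite eq_complex /= eqxx andbT gt_eqF.
by rewrite cmod_real gtr0_norm //= ler_piMl // ltW.
Qed.

Lemma divdiff_scale (k lam : R) f : 0 < k -> divdiff (k * lam) f ->
  divdiff lam (fun z => f (k%:C * z)).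
Proof.
move=> k0 [sf [E [sE hE]]]; split; first exact: smooth2_scale.
exists (fun z => E (k%:C * z)); split; first exact: smooth2_scale.
move=> z zs; have := hE _ (sectM k0 zs); rewrite rmorphM /= -mulrBr -!mulrA => /mulfI-> //.
by rewrite eq_complex /= eqxx andbT gt_eqF.
Qed.

Lemma dginvVl z : sect z -> Q z *m dgmx q z = 1%:M.
Proof. by move=> zs; rewrite mulVmx // (dgmx_unit q delta0). Qed.

Lemma dginvVr z : sect z -> dgmx q z *m Q z = 1%:M.
Proof. by move=> zs; rewrite mulmxV // (dgmx_unit q delta0). Qed.

Lemma dginvB z w : sect z -> sect w -> Q z - Q w = (w - z) *: (Q z *m W *m Q w).
Proof.
move=> zs ws; have -> : Q z - Q w = Q z *m (dgmx q w - dgmx q z) *m Q w.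
  by rewrite mulmxBr mulmxBl dginvVl // mul1mx -mulmxA dginvVr // mulmx1.
rewrite /dgmx opprD addrACA subrr add0r -scalerBl.
by rewrite -scalemxAr -scalemxAl.
Qed.

(** The resolvent identity [dginvB], used twice, gives the derivative - z Q W Q and the exact
    remainder (u - 1)^2 z^2 Q(u z) W Q W Q. Every z is paired with a factor Q, since z Q is bounded;
    z Q(u z) costs a factor 2 because |u| >= 1/2. *)
Lemma smooth2_dginv i j : smooth2 (fun z => Q z i j).
Proof.
have [C C0 hC] := dginv_bounded q delta0; have [D D0 hD] := dginv_scaled_bounded q delta0.
have [A A0 hA] := mxbd_ex W.
pose B1 := n%:R * (D * (n%:R * (A * C))).
pose B2 := n%:R * (2 * D * (n%:R * (A * (n%:R * (D * (n%:R * (A * C))))))).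
have B10 : 0 <= B1 by rewrite !mulr_ge0.
have B20 : 0 <= B2 by rewrite !mulr_ge0.
exists (fun z => - (z *: Q z *m (W *m Q z)) i j), (C + B1 + B2).
split; first by rewrite !addr_ge0.
move=> z zs; split.
- by apply: le_trans (hC _ zs i j) _; rewrite -addrA lerDl addr_ge0.
- rewrite cmodN; apply: le_trans (_ : B1 <= _); last by rewrite addrAC lerDr addr_ge0.
  by apply: mxbdM => //; [exact: hD | apply: mxbdM => //; exact: hC].
move=> u us u1.
have -> : Q (u * z) i j - Q z i j - (u - 1) * - (z *: Q z *m (W *m Q z)) i j =
    (u - 1) ^+ 2 * ((z *: Q (u * z)) *m (W *m ((z *: Q z) *m (W *m Q z)))) i j.
  have -> : Q (u * z) i j - Q z i j = (Q (u * z) - Q z) i j by rewrite !mxE.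
  have e1 : Q (u * z) = Q z + ((1 - u) * z) *: (Q (u * z) *m W *m Q z).
    have -> : (1 - u) * z = z - u * z by ring.
    by rewrite -dginvB // addrC subrK.
  have e2 : Q (u * z) - Q z = ((1 - u) * z) *: (Q z *m W *m Q z) +
      ((1 - u) * z) ^+ 2 *: (Q (u * z) *m W *m Q z *m W *m Q z).
    rewrite dginvB // {1}e1 (_ : z - u * z = (1 - u) * z); last by ring.
    by rewrite mulmxDl mulmxDl scalerDr -!scalemxAl scalerA -expr2.
  rewrite e2 [LHS](_ : _ = (((1 - u) * z) ^+ 2 *: (Q (u * z) *m W *m Q z *m W *m Q z)) i j).
    rewrite -!scalemxAl -!scalemxAr !mulmxA !mxE; ring.
  rewrite -!scalemxAl !mulmxA !mxE; ring.
rewrite cmodM cmodX mulrC ler_wpM2r ?sqr_ge0 //.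
apply: le_trans (_ : B2 <= _); last by rewrite lerDr addr_ge0.
apply: mxbdM; first by rewrite mulr_ge0.
  move=> a b; have u0 := half_le_cmod u1; have := hD _ us a b.
  rewrite !mxE !cmodM; have := cmod_ge0 z; have := cmod_ge0 (Q (u * z) a b) => q0 z0 h.
  have := ler_wpM2r (mulr_ge0 z0 q0) u0; lra.
by apply: mxbdM => //; apply: mxbdM => //; [exact: hD | apply: mxbdM => //; exact: hC].
Qed.

Lemma smooth2_mulmxr m p r (A : R[i] -> 'M[R[i]]_(m, p)) (B : 'M[R[i]]_(p, r)) i j :
  (forall i j, smooth2 (fun z => A z i j)) -> smooth2 (fun z => (A z *m B) i j).
Proof.
move=> h; apply: (@smooth2_ext _ _ (fun z => \sum_k B k j * A z i k)).
  by move=> z _; rewrite mxE; apply: eq_bigr => k _; rewrite mulrC.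
by apply: smooth2_sum => k; exact: smooth2Z.
Qed.

Lemma smooth2_mulmxl m p r (A : R[i] -> 'M[R[i]]_(m, p)) (B : 'M[R[i]]_(r, m)) i j :
  (forall i j, smooth2 (fun z => A z i j)) -> smooth2 (fun z => (B *m A z) i j).
Proof.
move=> h; apply: (@smooth2_ext _ _ (fun z => \sum_k B i k * A z k j)).
  by move=> z _; rewrite mxE.
by apply: smooth2_sum => k; exact: smooth2Z.
Qed.

(** The resolvent identity exhibits the factor z - lam; the quotient contains z Q, which is
    rewritten by [dginv_scaled] to make its smoothness visible. *)
Lemma divdiff_dginv lam i j : 0 < lam -> divdiff lam (fun z => Q z i j).
Proof.
move=> l0; split; first exact: smooth2_dginv.
exists (fun z => - ((invmx W *m (1%:M - S *m Q z)) *m (W *m Q lam%:C)) i j); split.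
  apply: (@smooth2_ext _ _ (fun z => -1 *
     ((invmx W *m (1%:M - S *m Q z)) *m (W *m Q lam%:C)) i j)).
    by move=> z _; rewrite mulN1r.
  apply: smooth2Z; apply: smooth2_mulmxr => {}i {}j; apply: smooth2_mulmxl => {}i {}j.
  apply: (@smooth2_ext _ _ (fun z => (1%:M : 'M[R[i]]_n) i j + -1 * (S *m Q z) i j)).
    by move=> z _; rewrite !mxE mulN1r.
  apply: smooth2D; first exact: smooth2_cst.
  by apply: smooth2Z; apply: smooth2_mulmxl => a b; exact: smooth2_dginv.
move=> z zs; have ls := sect_real l0; rewrite -(dginv_scaled q delta0 zs).
have -> : Q z i j - Q lam%:C i j = (Q z - Q lam%:C) i j by rewrite !mxE.
by rewrite dginvB // -!scalemxAl mulmxA !mxE; ring.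
Qed.

Lemma divdiff_dginv_scaled lam i j : 0 < lam -> divdiff lam (fun z => z * Q z i j).
Proof.
move=> l0; apply: (@divdiff_ext _ _ _ (fun z => \sum_k invmx W i k *
   ((1%:M : 'M[R[i]]_n) k j + -1 * \sum_l S k l * Q z l j))).
- have := dginv_scaled q delta0 (sect_real l0) => /matrixP/(_ i j).
  rewrite !mxE => ->; apply: eq_bigr => k _; congr (_ * _).
  by rewrite [in RHS]mxE [X in _ = _ + X]mxE [X in _ = _ + - X]mxE mulN1r.
- move=> z zs; have := dginv_scaled q delta0 zs => /matrixP/(_ i j).
  rewrite [in X in X -> _]mxE => ->; rewrite mxE; apply: eq_bigr => k _; congr (_ * _).
  by rewrite [in RHS]mxE [X in _ = _ + X]mxE [X in _ = _ + - X]mxE mulN1r.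
apply: divdiff_sum => k; apply: divdiffZ; apply: divdiffD; first exact: divdiff_cst.
by apply: divdiffZ; apply: divdiff_sum => l; apply: divdiffZ; exact: divdiff_dginv.
Qed.

Lemma divdiff_dgstab lam (i : 'I_n) : 0 < lam -> divdiff lam (dgstab i).
Proof. by move=> l0; apply: divdiff_sum => j; exact: divdiff_dginv. Qed.

(** Q(0) = S^-1 is not zero, so Q has infinite mass on a ray with respect to d rho / rho. The
    subtracted term has the same value at 0, and its operator is a single resolvent. *)
Definition dgloc (i j : 'I_n) (z : R[i]) : R[i] := Q z i j - invmx S i j * (z + 1)^-1.

Lemma divdiff_dgloc lam i j : 0 < lam -> divdiff lam (dgloc i j).
Proof.
move=> l0; apply: (@divdiff_ext _ _ _ (fun z => Q z i j + - invmx S i j * (z + (1 : R)%:C)^-1)).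
- by rewrite /dgloc mulNr.
- by move=> z _; rewrite /dgloc mulNr.
apply: divdiffD; first exact: divdiff_dginv.
by apply: divdiffZ; exact: divdiff_inv.
Qed.

(** Near 0 both terms are within O(|z|) of S^-1; near infinity both are O(1 / |z|). *)
Lemma dgloc_bound : exists2 C : R, 0 <= C & forall z i j, sect z ->
  cmod (dgloc i j z) <= C * (cmod z / (1 + cmod z) ^+ 2).
Proof.
have [C C0 hC] := dginv_decay q delta0; have [D D0 hD] := dginv_bounded q delta0.
have [A A0 hA] := mxbd_ex (invmx S); have [B B0 hB] := mxbd_ex W.
pose C1 := C + A; pose C2 := n%:R * (D * (n%:R * (B * A))) + A.
have C10 : 0 <= C1 by rewrite addr_ge0.
have C20 : 0 <= C2 by rewrite addr_ge0 // !mulr_ge0.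
exists (4 * C1 + 4 * C2); first by rewrite addr_ge0 ?mulr_ge0.
move=> z i j zs; set p := cmod z; have p0 : 0 <= p := cmod_ge0 _.
have z1 : z + 1 != 0 by exact: (sect_addr_neq0 delta0 zs ltr01).
have n1 : p <= cmod (z + 1) by exact: (sect_addl_ge delta0 zs ltr01).
have n2 : 1 <= cmod (z + 1) by exact: (sect_addr_ge delta0 zs ltr01).
have p1 : 0 < 1 + p by rewrite ltr_pwDl.
have b1 : cmod (dgloc i j z) <= C1 * 2 / (1 + p).
  apply: le_trans (cmodB _ _) _; rewrite mulrAC [X in _ <= X * 2]mulrDl mulrDl; apply: lerD.
    by apply: le_trans (hC _ i j zs) _; rewrite ler_peMr ?ler1n ?divr_ge0 ?(ltW p1).
  rewrite cmodM cmodV -mulrA; apply: ler_pM; rewrite ?cmod_ge0 ?invr_ge0 ?cmod_ge0 //.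
  rewrite mulrC ler_pdivlMr // mulrC ler_pdivrMr ?cmod_gt0 //; lra.
have b2 : cmod (dgloc i j z) <= C2 * p.
  have -> : dgloc i j z = - (z * (Q z *m (W *m invmx S)) i j) + invmx S i j * (z / (z + 1)).
    have uS : S \in unitmx by exact/toCM_unit/stf_unit.
    have e : Q z - invmx S = - (z *: (Q z *m (W *m invmx S))).
      have -> : Q z - invmx S = Q z *m (S - dgmx q z) *m invmx S.
        by rewrite mulmxBr mulmxBl dginvVl // mul1mx -mulmxA mulmxV // mulmx1.
      by rewrite /dgmx opprD addrA subrr add0r mulmxN mulNmx -scalemxAr -scalemxAl mulmxA.
    have := congr1 (fun X : 'M[R[i]]_n => X i j) e; rewrite [LHS]mxE [X in _ + X = _]mxE.
    rewrite [RHS]mxE [X in _ = - X]mxE => <-; rewrite /dgloc; by field.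
  apply: le_trans (cmodD _ _) _; rewrite mulrDl cmodN !cmodM -/p; apply: lerD.
    rewrite mulrC ler_wpM2r //; apply: mxbdM => //; first exact: hD.
    exact: mxbdM.
  apply: ler_pM; rewrite ?mulr_ge0 ?cmod_ge0 //.
  by rewrite cmodV ler_pdivrMr ?cmod_gt0 // ler_peMr.
have [pl|pl] := leP p 1.
  apply: le_trans b2 _; apply: le_trans (_ : 4 * C2 * (p / (1 + p) ^+ 2) <= _).
    rewrite mulrA ler_pdivlMr ?exprn_gt0 //.
    have hsq : (1 + p) ^+ 2 <= 4 by nra.
    by have := ler_wpM2l (mulr_ge0 C20 p0) hsq; lra.
  by rewrite ler_wpM2r ?divr_ge0 ?sqr_ge0 // lerDr mulr_ge0.
have pp : (1 + p) / p <= 2 by rewrite ler_pdivrMr ?(lt_trans ltr01) //; lra.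
have p2 : 0 < p by exact: lt_trans pl.
have w0 : 0 <= p / (1 + p) ^+ 2 by rewrite divr_ge0 ?sqr_ge0.
apply: le_trans b1 _.
have -> : C1 * 2 / (1 + p) = C1 * 2 * ((1 + p) / p) * (p / (1 + p) ^+ 2).
  by field; rewrite !gt_eqF.
rewrite ler_wpM2r //.
by have := ler_wpM2l (mulr_ge0 C10 (ler0n R 2)) pp; lra.
Qed.

End DGSmooth.

(** * Functional calculus and the resolvent estimate *)

Section Diagonalization.
Variable R : realType.
Local Notation conjR := (@Num.conj R[i]).
Local Notation "A ^h" := (map_mx conjR A^T) (at level 8, format "A ^h").

Lemma conjRE (z : R[i]) : conjR z = conjc z.
Proof. by []. Qed.

Lemma trmxhK m n (A : 'M[R[i]]_(m, n)) : A^h^h = A.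
Proof. by apply/matrixP => i j; rewrite !mxE conjCK. Qed.

Lemma trmxh_mul m n p (A : 'M[R[i]]_(m, n)) (B : 'M[R[i]]_(n, p)) : (A *m B)^h = B^h *m A^h.
Proof. by rewrite trmx_mul map_mxM. Qed.

Lemma trmxh_real n (A : 'M[R]_n) : A^T = A -> (toCM A)^h = toCM A.
Proof.
by move=> sA; apply/matrixP => i j; rewrite !mxE -[in RHS]sA mxE conjRE /= oppr0.
Qed.

Lemma herm_form_pos n (A : 'M[R]_n) (x : 'cV[R[i]]_n) : sym_posdef A -> x != 0 ->
  exists2 r : R, 0 < r & (x^h *m toCM A *m x) 0 0 = r%:C.
Proof.
move=> [sA pA] x0; pose a := \col_i cre (x i 0); pose b := \col_i cim (x i 0).
have bilE (y w : 'cV[R]_n) : bil A y w = \sum_j \sum_i y i 0 * A i j * w j 0.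
  rewrite /bil mxE; apply: eq_bigr => j _; rewrite mxE mulr_suml.
  by apply: eq_bigr => i _; rewrite mxE.
have bs (y w : 'cV[R]_n) : bil A y w = bil A w y.
  rewrite !bilE exchange_big; apply: eq_bigr => i _; apply: eq_bigr => j _.
  by rewrite -{1}sA mxE; ring.
have b0 (y : 'cV[R]_n) : 0 <= bil A y y.
  have [->|y0] := eqVneq y 0; last by exact/ltW/pA.
  by rewrite bilE big1 // => i _; rewrite big1 // => j _; rewrite mxE !mul0r.
exists (bil A a a + bil A b b).
  have [a0|a0] := eqVneq a 0; last by rewrite ltr_pwDl ?pA.
  have bn0 : b != 0.
    apply: contra x0 => /eqP b0'; apply/eqP/matrixP => i j; rewrite ord1 [RHS]mxE.
    move: (congr1 (fun v : 'cV[R]_n => v i 0) a0) (congr1 (fun v : 'cV[R]_n => v i 0) b0').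
    by rewrite !mxE; case: (x i 0) => u v /= -> ->.
  by rewrite ltr_wpDl ?pA.
have -> : (x^h *m toCM A *m x) 0 0 = (bil A a a + bil A b b) +i* (bil A a b - bil A b a).
  apply/eqP; rewrite !bilE -!sumrB -!big_split /=.
  have cE : forall (I : finType) (F G : I -> R),
      (\sum_i F i) +i* (\sum_i G i) = \sum_i (F i +i* G i) :> R[i].
    move=> I F G; elim/big_rec3: _ => [//|i u v w _ <-]; by simpc.
  rewrite cE mxE; apply/eqP; apply: eq_bigr => j _.
  rewrite -!big_split -!sumrB /= cE mxE mulr_suml; apply: eq_bigr => i _.
  rewrite !mxE conjRE; case: (x i 0) => u v; case: (x j 0) => u' v' /=.
  by apply/eqP; rewrite eq_complex /=; apply/andP; split; apply/eqP; ring.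
by rewrite (bs b a) subrr.
Qed.

Lemma herm_diag m n (P : 'M[R[i]]_(m, n)) (H : 'M[R[i]]_m) i :
  (P^h *m H *m P) i i = ((col i P)^h *m H *m col i P) 0 0.
Proof.
rewrite !mxE; apply: eq_bigr => j _; rewrite !mxE; congr (_ * _).
by apply: eq_bigr => k _; rewrite !mxE.
Qed.

Lemma herm_unitary_diag n (H : 'M[R[i]]_n) : H^h = H -> exists V : 'M[R[i]]_n, exists d,
  [/\ V^h *m V = 1%:M, V *m V^h = 1%:M & V^h *m H *m V = diag_mx d].
Proof.
move=> hH; have nH : H \is normalmx by apply/normalmxP; rewrite hH.
have /orthomx_spectralP := nH; set V := spectralmx H; set d := spectral_diag H => e.
have uV : V \is unitarymx := spectral_unitarymx H.
have e1 : V *m V^h = 1%:M by apply/unitarymxP.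
have e2 : V^h *m V = 1%:M by exact: mulmx1C.
exists V^h, d; rewrite trmxhK; split=> //.
rewrite e (invmx_unitary uV) !mulmxA e1 mul1mx -mulmxA.
by rewrite -[V *m _]/(V *m V^h) e1 mulmx1.
Qed.

Lemma col_unit_neq0 n (P : 'M[R[i]]_n) i : P \in unitmx -> col i P != 0.
Proof.
move=> uP; apply/eqP; rewrite colE => /(congr1 (mulmx (invmx P))).
rewrite mulKmx // mulmx0 => /matrixP/(_ i 0)/eqP.
by rewrite !mxE !eqxx oner_eq0.
Qed.

(** G^-1 K is self-adjoint for the inner product of G. A basis Y that turns G into the identity is
    built from the spectral decomposition of G, and a unitary change then diagonalizes K; the
    eigenvalues are values of the form of K, hence positive. *)
Lemma simultaneous_diag n (G K : 'M[R]_n) : sym_posdef G -> sym_posdef K ->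
  exists P : 'M[R[i]]_n, exists d : 'I_n -> R,
   [/\ P \in unitmx, forall i, 0 < d i &
     toCM (invmx G *m K) = P *m diag_mx (\row_i (d i)%:C) *m invmx P].
Proof.
move=> pG pK; have [V [g [V1 V2 Vg]]] := herm_unitary_diag (trmxh_real pG.1).
have uV : V \in unitmx by have [] := mulmx1_unit V1.
have hg i : exists2 r : R, 0 < r & g 0 i = r%:C.
  have [r r0 e] := herm_form_pos pG (col_unit_neq0 i uV); exists r => //.
  by rewrite -e -herm_diag Vg mxE eqxx mulr1n.
pose s i := projT1 (cid2 (hg i)).
have [s0 sg] : (forall i, 0 < s i) /\ forall i, g 0 i = (s i)%:C.
  by split=> i; rewrite /s; case: cid2.
pose D := diag_mx (\row_i (Num.sqrt (s i))^-1%:C) : 'M[R[i]]_n.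
have hD : D^h = D.
  apply/matrixP => i j; rewrite !mxE eq_sym; case: eqVneq => [->|_]; rewrite ?mulr1n ?mulr0n ?conjC0 //.
  by rewrite conjRE conjc_real.
have [Y Y1] : exists Y : 'M[R[i]]_n, Y^h *m toCM G *m Y = 1%:M.
  exists (V *m D); rewrite trmxh_mul hD -!mulmxA (mulmxA (toCM G)) (mulmxA V^h) (mulmxA V^h) Vg.
  rewrite /D !mulmx_diag; apply/matrixP => i j; rewrite !mxE.
  case: eqVneq => [->|_]; rewrite ?mulr0n // !mulr1n sg -!rmorphM /=.
  rewrite -[RHS](rmorph1 (real_complex R)); congr (_%:C).
  have w0 : Num.sqrt (s j) != 0 by rewrite gt_eqF // sqrtr_gt0.
  have : s j = Num.sqrt (s j) ^+ 2 by rewrite sqr_sqrtr // ltW.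
  by move: w0; set w := Num.sqrt _ => w0 ->; field.
have hH2 : (Y^h *m toCM K *m Y)^h = Y^h *m toCM K *m Y.
  by rewrite (trmxh_mul _ Y) (trmxh_mul Y^h) trmxhK (trmxh_real pK.1) mulmxA.
have [U [d [U1 U2 Ud]]] := herm_unitary_diag hH2.
have [P [P1 P2]] : exists P : 'M[R[i]]_n,
    P^h *m toCM G *m P = 1%:M /\ P^h *m toCM K *m P = diag_mx d.
  exists (Y *m U); rewrite trmxh_mul; split; last by rewrite -Ud !mulmxA.
  by rewrite -!mulmxA (mulmxA (toCM G)) (mulmxA Y^h) (mulmxA Y^h) Y1 mul1mx.
have [_ uP] := mulmx1_unit P1.
have uPh : P^h \in unitmx by move: P1; rewrite -mulmxA => /mulmx1_unit[].
have hd i : exists2 r : R, 0 < r & d 0 i = r%:C.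
  have [r r0 e] := herm_form_pos pK (col_unit_neq0 i uP); exists r => //.
  by rewrite -e -herm_diag P2 mxE eqxx mulr1n.
pose t i := projT1 (cid2 (hd i)).
have [t0 td] : (forall i, 0 < t i) /\ forall i, d 0 i = (t i)%:C.
  by split=> i; rewrite /t; case: cid2.
exists P, t; split=> //.
have -> : \row_i (t i)%:C = d by apply/rowP => i; rewrite mxE td.
have uG : toCM G \in unitmx.
  by move: P1; rewrite -mulmxA => /mulmx1_unit[_]; rewrite unitmx_mul => /andP[].
have e : toCM K = toCM G *m (P *m diag_mx d *m invmx P).
  apply: (can_inj (mulKmx uPh)); apply: (can_inj (mulmxK uP)).
  rewrite P2 -[RHS]mulmxA -!(mulmxA (toCM G)) mulmxKV //.
  by rewrite !mulmxA P1 mul1mx.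
rewrite -[toCM (_ *m _)]/(map_mx (real_complex R) _) map_mxM map_invmx.
by rewrite -[map_mx _ G]/(toCM G) -[map_mx _ K]/(toCM K) e mulKmx.
Qed.

End Diagonalization.

Section NormFacts.
Variables (R : realType) (n : nat) (N : 'cV[R[i]]_n -> R).
Hypothesis normN : is_norm N.

Lemma norm0 : N 0 = 0.
Proof. by case: normN => _ h _; rewrite -(scale0r (0 : 'cV_n)) h cmod0 mul0r. Qed.

Lemma normD x y : N (x + y) <= N x + N y. Proof. by case: normN. Qed.
Lemma normZ c x : N (c *: x) = cmod c * N x. Proof. by case: normN. Qed.
Lemma normNN x : N (- x) = N x.
Proof. by rewrite -scaleN1r normZ cmodN cmod1 mul1r. Qed.
Lemma norm_ge0 x : 0 <= N x.
Proof. by have := normD x (- x); rewrite subrr norm0 normNN; lra. Qed.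
Lemma normB x y : N (x - y) <= N x + N y.
Proof. by apply: le_trans (normD _ _) _; rewrite normNN. Qed.

Lemma norm_sum (I : Type) (r : seq I) (p : pred I) (F : I -> 'cV[R[i]]_n) :
  N (\sum_(i <- r | p i) F i) <= \sum_(i <- r | p i) N (F i).
Proof.
elim/big_rec2: _ => [|i a b _ h]; first by rewrite norm0.
by apply: le_trans (normD _ _) _; rewrite lerD2l.
Qed.

End NormFacts.

(** The passage to the limit of infinitely fine grids; K may depend on everything except nu. *)
Lemma le_inv_nat (R : realType) (x y K : R) : 0 <= K ->
  (forall nu, (0 < nu)%N -> x <= y + K / nu%:R) -> x <= y.
Proof.
move=> K0 h; rewrite leNgt; apply/negP => yx.
have d0 : 0 < x - y by rewrite subr_gt0.
have [nu hnu] : exists nu : nat, K / (x - y) < nu%:R.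
  by exists (Num.bound (K / (x - y))); apply: archi_boundP; rewrite divr_ge0 // ltW.
have nu0 : (0 < nu)%N by rewrite -(ltr0n R) (le_lt_trans _ hnu) // divr_ge0 // ltW.
have := h _ nu0; rewrite leNgt => /negP; apply.
rewrite -ltrBrDl ltr_pdivrMr ?ltr0n //.
by move: hnu; rewrite ltr_pdivrMr // mulrC.
Qed.

(** F(A) depends on the values of F at the eigenvalues d only, so identities between functions need
    to hold only there. *)
HB.lock Definition fcalc (R : realType) (n : nat) (P : 'M[R[i]]_n) (d : 'I_n -> R)
  (F : R[i] -> R[i]) : 'M[R[i]]_n := P *m diag_mx (\row_i F (d i)%:C) *m invmx P.
Canonical fcalc_unlockable := Unlockable fcalc.unlock.

Section FunctionalCalculus.
Variables (R : realType) (n : nat) (P : 'M[R[i]]_n) (d : 'I_n -> R).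
Hypotheses (uP : P \in unitmx) (d0 : forall i, 0 < d i).

Local Notation fcalc := (fcalc P d).

Lemma eq_fcalc F G : (forall i, F (d i)%:C = G (d i)%:C) -> fcalc F = fcalc G.
Proof.
move=> h; rewrite unlock; congr (_ *m diag_mx _ *m _).
by apply/rowP => i; rewrite !mxE.
Qed.

Lemma fcalcM F G : fcalc F *m fcalc G = fcalc (fun z => F z * G z).
Proof.
rewrite unlock !mulmxA mulmxKV // -(mulmxA P) mulmx_diag.
by congr (_ *m diag_mx _ *m _); apply/rowP => i; rewrite !mxE.
Qed.

Lemma fcalcD F G : fcalc F + fcalc G = fcalc (fun z => F z + G z).
Proof.
rewrite unlock -mulmxDl -mulmxDr -raddfD; congr (_ *m diag_mx _ *m _).
by apply/rowP => i; rewrite !mxE.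
Qed.

Lemma fcalcZ c F : c *: fcalc F = fcalc (fun z => c * F z).
Proof.
rewrite unlock scalemxAl scalemxAr -linearZ; congr (_ *m diag_mx _ *m _).
by apply/rowP => i; rewrite !mxE.
Qed.

Lemma fcalcB F G : fcalc F - fcalc G = fcalc (fun z => F z - G z).
Proof.
by rewrite -[- fcalc G]scaleN1r fcalcZ fcalcD; apply: eq_fcalc => i; rewrite mulN1r.
Qed.

Lemma fcalc0 : fcalc (fun=> 0) = 0.
Proof.
rewrite unlock (_ : \row_i 0 = 0); last by apply/rowP => i; rewrite !mxE.
by rewrite raddf0 mulmx0 mul0mx.
Qed.

Lemma fcalc_sum (I : Type) (r : seq I) (F : I -> R[i] -> R[i]) :
  \sum_(i <- r) fcalc (F i) = fcalc (fun z => \sum_(i <- r) F i z).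
Proof.
elim: r => [|i r ih].
  by rewrite big_nil -fcalc0; apply: eq_fcalc => i; rewrite big_nil.
by rewrite big_cons ih fcalcD; apply: eq_fcalc => j; rewrite big_cons.
Qed.

Lemma fcalc_cst c : fcalc (fun=> c) = c%:M.
Proof.
rewrite unlock (_ : diag_mx _ = c%:M).
  by rewrite mul_mx_scalar -scalemxAl mulmxV // scalemx1.
by apply/matrixP => i j; rewrite !mxE.
Qed.

Lemma fcalc_inv z : (forall i, z - (d i)%:C != 0) ->
  invmx (z%:M - fcalc id) = fcalc (fun x => (z - x)^-1).
Proof.
move=> h; have e : z%:M - fcalc id = fcalc (fun x => z - x).
  rewrite -fcalc_cst -scaleN1r fcalcZ fcalcD; apply: eq_fcalc => i.
  by rewrite mulN1r.
have e2 : fcalc (fun x => z - x) *m fcalc (fun x => (z - x)^-1) = 1%:M.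
  rewrite fcalcM -fcalc_cst; apply: eq_fcalc => i; exact: mulfV.
have [u1 u2] := mulmx1_unit e2.
by rewrite e -[LHS]mulmx1 -e2 mulKmx.
Qed.

Variables (N : 'cV[R[i]]_n -> R) (gamma Mh : R) (D : 'M[R]_n).
Hypotheses (normN : is_norm N) (gamma_bd : 0 < gamma < pi / 2).
Hypotheses (hD : toCM D = - fcalc id) (res : resolvent_estimate N D gamma Mh).

Lemma cos_gamma_gt0 : 0 < cos gamma.
Proof.
have /andP[h1 h2] := gamma_bd; apply: cos_gt0_pihalf; rewrite h2 andbT.
by apply: lt_trans h1; rewrite oppr_lt0; apply: divr_gt0 => //; exact: pi_gt0.
Qed.

Lemma fcalc_resolvent z (v : 'cV[R]_n) : ~ in_sector gamma z ->
  N (fcalc (fun x => (z - x)^-1) *m toC v) <= Mh / cmod z * N (toC v).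
Proof.
move=> hz; rewrite -fcalc_inv; first by rewrite -hD; exact: res.
move=> i; rewrite subr_eq0; apply/eqP => zd; apply: hz; right.
rewrite zd cmod_real gtr0_norm //= ler_piMr ?(ltW (d0 i)) //; exact: cos_le1.
Qed.

Lemma negative_notin_sector (k : R) : 0 < k -> ~ in_sector gamma (- k%:C).
Proof.
move=> k0 [/eqP|]; first by rewrite oppr_eq0 eq_complex /= eqxx andbT gt_eqF.
rewrite cmodN cmod_real gtr0_norm //= leNgt => /negP; apply.
by apply: (@lt_trans _ _ 0); rewrite ?oppr_lt0 // mulr_gt0 // cos_gamma_gt0.
Qed.

(** No sign of Mh is assumed, and in dimension 0 none follows; the product with a norm is
    nonnegative because it bounds the resolvent at z = - 1. *)
Lemma Mh_norm_ge0 (v : 'cV[R]_n) : 0 <= Mh * N (toC v).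
Proof.
have := fcalc_resolvent v (negative_notin_sector ltr01).
rewrite cmodN cmod1 divr1; apply: le_trans; exact: norm_ge0.
Qed.

(** (1 + k A)^-1 is - 1/k times the resolvent at z = - 1/k, and |z| = 1/k cancels the prefactor. *)
Lemma fcalc_one_plus_inv (k : R) (v : 'cV[R]_n) : 0 < k ->
  N (fcalc (fun z => (k%:C * z + 1)^-1) *m toC v) <= Mh * N (toC v).
Proof.
move=> k0; have kV : 0 < k^-1 by rewrite invr_gt0.
have kn : k%:C != 0 by rewrite eq_complex /= eqxx andbT gt_eqF.
have -> : fcalc (fun z => (k%:C * z + 1)^-1) =
    (- k^-1%:C) *: fcalc (fun z => (- k^-1%:C - z)^-1).
  rewrite fcalcZ; apply: eq_fcalc => i; rewrite fmorphV.
  have h : k%:C * (d i)%:C + 1 != 0.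
    rewrite -rmorphM -(rmorph1 (real_complex R)) -rmorphD eq_complex /= eqxx andbT gt_eqF //.
    by rewrite addr_gt0 // mulr_gt0.
  have -> : - k%:C^-1 - (d i)%:C = - k%:C^-1 * (k%:C * (d i)%:C + 1) by field.
  by field; rewrite h kn.
rewrite -scalemxAl (normZ normN) cmodN cmod_real gtr0_norm //.
apply: le_trans (ler_wpM2l (ltW kV) (fcalc_resolvent v (negative_notin_sector kV))) _.
rewrite cmodN cmod_real gtr0_norm // invrK le_eqVlt; apply/orP; left; apply/eqP.
by field; rewrite gt_eqF.
Qed.

Variable theta : R.
Hypotheses (theta_bd : 0 < theta < pi / 2) (gamma_theta : gamma < theta).

Lemma ray_notin_sector (rho phi : R) : 0 < rho -> cos phi = cos theta ->
  ~ in_sector gamma (rho%:C * eix phi).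
Proof.
move=> r0 cphi; have ct : cos theta < cos gamma.
  have /andP[g0 g1] := gamma_bd; have /andP[t0 t1] := theta_bd.
  have pp : pi / 2 <= pi :> R by rewrite ler_pdivrMr // ler_peMr ?pi_ge0 // ler1n.
  by rewrite ltr_cos // in_itv /= ltW //= (le_trans (ltW _) pp).
case=> [/eqP|]; first by rewrite -cmod_eq0 cmod_realM cmod_eix mulr1 gtr0_norm // gt_eqF.
rewrite cmod_realM cmod_eix mulr1 gtr0_norm // creMreal /= cphi ler_pM2l //.
by rewrite leNgt ct.
Qed.

(** The integral of sig / (1 + sig rho)^2 over rho > 0 is 1 for every sig. The sum is compared with
    the telescoping increments of - 1 / (1 + sig rho); the ratio of neighbouring denominators is at
    most 2. *)
Lemma radial_mass (sig : R) nu : (0 < nu)%N -> 0 < sig ->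
  \sum_(j < gnum nu) geps R nu * (sig * grho R nu j / (1 + sig * grho R nu j) ^+ 2) <= 2.
Proof.
move=> nu0 s0; have e0 := geps_gt0 R nu0; have e1 := geps_le R nu0.
pose f j := - (1 + sig * grho R nu j)^-1.
have pos j : 0 < 1 + sig * grho R nu j by rewrite ltr_pwDl // mulr_ge0 ?ltW // grho_gt0.
apply: le_trans (_ : \sum_(j < gnum nu) 2 * (f j.+1 - f j) <= _).
  apply: ler_sum => j _; rewrite /f; have p1 := pos j; have p2 := pos j.+1.
  have r0 := grho_gt0 R j nu0.
  set a := 1 + _ * grho R nu j in p1 *; set b := 1 + _ * grho R nu j.+1 in p2 *.
  have ba : b - a = sig * grho R nu j * geps R nu by rewrite /a /b grhoS; ring.
  have -> : 2 * (- b^-1 - - a^-1) = 2 * (b - a) / (a * b) by field; rewrite !gt_eqF.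
  rewrite ba expr2 mulrA ler_pdivrMr ?mulr_gt0 // mulrAC ler_pdivlMr ?mulr_gt0 //.
  have b2 : b <= 2 * a.
    have h : sig * grho R nu j * geps R nu <= sig * grho R nu j * 2^-1.
      by rewrite ler_wpM2l // mulr_ge0 // ltW.
    by have := mulr_gt0 s0 r0; rewrite /a in ba *; lra.
  have q0 : 0 <= geps R nu * (sig * grho R nu j) * a.
    exact: mulr_ge0 (mulr_ge0 (ltW e0) (mulr_ge0 (ltW s0) (ltW r0))) (ltW p1).
  by have := ler_wpM2l q0 b2; lra.
rewrite -mulr_sumr; have -> : \sum_(j < gnum nu) (f j.+1 - f j) = f (gnum nu) - f 0%N.
  by rewrite -(telescope_sumr f) // big_mkord.
have h1 : f (gnum nu) <= 0 by rewrite oppr_le0 invr_ge0 ltW.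
have h2 : - f 0%N <= 1.
  by rewrite opprK invf_le1 ?pos // lerDl mulr_ge0 ?ltW // grho_gt0.
lra.
Qed.

(** Replace F by its Cauchy sum: on each ray the factor z cancels the 1 / |z| of the resolvent
    estimate, and what remains is the mass of [radial_mass], which is independent of sig and of the
    eigenvalues. The error is a fixed combination of eigencomponents of v, divided by nu. *)
Theorem fcalc_bound (F : R[i] -> R[i]) (B sig : R) (v : 'cV[R]_n) :
  0 <= B -> 0 < sig -> (forall i, divdiff (cos theta) (d i) F) ->
  (forall z, sect (cos theta) z ->
     cmod (F z) <= B * (sig * cmod z / (1 + sig * cmod z) ^+ 2)) ->
  N (fcalc F *m toC v) <= B * (Mh * N (toC v)).
Proof.
move=> B0 s0 dF bF.
have hz z : sect (cos theta) z -> cmod z * cmod (F z) <= B / sig.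
  move=> zs; have p0 := cmod_ge0 z; set p := cmod z in p0 *.
  apply: le_trans (ler_wpM2l p0 (bF _ zs)) _; rewrite -/p.
  rewrite mulrCA ler_wpM2l // mulrA ler_pdivrMr ?exprn_gt0 ?ltr_pwDl ?mulr_ge0 ?(ltW s0) //.
  by rewrite [leRHS]mulrC ler_pdivlMr //; have := mulr_ge0 (ltW s0) p0; nra.
have thn : `|theta| <= theta by rewrite ger0_norm //; case/andP: theta_bd => /ltW.
have thn' : `|- theta| <= theta by rewrite normrN.
pose KK i := projT1 (cid2 (discrete_cauchy theta_bd (d0 i) (dF i) hz)).
have [KK0 hKK] : (forall i, 0 <= KK i) /\ forall i nu, (0 < nu)%N ->
    cmod (cauchy_sum theta F nu (d i) - F (d i)%:C) <= KK i / nu%:R.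
  by split=> i; rewrite /KK; case: cid2.
pose w i := (invmx P *m toC v) i 0 *: col i P.
have fcE G : fcalc G *m toC v = \sum_i G (d i)%:C *: w i.
  rewrite unlock /w -!mulmxA; move: (invmx P *m toC v) => y.
  apply/colP => a; rewrite mxE summxE; apply: eq_bigr => i _.
  by rewrite mul_diag_mx !mxE; ring.
have E0 : 0 <= \sum_i KK i * N (w i) by rewrite sumr_ge0 // => i _; rewrite mulr_ge0 // norm_ge0.
have MN := Mh_norm_ge0 v.
apply: (le_inv_nat E0) => nu nu0.
have e0 := geps_gt0 R nu0; have p0 := pi_gt0 R.
have -> : fcalc F *m toC v = fcalc (fun x => \sum_(j < gnum nu) (
     (2 * pi)^-1%:C * 'i * (geps R nu)%:C *
       (((grho R nu j)%:C * eix theta) * F ((grho R nu j)%:C * eix theta) /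
          ((grho R nu j)%:C * eix theta - x)
      - ((grho R nu j)%:C * eix (- theta)) * F ((grho R nu j)%:C * eix (- theta)) /
          ((grho R nu j)%:C * eix (- theta) - x)))) *m toC v
   - \sum_i (cauchy_sum theta F nu (d i) - F (d i)%:C) *: w i.
  rewrite !fcE -sumrB; apply: eq_bigr => i _; rewrite -scalerBl; congr (_ *: _).
  rewrite /cauchy_sum /radial -mulrBr -sumrB !mulr_sumr.
  set s1 := \sum_(_ < _) _; set s2 := \sum_(_ < _) _.
  have -> : s1 = s2 by apply: eq_bigr => j _; rewrite -!mulrA.
  by rewrite opprB addrC subrK.
apply: le_trans (normB normN _ _) _; apply: lerD; last first.
  apply: le_trans (norm_sum normN _ _ _) _; rewrite mulr_suml; apply: ler_sum => i _.
  by rewrite (normZ normN) mulrAC ler_wpM2r ?norm_ge0 // hKK.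
rewrite -fcalc_sum mulmx_suml; apply: le_trans (norm_sum normN _ _ _) _.
have key rho phi (c : R[i]) : 0 < rho -> cos phi = cos theta -> `|phi| <= theta ->
    N ((c *: fcalc (fun x => (rho%:C * eix phi - x)^-1)) *m toC v) <=
    cmod c * (Mh / rho * N (toC v)).
  move=> r0 cp pt; rewrite -scalemxAl (normZ normN) ler_wpM2l ?cmod_ge0 //.
  have := fcalc_resolvent v (ray_notin_sector r0 cp).
  by rewrite cmod_realM cmod_eix mulr1 gtr0_norm.
have ci : cmod ('i : R[i]) = 1 by rewrite /cmod /= expr0n add0r expr1n sqrtr1.
pose g rho := B * (sig * rho / (1 + sig * rho) ^+ 2).
have fr rho phi : 0 < rho -> `|phi| <= theta -> cmod (F (rho%:C * eix phi)) <= g rho.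
  move=> r0 pt; apply: le_trans (bF _ (sect_eix theta_bd r0 pt)) _.
  by rewrite cmod_realM cmod_eix mulr1 gtr0_norm.
have half rho phi : 0 < rho -> cos phi = cos theta -> `|phi| <= theta ->
   N (fcalc (fun x => ((2 * pi)^-1%:C * 'i * (geps R nu)%:C) *
      ((rho%:C * eix phi) * F (rho%:C * eix phi)) / (rho%:C * eix phi - x)) *m toC v)
   <= (2 * pi)^-1 * (geps R nu * g rho) * (Mh * N (toC v)).
  move=> r0 cp pt; rewrite -fcalcZ; apply: le_trans (key _ _ _ r0 cp pt) _.
  rewrite !cmodM ci !cmod_real cmod_eix mulr1 mulr1 (gtr0_norm r0) (gtr0_norm e0).
  rewrite gtr0_norm ?invr_gt0 ?mulr_gt0 //.
  have -> : (2 * pi)^-1 * geps R nu * (rho * cmod (F (rho%:C * eix phi))) * (Mh / rho * N (toC v))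
    = (2 * pi)^-1 * (geps R nu * cmod (F (rho%:C * eix phi))) * (Mh * N (toC v)).
    by move: (2 * pi)^-1 => pv; field; rewrite (gt_eqF r0).
  rewrite ler_wpM2r // ler_wpM2l ?invr_ge0 ?mulr_ge0 ?(ltW p0) //.
  by rewrite ler_wpM2l ?(ltW e0) // fr.
apply: le_trans (_ : \sum_(j < gnum nu) (2 * ((2 * pi)^-1 * (geps R nu * g (grho R nu j))))
   * (Mh * N (toC v)) <= _).
  apply: ler_sum => j _; have r0 := grho_gt0 R j nu0.
  rewrite (_ : fcalc _ = fcalc (fun x => ((2 * pi)^-1%:C * 'i * (geps R nu)%:C) *
      (((grho R nu j)%:C * eix theta) * F ((grho R nu j)%:C * eix theta)) /
      ((grho R nu j)%:C * eix theta - x)) -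
    fcalc (fun x => ((2 * pi)^-1%:C * 'i * (geps R nu)%:C) *
      (((grho R nu j)%:C * eix (- theta)) * F ((grho R nu j)%:C * eix (- theta))) /
      ((grho R nu j)%:C * eix (- theta) - x))); last first.
    by rewrite fcalcB; apply: eq_fcalc => i; ring.
  rewrite mulmxBl; apply: le_trans (normB normN _ _) _.
  have h1 := half _ _ r0 (erefl _) thn; have h2 := half _ _ r0 (cosN theta) thn'.
  by apply: le_trans (lerD h1 h2) _; rewrite le_eqVlt; apply/orP; left; apply/eqP; ring.
rewrite -mulr_suml ler_wpM2r // -2!mulr_sumr.
have -> : \sum_(j < gnum nu) geps R nu * g (grho R nu j) = B *
  \sum_(j < gnum nu) geps R nu * (sig * grho R nu j / (1 + sig * grho R nu j) ^+ 2).
  by rewrite !mulr_sumr; apply: eq_bigr => j _; rewrite /g mulrCA.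
have hm := radial_mass nu0 s0.
set SS := \sum_(_ < _) _ in hm *.
(* Two rays, the prefactor 1 / (2 pi) and the mass 2 give 2 / pi <= 1, so no extra constant
   appears. *)
have -> : 2 * ((2 * pi)^-1 * (B * SS)) = B * (SS / pi).
  by rewrite invfM; move: (pi^-1) => pv; field.
rewrite -[leRHS]mulr1 ler_wpM2l // ler_pdivrMr // mul1r; apply: le_trans hm _.
exact: pi_ge2.
Qed.

End FunctionalCalculus.

(** * Norms of integrals *)

Section SublinearSupport.
Variables (R : realType) (V : lmodType R).

Definition sublinear (p : V -> R) : Prop :=
  (forall x y, p (x + y) <= p x + p y) /\ (forall (a : R) x, 0 <= a -> p (a *: x) <= a * p x).

Lemma sublinear_ge0N p x : sublinear p -> 0 <= p x + p (- x).
Proof.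
move=> [pD pZ]; have h0 : 0 <= p 0 by have := pD 0 0; rewrite addr0; lra.
by apply: le_trans h0 _; rewrite -(subrr x) pD.
Qed.

Lemma sublinearZ_ge p (t : R) v : sublinear p -> 0 <= t -> t * p v <= p (t *: v).
Proof.
move=> sp; rewrite le_eqVlt => /predU1P[<-|t0].
  by rewrite mul0r scale0r; have := sublinear_ge0N 0 sp; rewrite oppr0; lra.
have [_ pZ] := sp; have := pZ t^-1 (t *: v); rewrite invr_ge0 ltW // scalerA mulVf ?gt_eqF // scale1r.
by move=> /(_ isT); rewrite mulrC ler_pdivlMr // mulrC.
Qed.

(* Take q x to be the infimum over t >= 0 of p (x + t v) - t p v. *)
Lemma sublinear_step p v : sublinear p ->
  exists q, [/\ sublinear q, forall x, q x <= p x & q (- v) <= - p v].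
Proof.
move=> sp; have [pD pZ] := sp.
pose E x := [set p (x + t *: v) - t * p v | t in [set t : R | 0 <= t]].
have lbE x : lbound (E x) (- p (- x)).
  move=> _ [t t0 <-]; have := pD (x + t *: v) (- x).
  rewrite addrAC subrr add0r; have := sublinearZ_ge v sp t0; lra.
have hlb x : has_lbound (E x) by exists (- p (- x)); exact: lbE.
have E0 x : E x !=set0 by exists (p (x + 0 *: v) - 0 * p v), 0 => //=.
pose q x := inf (E x).
have qle x t : 0 <= t -> q x <= p (x + t *: v) - t * p v.
  by move=> t0; apply: ge_inf => //; exists t.
have leqq x c : (forall t, 0 <= t -> c <= p (x + t *: v) - t * p v) -> c <= q x.
  by move=> h; apply: lb_le_inf => // _ [t t0 <-]; exact: h.
exists q; split.
- split=> [x y|a x].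
    rewrite -lerBlDr; apply: (leqq) => t t0; rewrite lerBlDr -lerBlDl; apply: (leqq) => s s0.
    rewrite lerBlDl; apply: le_trans (qle _ _ (addr_ge0 t0 s0)) _.
    have := pD (x + t *: v) (y + s *: v); rewrite addrACA -scalerDl; lra.
  rewrite le_eqVlt => /predU1P[<-|a0].
    rewrite scale0r mul0r; apply: le_trans (qle 0 0 (lexx 0)) _.
    have := pZ 0 0 (lexx _); rewrite !scale0r addr0 !mul0r; lra.
  rewrite -ler_pdivrMl //; apply: (leqq) => t t0; rewrite ler_pdivrMl //.
  apply: le_trans (qle _ (a * t) (mulr_ge0 (ltW a0) t0)) _.
  have := pZ a (x + t *: v) (ltW a0); rewrite scalerDr scalerA; lra.
- by move=> x; have := qle x 0 (lexx 0); rewrite scale0r addr0 mul0r subr0.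
have := qle (- v) 1 ler01; rewrite scale1r addNr mul1r.
have := pZ 0 0 (lexx _); rewrite scale0r mul0r; lra.
Qed.

Lemma sublinear_steps p (s : seq V) : sublinear p ->
  exists q, [/\ sublinear q, forall x, q x <= p x & forall u, List.In u s -> q (- u) <= - q u].
Proof.
move=> sp; elim: s => [|v s [q [sq qp hq]]]; first by exists p.
have [q' [sq' q'q hq']] := sublinear_step v sq.
exists q'; split=> //; first by move=> x; exact: le_trans (q'q x) (qp x).
move=> u [<-|us]; first by apply: le_trans hq' _; rewrite lerN2.
apply: le_trans (q'q _) _; apply: le_trans (hq _ us) _; by rewrite lerN2.
Qed.

End SublinearSupport.

(** Hahn-Banach in finite dimension. Minorize p first in the direction v, which pins the value
    there, then in every coordinate direction; q(- u) <= - q(u) along a basis forces q to be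
    linear. *)
Lemma norm_support (R : realType) n (p : 'cV[R]_n -> R) (v : 'cV[R]_n) : sublinear p ->
  exists2 w : 'I_n -> R, (forall x : 'cV[R]_n, \sum_i w i * x i 0 <= p x)
    & \sum_i w i * v i 0 = p v.
Proof.
move=> sp; have [p1 [sp1 p1p hp1]] := sublinear_step v sp.
have [q [sq qp1 hq]] := sublinear_steps [seq delta_mx i (0 : 'I_1) | i <- enum 'I_n] sp1.
have {}hq i : q (- delta_mx i 0) <= - q (delta_mx i 0).
  apply: hq; have : i \in enum 'I_n by rewrite mem_enum.
  elim: (enum 'I_n) => //= j s ih; rewrite in_cons => /predU1P[->|/ih]; by [left | right].
pose w i := q (delta_mx i 0).
have up (x : 'cV[R]_n) : q x <= \sum_i w i * x i 0.
  have -> : x = \sum_i x i 0 *: delta_mx i 0.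
    by rewrite {1}[x]matrix_sum_delta; apply: eq_bigr => i _; rewrite big_ord1.
  have -> : \sum_i w i * (\sum_j x j 0 *: delta_mx j 0 : 'cV_n) i 0 = \sum_i w i * x i 0.
    apply: eq_bigr => i _; congr (_ * _); rewrite summxE (bigD1 i) //= !mxE !eqxx mulr1.
    by rewrite big1 ?addr0 // => j ji; rewrite !mxE eq_sym (negbTE ji) mulr0.
  have [qD qZ] := sq; elim/big_rec2: _ => [|i a b _ h].
    by have := qZ 0 0 (lexx _); rewrite scale0r mul0r.
  apply: le_trans (qD _ _) _; apply: lerD h.
  have [x0|x0] := leP 0 (x i 0); first by rewrite mulrC qZ.
  rewrite -[_ *: _]opprK -scaleNr -scalerN.
  have := qZ (- x i 0) (- delta_mx i 0); rewrite oppr_ge0 ltW // => /(_ isT).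
  have := hq i; rewrite -/(w i) => h1 h2; apply: le_trans h2 _.
  have : - x i 0 * q (- delta_mx i 0) <= - x i 0 * - w i by rewrite ler_wpM2l // oppr_ge0 ltW.
  by lra.
have low (x : 'cV[R]_n) : \sum_i w i * x i 0 <= q x.
  have := up (- x); have := sublinear_ge0N x sq.
  have -> : \sum_i w i * (- x) i 0 = - \sum_i w i * x i 0.
    by rewrite -sumrN; apply: eq_bigr => i _; rewrite mxE mulrN.
  lra.
exists w.
  by move=> x; apply: le_trans (low x) _; apply: le_trans (qp1 x) _.
apply: le_anti; apply/andP; split.
  by apply: le_trans (low v) _; apply: le_trans (qp1 v) _.
apply: le_trans (up v); have := sublinear_ge0N v sq; have := qp1 (- v); lra.
Qed.

(** * Measurability of norms of vector-valued functions *)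

Section NormMeasurable.
Context d (T : measurableType d) (R : realType) (n : nat) (N : 'cV[R[i]]_n -> R).
Hypothesis normN : is_norm N.

Lemma toCD (x y : 'cV[R]_n) : toC (x + y) = toC x + toC y.
Proof. by rewrite -[toC _]/(map_mx (real_complex R) _) map_mxD. Qed.

Lemma toCZ (a : R) (x : 'cV[R]_n) : toC (a *: x) = (a%:C)%C *: toC x.
Proof. by rewrite -[toC _]/(map_mx (real_complex R) _) map_mxZ. Qed.

Lemma toC_sublinear : sublinear (fun x : 'cV[R]_n => N (toC x)).
Proof.
split=> [x y|a x a0]; first by rewrite toCD (normD normN).
by rewrite toCZ (normZ normN) cmod_real ger0_norm.
Qed.

Let L i := N (toC (delta_mx i 0)).

Lemma norm_lip (x y : 'cV[R]_n) : N (toC x) <= N (toC y) + \sum_i L i * `|x i 0 - y i 0|.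
Proof.
have -> : x = y + \sum_i (x i 0 - y i 0) *: delta_mx i 0.
  rewrite {1}[x](_ : x = y + (x - y)); last by rewrite addrC subrK.
  congr (_ + _); rewrite {1}[x - y]matrix_sum_delta; apply: eq_bigr => i _.
  by rewrite big_ord1 !mxE.
rewrite toCD; apply: le_trans (normD normN _ _) _; rewrite lerD2l.
have [sD sZ] := toC_sublinear.
have -> : \sum_i L i * `|(y + \sum_j (x j 0 - y j 0) *: delta_mx j 0) i 0 - y i 0| =
  \sum_i `|x i 0 - y i 0| * L i.
  apply: eq_bigr => i _; rewrite mulrC; congr (`|_| * _).
  rewrite mxE addrAC subrr add0r summxE (bigD1 i) //= !mxE !eqxx mulr1.
  by rewrite big1 ?addr0 // => j ji; rewrite !mxE eq_sym (negbTE ji) mulr0.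
elim/big_rec2: _ => [|i a b _ h].
  by rewrite -[toC 0]/(map_mx (real_complex R) _) map_mx0 (norm0 normN).
apply: le_trans (sD _ _) _; apply: lerD h.
by rewrite toCZ (normZ normN) cmod_real.
Qed.

Lemma norm_le_sum (x : 'cV[R]_n) : N (toC x) <= \sum_i L i * `|x i 0|.
Proof.
have := norm_lip x 0; rewrite -[toC 0]/(map_mx (real_complex R) _) map_mx0 (norm0 normN) add0r.
by under eq_bigr do rewrite mxE subr0.
Qed.

Lemma L_ge0 i : 0 <= L i. Proof. exact: norm_ge0. Qed.

(* N is the infimum of countably many functions of the coordinates. *)
Lemma measurable_norm (D : set T) (g : T -> 'cV[R]_n) :
  (forall i, measurable_fun D (fun t => g t i 0)) ->
  measurable_fun D (fun t => N (toC (g t))).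
Proof.
move=> mg.
pose r k : 'cV[R]_n := map_mx ratr (odflt 0 (unpickle k : option 'cV[rat]_n)).
pose h k t := N (toC (r k)) + \sum_i L i * `|g t i 0 - r k i 0|.
have mh k : measurable_fun D (h k).
  apply: measurable_funD; first exact: measurable_cst.
  apply: measurable_sum => i; apply: measurable_funM; first exact: measurable_cst.
  by apply: measurableT_comp => //; apply: measurable_funB => //; exact: measurable_cst.
have hlb t : D t -> has_lbound (range (h ^~ t)).
  by move=> _; exists (N (toC (g t))) => _ [k _ <-]; exact: norm_lip.
have := measurable_fun_infs 0 hlb mh; apply: eq_measurable_fun => t /set_mem Dt.
rewrite /infs /=; apply/eqP; rewrite eq_le; apply/andP; split; last first.
  by apply: lb_le_inf => [|_ [k _ <-]]; [exists (h 0%N t), 0%N | exact: norm_lip].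
apply/ler_addgt0Pr => e e0.
pose LL := 1 + \sum_i L i.
have LL0 : 0 < LL by rewrite ltr_pwDl // sumr_ge0 // => i _; exact: L_ge0.
pose eta := e / (2 * LL); have eta0 : 0 < eta by rewrite divr_gt0 // mulr_gt0.
have hr i : exists a : rat, `|g t i 0 - ratr a| < eta.
  have [a] := @rat_in_itvoo R (g t i 0 - eta) (g t i 0 + eta) (ltac:(lra)).
  by rewrite in_itv /= => /andP[a1 a2]; exists a; rewrite ltr_norml; apply/andP; split; lra.
pose rr : 'cV[rat]_n := \col_i projT1 (cid (hr i)).
have hrr i : `|g t i 0 - r (pickle rr) i 0| < eta.
  by rewrite /r pickleK /= !mxE; case: cid.
apply: (@le_trans _ _ (h (pickle rr) t)).
  by apply: ge_inf; [exists (N (toC (g t))) => _ [k _ <-]; exact: norm_lip | exists (pickle rr)].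
rewrite /h; have := norm_lip (r (pickle rr)) (g t).
under eq_bigr do rewrite distrC.
have hs : \sum_i L i * `|g t i 0 - r (pickle rr) i 0| <= e / 2.
  apply: (@le_trans _ _ (\sum_i L i * eta)).
    by apply: ler_sum => i _; rewrite ler_wpM2l ?L_ge0 // ltW.
  rewrite -mulr_suml; have -> : e / 2 = LL * eta by rewrite /eta; field; rewrite gt_eqF.
  by rewrite ler_wpM2r ?(ltW eta0) // lerDr.
lra.
Qed.

End NormMeasurable.

Section IntegralComb.
Context d (T : measurableType d) (R : realType) (mu : {measure set T -> \bar R}).
Local Open Scope ring_scope.

Lemma integrable_comb (I : finType) (D : set T) (c : I -> R) (f : I -> T -> R) :
  measurable D -> (forall i, mu.-integrable D (EFin \o f i)) ->
  mu.-integrable D (EFin \o (fun t => \sum_i c i * f i t)).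
Proof.
move=> mD h.
have -> : EFin \o (fun t => \sum_i c i * f i t) = (fun t => \sum_i ((c i)%:E * (f i t)%:E)%E)%E.
  by apply/funext => t /=; rewrite -sumEFin.
apply: integrable_sum => // i _. exact: (integrableZl mD _ (h i)).
Qed.

Lemma Rintegral_comb (I : finType) (D : set T) (c : I -> R) (f : I -> T -> R) :
  measurable D -> (forall i, mu.-integrable D (EFin \o f i)) ->
  Rintegral mu D (fun t => \sum_i c i * f i t) = \sum_i c i * Rintegral mu D (f i).
Proof.
move=> mD h.
have key : forall s : seq I, mu.-integrable D (EFin \o (fun t => \sum_(i <- s) c i * f i t)) /\
    Rintegral mu D (fun t => \sum_(i <- s) c i * f i t) = \sum_(i <- s) c i * Rintegral mu D (f i).
  elim=> [|i s [ih1 ih2]].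
    rewrite big_nil (_ : (fun=> _) = cst 0); last by apply/funext => t; rewrite big_nil.
    split; first by rewrite (_ : _ \o _ = cst 0%E) //; exact: integrable0.
    by rewrite Rintegral_cst // mul0r.
  have hi : mu.-integrable D (EFin \o (fun t => c i * f i t)).
    by rewrite (_ : _ \o _ = (fun t => (c i)%:E * (EFin \o f i) t)%E) //; exact: (integrableZl mD _ (h i)).
  have -> : (fun t => \sum_(j <- i :: s) c j * f j t) =
      (fun t => c i * f i t + \sum_(j <- s) c j * f j t).
    by apply/funext => t; rewrite big_cons.
  split; last by rewrite RintegralD // ih2 big_cons RintegralZl.
  exact: (integrableD mD hi ih1).
exact: (key (index_enum I)).2.
Qed.

Variables (n : nat) (N : 'cV[R[i]]_n -> R).
Hypothesis normN : is_norm N.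

Lemma norm_integrable (D : set T) (g : T -> 'cV[R]_n) : measurable D ->
  (forall i, mu.-integrable D (EFin \o (fun t => g t i 0))) ->
  mu.-integrable D (EFin \o (fun t => N (toC (g t)))).
Proof.
move=> mD ig; pose L i := N (toC (delta_mx i 0)).
have iL : mu.-integrable D (EFin \o (fun t => \sum_i L i * `|g t i 0|)).
  by apply: integrable_comb => // i; exact: (integrable_norm (ig i)).
apply: (le_integrable _ _ _ iL) => //.
  apply/measurable_EFinP; apply: (measurable_norm normN) => i.
  by apply/measurable_EFinP; case/integrableP: (ig i).
move=> t _ /=; rewrite lee_fin ger0_norm ?(norm_ge0 normN) //.
by apply: le_trans (norm_le_sum normN _) (ler_norm _).
Qed.

(** Take a linear functional below the norm that attains it at the integral, and exchange it with
    the integral. *)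
Lemma norm_integral_le (D : set T) (f : T -> 'cV[R]_n) (h : T -> R) : measurable D ->
  (forall i, mu.-integrable D (EFin \o (fun t => f t i 0))) ->
  mu.-integrable D (EFin \o h) -> (forall t, D t -> N (toC (f t)) <= h t) ->
  N (toC (\col_i Rintegral mu D (fun t => f t i 0))) <= Rintegral mu D h.
Proof.
move=> mD if_ ih fh; have [w hw <-] := norm_support (\col_i Rintegral mu D (fun t => f t i 0))
  (toC_sublinear normN).
under eq_bigr do rewrite mxE.
rewrite -Rintegral_comb //; apply: le_Rintegral => //; first exact: integrable_comb.
by move=> t Dt; apply: le_trans (hw (f t)) (fh _ Dt).
Qed.

End IntegralComb.

Section HornerIntegral.
Context (R : realType).
Local Notation mu := (@lebesgue_measure R).

Lemma horner_integrable (a b : R) (p : {poly R}) :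
  mu.-integrable `]a, b]%classic (EFin \o horner p).
Proof.
apply: (@integrableS _ _ _ mu `[a, b]%classic) => //.
  by move=> x /=; rewrite !in_itv /= => /andP[/ltW -> ->].
apply: continuous_compact_integrable; first exact: segment_compact.
by apply: continuous_subspaceT => t; exact: continuous_horner.
Qed.

Lemma horner_Rintegral (a b : R) (P : {poly R}) : a < b ->
  Rintegral mu `]a, b]%classic (horner P^`()) = P.[b] - P.[a].
Proof.
move=> ab; rewrite Rintegral_itv_obnd_cbnd; last exact: horner_integrable.
rewrite /Rintegral (@continuous_FTC2 _ _ (horner P)) //.
- by apply: continuous_subspaceT => t; exact: continuous_horner.
- split=> [t _||]; first exact: derivable_horner.
  + by apply: cvg_at_right_filter; exact: continuous_horner.
  + by apply: cvg_at_left_filter; exact: continuous_horner.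
- by move=> t _; rewrite -[LHS](congr1 (fun g => g t) (derivE P)).
Qed.

Definition scaled (a b : R) n (t : R) : R := ((t - a) / (b - a)) ^+ n.

Lemma scaled_horner (a b : R) n :
  scaled a b n = horner (((b - a)^-1 *: ('X - a%:P)) ^+ n).
Proof. by apply/funext => t; rewrite /scaled !hornerE mulrC. Qed.

Lemma scaled_integrable (a b c d : R) n :
  mu.-integrable `]c, d]%classic (EFin \o scaled a b n).
Proof. by rewrite scaled_horner; exact: horner_integrable. Qed.

Lemma scaled_Rintegral (a b : R) n : a < b ->
  Rintegral mu `]a, b]%classic (scaled a b n) = (b - a) / n.+1%:R.
Proof.
move=> ab; have d0 : b - a != 0 by rewrite gt_eqF // subr_gt0.
have n0 : n.+1%:R != 0 :> R by rewrite pnatr_eq0.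
pose P : {poly R} := ((b - a) / n.+1%:R) *: ((b - a)^-1 *: ('X - a%:P)) ^+ n.+1.
have dP : P^`() = ((b - a)^-1 *: ('X - a%:P)) ^+ n.
  rewrite /P derivZ deriv_exp derivZ derivB derivX derivC subr0 /=.
  rewrite -[X in _ *: X = _]scaler_nat -scalerAl mul1r.
  rewrite !scalerA /=; rewrite (_ : _ * _ = 1) ?scale1r //.
  by field; rewrite d0 addrC natr1 n0.
rewrite scaled_horner -dP horner_Rintegral // /P !hornerE subrr mulr0 expr0n /= mulr0 subr0.
by rewrite mulVf // expr1n mulr1.
Qed.

Lemma scaled_measurable (a b : R) n (D : set R) : measurable_fun D (scaled a b n).
Proof.
rewrite scaled_horner; apply: measurable_funTS.
by apply: continuous_measurable_fun; exact: continuous_horner.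
Qed.

Lemma scaled_bd (a b : R) n t : a < t <= b -> 0 <= scaled a b n t <= 1.
Proof.
move=> /andP[at_ tb]; have ab : 0 < b - a by rewrite subr_gt0 (lt_le_trans at_).
have h0 : 0 <= (t - a) / (b - a) by rewrite divr_ge0 ?(ltW ab) // subr_ge0 ltW.
have h1 : (t - a) / (b - a) <= 1 by rewrite ler_pdivrMr // mul1r lerD2r.
by rewrite exprn_ge0 //= exprn_ile1.
Qed.

Lemma integrable_scaledM (a b : R) n (g : R -> R) :
  mu.-integrable `]a, b]%classic (EFin \o g) ->
  mu.-integrable `]a, b]%classic (EFin \o (fun t => scaled a b n t * g t)).
Proof.
move=> ig; apply: (le_integrable _ _ _ ig) => //.
  apply/measurable_EFinP; apply: measurable_funM; first exact: scaled_measurable.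
  by apply/measurable_EFinP; case/integrableP: ig.
move=> t /=; rewrite in_itv /= => /(scaled_bd n)/andP[s0 s1].
by rewrite lee_fin normrM ger0_norm // ler_piMl.
Qed.

End HornerIntegral.

(** * From the Galerkin equations to a recurrence *)

Section LocalCoefficients.
Variables (R : realType) (n q : nat).

(** The binomial change of basis from t^l to the powers of (t - a) / k. *)
Definition loc_coef (a k : R) (l j : nat) : R := ((a%:P + k *: 'X) ^+ l)`_j.

Definition locX (a k : R) (U : 'I_q.+1 -> 'cV[R]_n) (j : 'I_q.+1) : 'cV[R]_n :=
  \sum_(l < q.+1) loc_coef a k l j *: U l.

Lemma size_loc (a k : R) (l : 'I_q.+1) : (size ((a%:P + k *: 'X : {poly R}) ^+ l) <= q.+1)%N.
Proof.
apply: leq_trans (size_poly_exp_leq _ _) _; rewrite ltnS.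
apply: (@leq_trans (1 * l)%N); last by rewrite mul1n -ltnS.
rewrite leq_mul2r; apply/orP; right.
have hp : (size ((a%:P + k *: 'X)%R : {poly R}) <= 2)%N.
  apply: leq_trans (size_polyD _ _) _; rewrite geq_max.
  rewrite (leq_trans (size_polyC_leq1 _)) //=.
  by apply: leq_trans (size_scale_leq _ _) _; rewrite size_polyX.
by case: (size _) hp => [|[|[]]].
Qed.

Lemma locX_val (a k t : R) U : k != 0 ->
  \sum_(l < q.+1) t ^+ l *: U l = \sum_(j < q.+1) ((t - a) / k) ^+ j *: locX a k U j.
Proof.
move=> k0; under [RHS]eq_bigr do rewrite scaler_sumr.
rewrite exchange_big /=; apply: eq_bigr => l _.
under eq_bigr do rewrite scalerA mulrC.
rewrite -scaler_suml; congr (_ *: _); rewrite -horner_coef_wide ?size_loc //.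
by rewrite horner_exp hornerD hornerC hornerZ hornerX; congr (_ ^+ _); field.
Qed.

Lemma locX_der (a k t : R) U : k != 0 ->
  \sum_(l < q.+1) (l%:R * t ^+ l.-1) *: U l =
  k^-1 *: \sum_(j < q.+1) (j%:R * ((t - a) / k) ^+ j.-1) *: locX a k U j.
Proof.
move=> k0; under [X in _ = _ *: X]eq_bigr do rewrite scaler_sumr.
rewrite exchange_big scaler_sumr /=; apply: eq_bigr => l _.
under eq_bigr do rewrite scalerA.
rewrite -scaler_suml scalerA; congr (_ *: _).
set p : {poly R} := (a%:P + k *: 'X) ^+ l; set x := (t - a) / k.
have -> : \sum_(j < q.+1) j%:R * x ^+ j.-1 * loc_coef a k l j = p^`().[x].
  have -> : p = \sum_(j < q.+1) p`_j *: 'X^j.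
    rewrite -poly_def; apply/polyP => j; rewrite coef_poly; case: ltnP => // hj.
    by rewrite nth_default // (leq_trans (size_loc _ _ _)).
  have -> : (\sum_(j < q.+1) p`_j *: 'X^j)^`() = \sum_(j < q.+1) (p`_j *: 'X^j)^`().
    exact: raddf_sum.
  rewrite horner_sum; apply: eq_bigr => j _.
  by rewrite derivZ derivXn hornerZ hornerMn hornerXn -[X in _ = _ * X]mulr_natl mulrC.
rewrite /p deriv_exp derivD derivC derivZ derivX add0r hornerMn hornerM hornerZ hornerC mulr1.
rewrite horner_exp hornerD hornerC hornerZ hornerX (_ : a + k * x = t); last by rewrite /x; field.
by rewrite -[X in _ = _ * X]mulr_natl mulrCA mulKf.
Qed.

End LocalCoefficients.

Section StepEquation.
Variables (R : realType) (H : lmodType R) (n q : nat).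
Variables (ip : H -> H -> R) (e : 'I_n -> H) (K : 'M[R]_n).
Hypotheses (ipP : is_inner_product ip) (eP : lin_indep e) (KP : sym_posdef K).
Local Notation G := (gram ip e).
Local Notation mu := (@lebesgue_measure R).

Lemma ip_elem h (x : 'cV[R]_n) : ip h (elem e x) = \sum_a x a 0 * ip h (e a).
Proof.
have [lin sym _] := ipP.
have ip0 z : ip 0 z = 0 by have := lin (-1) 0 0 z; rewrite scaleN1r oppr0 add0r; lra.
rewrite sym /elem; elim/big_rec2: _ => [|i a b _ <-]; first exact: ip0.
by rewrite lin (sym (e i)).
Qed.

Lemma gram_posdef : sym_posdef G.
Proof.
have [lin sym pos] := ipP; split.
  by apply/matrixP => i j; rewrite !mxE sym.
move=> x x0; have -> : bil G x x = ip (elem e x) (elem e x).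
  rewrite ip_elem /bil mxE; apply: eq_bigr => j _; rewrite mulrC; congr (_ * _).
  rewrite sym ip_elem mxE; apply: eq_bigr => i _; rewrite !mxE; congr (_ * _); exact: sym.
apply: pos; apply: contra x0 => /eqP h; apply/eqP; exact: eP.
Qed.

Lemma posdef_unit m (A : 'M[R]_m) : sym_posdef A -> A \in unitmx.
Proof.
move=> [_ pA]; apply: mulmx_ker_unit => x hx; apply/eqP; apply/negPn/negP => x0.
by have := pA _ x0; rewrite /bil -mulmxA hx mulmx0 mxE ltxx.
Qed.

Lemma bil0r (A : 'M[R]_n) x : bil A x 0 = 0.
Proof. by rewrite /bil mulmx0 mxE. Qed.

Lemma bilZr (A : 'M[R]_n) x c y : bil A x (c *: y) = c * bil A x y.
Proof. by rewrite /bil -scalemxAr mxE. Qed.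

Lemma bilBl (A : 'M[R]_n) x y z : bil A (x - y) z = bil A x z - bil A y z.
Proof. by rewrite /bil linearB !mulmxBl !mxE. Qed.

Lemma bil_suml (A : 'M[R]_n) (I : Type) (r : seq I) (c : I -> R) (x : I -> 'cV[R]_n) y :
  bil A (\sum_(i <- r) c i *: x i) y = \sum_(i <- r) c i * bil A (x i) y.
Proof.
rewrite /bil linear_sum /= !mulmx_suml summxE; apply: eq_bigr => i _.
by rewrite linearZ /= -!scalemxAl mxE.
Qed.

Lemma bil_delta (A : 'M[R]_n) x a : A^T = A -> bil A x (delta_mx a 0) = (A *m x) a 0.
Proof.
move=> sA; rewrite /bil -colE mxE -{1}sA -trmx_mul mxE.
by [].
Qed.

Variables (M : nat) (tt : nat -> R) (f : R -> H) (U : nat -> 'I_q.+1 -> 'cV[R]_n) (T : R).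
Hypothesis ttP : time_partition T M tt.
Hypothesis intf : forall a, mu.-integrable `]0, T] (fun t => (ip (f t) (e a))%:E).
Hypothesis galerkin : forall Phi : nat -> 'I_q.+1 -> 'cV[R]_n,
  Bform G K M tt U Phi = load ip e M tt f Phi.

Lemma tt_lt i j : (i < j <= M)%N -> tt i < tt j.
Proof.
move=> /andP[ij jM]; have [_ _ h] := ttP; elim: j ij jM => // j ih.
rewrite ltnS leq_eqVlt => /predU1P[->|ij] jM; first exact: h.
by apply: lt_trans (ih ij (ltnW jM)) (h _ jM).
Qed.

Lemma tt_le i j : (i <= j <= M)%N -> tt i <= tt j.
Proof.
move=> /andP[]; rewrite leq_eqVlt => /predU1P[-> //|ij jM].
by apply/ltW/tt_lt; rewrite ij.
Qed.

Lemma kstep_gt0 m : (0 < m <= M)%N -> 0 < kstep tt m.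
Proof.
by case: m => // m /andP[_ mM]; rewrite /kstep subr_gt0 tt_lt // ltnSn.
Qed.

Lemma Im_sub m : (0 < m <= M)%N -> Im_ tt m `<=` `]0, T]%classic.
Proof.
case: m => // m /andP[_ mM] t; rewrite /Im_ /= !in_itv /= => /andP[h1 h2].
have [t0 tM _] := ttP; rewrite -{1}t0 -tM (le_lt_trans _ h1) ?(le_trans h2) //.
  by apply: tt_le; rewrite leqnn mM.
by apply: tt_le; rewrite leq0n ltnW.
Qed.

Lemma measurable_Im m : @measurable _ (g_sigma_algebraType (R.-ocitv.-measurable)) (Im_ tt m).
Proof. exact: measurable_itv. Qed.

Lemma int_ip m a : (0 < m <= M)%N -> mu.-integrable (Im_ tt m) (EFin \o (fun t => ip (f t) (e a))).
Proof.
move=> hm; apply: (@integrableS _ _ _ mu `]0, T]%classic); last exact: intf.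
- exact: measurable_itv.
- exact: measurable_itv.
- exact: Im_sub.
Qed.

Definition stepX m (j : 'I_q.+1) : 'cV[R]_n := locX (tt m.-1) (kstep tt m) (U m) j.
(** The value at t_(m-1)^-, with 0 before the first interval; this turns the initial term of B into
    a jump like the others. *)
Definition prevu m : 'cV[R]_n := if (m <= 1)%N then 0 else dgval U m.-1 (tt m.-1).
Definition stepF m (i : nat) : 'cV[R]_n :=
  \col_a Rintegral mu (Im_ tt m)
    (fun t => scaled (tt m.-1) (tt m) i t * (proj_coord ip e (f t)) a 0).

Lemma dgval_stepX m t : (0 < m <= M)%N ->
  dgval U m t = \sum_(j < q.+1) scaled (tt m.-1) (tt m) j t *: stepX m j.
Proof.
move=> hm; have k0 : kstep tt m != 0 by rewrite gt_eqF // kstep_gt0.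
by rewrite /dgval (locX_val (tt m.-1) _ _ k0).
Qed.

Lemma dgder_stepX m t : (0 < m <= M)%N ->
  dgder U m t = (kstep tt m)^-1 *:
    \sum_(j < q.+1) (j%:R * scaled (tt m.-1) (tt m) j.-1 t) *: stepX m j.
Proof.
move=> hm; have k0 : kstep tt m != 0 by rewrite gt_eqF // kstep_gt0.
by rewrite /dgder (locX_der (tt m.-1) _ _ k0).
Qed.

Lemma scaled_left a b i : scaled a b i a = (i == 0%N)%:R :> R.
Proof. by rewrite /scaled subrr mul0r expr0n. Qed.

Lemma scaled_right a b i : a != b -> scaled a b i b = 1 :> R.
Proof. by move=> ab; rewrite /scaled divff ?expr1n // subr_eq0 eq_sym. Qed.

(** The function ((t - t_(m-1)) / k_m)^i chi on I_m, extended by 0, in the monomial coefficients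
    that [Bform] expects. *)
Definition testPhi m (i : nat) (chi : 'cV[R]_n) (m' : nat) (j : 'I_q.+1) : 'cV[R]_n :=
  if m' == m then (((kstep tt m)^-1 *: ('X - (tt m.-1)%:P) : {poly R}) ^+ i)`_j *: chi else 0.

Lemma testPhi_val m (i : 'I_q.+1) chi m' t :
  dgval (testPhi m i chi) m' t =
  if m' == m then scaled (tt m.-1) (tt m) i t *: chi else 0.
Proof.
rewrite /dgval /testPhi; case: eqVneq => [_|_]; last by rewrite big1 // => j _; rewrite scaler0.
under eq_bigr do rewrite scalerA mulrC.
rewrite -scaler_suml -horner_coef_wide ?scaled_horner //.
apply: leq_trans (size_poly_exp_leq _ _) _; rewrite ltnS.
apply: (@leq_trans (1 * i)%N); last by rewrite mul1n -ltnS.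
rewrite leq_mul2r; apply/orP; right.
have hp : (size (((kstep tt m)^-1 *: ('X - (tt m.-1)%:P))%R : {poly R}) <= 2)%N.
  by apply: leq_trans (size_scale_leq _ _) _; rewrite size_XsubC.
by case: (size _) hp => [|[|[]]].
Qed.

Lemma Rintegral0 (D : set R) : Rintegral mu D (fun=> 0) = 0.
Proof. by rewrite /Rintegral integral0. Qed.

(** Test functions may be discontinuous in time, so one may live on I_m only. The jump at t_m does
    not see it, being paired with the value from the right. *)
Lemma galerkin_scalar m (i : 'I_q.+1) chi : (0 < m <= M)%N ->
  \sum_j stf R q i j * bil G (stepX m j) chi +
  kstep tt m * \sum_j hilb R q.+1 i j * bil K (stepX m j) chi =
  (i == 0%N :> nat)%:R * bil G (prevu m) chi +
  \sum_a chi a 0 * Rintegral mu (Im_ tt m)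
    (fun t => scaled (tt m.-1) (tt m) i t * ip (f t) (e a)).
Proof.
move=> hm; have := galerkin (testPhi m i chi); set k := kstep tt m.
have k0 : 0 < k := kstep_gt0 hm; have kn : k != 0 by rewrite gt_eqF.
have tlt : tt m.-1 < tt m by rewrite -subr_gt0.
have mS : m \in index_iota 1 M.+1 by rewrite mem_index_iota ltnS.
have single (F : nat -> R) : (forall m', m' != m -> F m' = 0) ->
    \sum_(1 <= m' < M.+1) F m' = F m.
  move=> hF; rewrite (bigD1_seq m) ?iota_uniq //= big1 ?addr0 // => m' /hF //.
rewrite /Bform /load.
rewrite [X in X + _ + _ + _ = _]single; last first.
  move=> m' m'm; rewrite -[RHS](Rintegral0 (Im_ tt m')); apply: eq_Rintegral => t _.
  by rewrite testPhi_val (negbTE m'm) bil0r.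
rewrite [X in _ + X + _ + _ = _]single; last first.
  move=> m' m'm; rewrite -[RHS](Rintegral0 (Im_ tt m')); apply: eq_Rintegral => t _.
  by rewrite testPhi_val (negbTE m'm) bil0r.
rewrite [X in _ = X]single; last first.
  move=> m' m'm; rewrite -[RHS](Rintegral0 (Im_ tt m')); apply: eq_Rintegral => t _.
  rewrite testPhi_val (negbTE m'm) ip_elem.
  by rewrite big1 // => a _; rewrite mxE mul0r.
have term1 : Rintegral mu (Im_ tt m) (fun t => bil G (dgder U m t) (dgval (testPhi m i chi) m t)) =
    \sum_(j < q.+1) (j%:R / (i + j)%:R) * bil G (stepX m j) chi.
  have -> : (fun t => bil G (dgder U m t) (dgval (testPhi m i chi) m t)) =
    (fun t => \sum_(j < q.+1) (k^-1 * j%:R * bil G (stepX m j) chi) *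
       scaled (tt m.-1) (tt m) (i + j.-1) t).
    apply/funext => t; rewrite testPhi_val eqxx dgder_stepX // -/k scaler_sumr.
    under eq_bigr do rewrite scalerA.
    rewrite bil_suml; apply: eq_bigr => j _; rewrite bilZr /scaled exprD; ring.
  rewrite Rintegral_comb; [|exact: measurable_Im|by move=> j; exact: scaled_integrable].
  apply: eq_bigr => j _; rewrite scaled_Rintegral // -/(kstep tt m) -/k.
  (* For j = 0 the exponent [j.-1] is meaningless, but the coefficient j vanishes on both sides. *)
  have [j0|j0] := posnP j; first by rewrite j0 mulr0 !mul0r.
  rewrite -addnS prednK //.
  have : (i + j)%:R != 0 :> R by rewrite pnatr_eq0 addn_eq0 negb_and -!lt0n j0 orbT.
  by move: ((i + j)%:R) => nn nn0; field; rewrite kn nn0.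
have term2 : Rintegral mu (Im_ tt m) (fun t => bil K (dgval U m t) (dgval (testPhi m i chi) m t)) =
    k * \sum_(j < q.+1) hilb R q.+1 i j * bil K (stepX m j) chi.
  have -> : (fun t => bil K (dgval U m t) (dgval (testPhi m i chi) m t)) =
    (fun t => \sum_(j < q.+1) (bil K (stepX m j) chi) * scaled (tt m.-1) (tt m) (i + j) t).
    apply/funext => t; rewrite testPhi_val eqxx dgval_stepX //.
    rewrite bil_suml; apply: eq_bigr => j _; rewrite bilZr /scaled exprD; ring.
  rewrite Rintegral_comb; [|exact: measurable_Im|by move=> j; exact: scaled_integrable].
  rewrite mulr_sumr; apply: eq_bigr => j _; rewrite scaled_Rintegral // -/(kstep tt m) -/k mxE.
  by ring.
(* The jumps are indexed from 2 on and the initial value is a separate term: for m = 1 only the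
   latter survives, for m > 1 only one jump does. *)
have term3 : \sum_(2 <= m' < M.+1) bil G (dgjump tt U m') (dgval (testPhi m i chi) m' (tt m'.-1)) +
    bil G (dgval U 1 (tt 0%N)) (dgval (testPhi m i chi) 1 (tt 0%N)) =
    (i == 0%N :> nat)%:R * (bil G (stepX m ord0) chi - bil G (prevu m) chi).
  have v0 : dgval U m (tt m.-1) = stepX m ord0.
    rewrite dgval_stepX // (bigD1 ord0) //= scaled_left eqxx scale1r big1 ?addr0 //.
    move=> j j0; rewrite scaled_left (_ : (j == 0%N :> nat) = false) ?scale0r //; exact/negbTE.
  have [m1|m1] := leqP m 1.
    have m1' : m = 1%N by apply/eqP; rewrite eqn_leq m1; case/andP: hm.
    rewrite big_nat_cond big1 ?add0r; last first.
      move=> m' /andP[/andP[h2 _] _]; rewrite testPhi_val m1' gtn_eqF ?bil0r //.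
    rewrite testPhi_val m1' eqxx bilZr /= scaled_left; congr (_ * _).
    have -> : dgval U 1 (tt 0%N) = stepX 1 ord0 by move: v0; rewrite m1'.
    by rewrite /prevu /= [X in _ - X](_ : _ = 0) ?subr0 // /bil trmx0 !mul0mx mxE.
  rewrite [X in _ + X](_ : _ = 0) ?addr0; last by rewrite testPhi_val ltn_eqF // bil0r.
  rewrite (bigD1_seq m) ?iota_uniq //=; last by rewrite mem_index_iota m1 ltnS; case/andP: hm.
  rewrite big1 ?addr0; last by move=> m' /negbTE m'm; rewrite testPhi_val m'm bil0r.
  rewrite testPhi_val eqxx bilZr scaled_left /dgjump /prevu leqNgt m1 /=.
  by rewrite bilBl v0.
have term4 : Rintegral mu (Im_ tt m) (fun t => ip (f t) (elem e (dgval (testPhi m i chi) m t))) =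
    \sum_a chi a 0 * Rintegral mu (Im_ tt m)
      (fun t => scaled (tt m.-1) (tt m) i t * ip (f t) (e a)).
  rewrite -Rintegral_comb; [|exact: measurable_Im|]; last first.
    by move=> a; apply: integrable_scaledM; exact: int_ip.
  apply: eq_Rintegral => t _; rewrite testPhi_val eqxx ip_elem.
  by apply: eq_bigr => a _; rewrite mxE; ring.
rewrite term1 term2 -addrA term3 term4 => <-.
rewrite (_ : \sum_j stf R q i j * _ = \sum_(j < q.+1) (j%:R / (i + j)%:R) * bil G (stepX m j) chi
   + (i == 0%N :> nat)%:R * bil G (stepX m ord0) chi); first by ring.
under eq_bigr do rewrite mxE mulrDl.
rewrite big_split /=; congr (_ + _); rewrite (bigD1 ord0) //= andbT big1 ?addr0 //.
by move=> j j0; rewrite (_ : (j == 0%N :> nat) = false) ?andbF ?mul0r //; exact/negbTE.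
Qed.

Lemma step_equation m (i : 'I_q.+1) : (0 < m <= M)%N ->
  \sum_j stf R q i j *: stepX m j +
  kstep tt m *: \sum_j hilb R q.+1 i j *: (invmx G *m K *m stepX m j) =
  (i == 0%N :> nat)%:R *: prevu m + stepF m i.
Proof.
move=> hm; have uG := posdef_unit gram_posdef; have [sG _] := gram_posdef; have [sK _] := KP.
apply: (can_inj (mulKmx uG)); apply/colP => a.
have := galerkin_scalar i (delta_mx a 0) hm.
under eq_bigr do rewrite bil_delta //.
under [X in _ + _ * X]eq_bigr do rewrite bil_delta //.
rewrite bil_delta // [X in _ = _ + X](bigD1 a) //= [delta_mx a 0 a 0]mxE !eqxx mul1r.
rewrite [X in _ = _ + (_ + X)]big1 ?addr0; last first.
  by move=> b ba; rewrite [delta_mx _ _ _ _]mxE (negbTE ba) mul0r.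
move=> h.
rewrite !mulmxDr -!scalemxAr !mulmx_sumr.
(* The Gram matrix undoes the L^2 projection: the moments of P_h f become those of (f, e_b). *)
have -> : G *m stepF m i = \col_b Rintegral mu (Im_ tt m)
    (fun t => scaled (tt m.-1) (tt m) i t * ip (f t) (e b)).
  apply: (can_inj (mulKVmx uG)); rewrite mulKmx //.
  apply/colP => b; rewrite mxE /proj_coord mxE.
  under [RHS]eq_bigr do rewrite mxE.
  rewrite -Rintegral_comb; [|exact: measurable_Im|]; last first.
    by move=> c; apply: integrable_scaledM; exact: int_ip.
  apply: eq_Rintegral => t _; rewrite mxE mulr_sumr; apply: eq_bigr => c _.
  by rewrite mxE; ring.
rewrite [RHS]mxE [X in _ = X + _]mxE [X in _ = _ + X]mxE -h.
rewrite [LHS]mxE [X in _ + X = _]mxE !summxE; congr (_ + _ * _).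
  by apply: eq_bigr => j _; rewrite -scalemxAr [LHS]mxE.
apply: eq_bigr => j _; rewrite -scalemxAr [LHS]mxE.
by rewrite !mulmxA mulmxV // mul1mx.
Qed.

End StepEquation.

(** * Bounds for the solution of the recurrence *)

Section StepBounds.
Variables (R : realType) (n q : nat) (P : 'M[R[i]]_n) (d : 'I_n -> R).
Hypotheses (uP : P \in unitmx) (d0 : forall i, 0 < d i).
Variables (N : 'cV[R[i]]_n -> R) (gamma Mh : R) (D : 'M[R]_n).
Hypotheses (normN : is_norm N) (gamma_bd : 0 < gamma < pi / 2).
Hypotheses (hD : toCM D = - fcalc P d id) (res : resolvent_estimate N D gamma Mh).
Variable theta : R.
Hypotheses (theta_bd : 0 < theta < pi / 2) (gamma_theta : gamma < theta).
Local Notation delta := (cos theta).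
Local Notation fc := (fcalc P d).
Local Notation Nr v := (N (toC v)).
Local Notation Q := (@dginv R q).
Local Notation Smx := (toCM (stf R q)).
Local Notation Wmx := (toCM (hilb R q.+1)).

Let delta0 : 0 < delta. Proof. exact: cos_theta_gt0. Qed.
Let MN v : 0 <= Mh * Nr v := Mh_norm_ge0 uP d0 normN gamma_bd hD res v.

Lemma fcalc_coord (G : R[i] -> R[i]) m (v : 'M[R[i]]_(n, m)) i j :
  (invmx P *m (fc G *m v)) i j = G (d i)%:C * (invmx P *m v) i j.
Proof. by rewrite unlock -!mulmxA mulKmx // mul_diag_mx !mxE. Qed.

Lemma eq_coord m (v w : 'M[R[i]]_(n, m)) :
  (forall i j, (invmx P *m v) i j = (invmx P *m w) i j) -> v = w.
Proof. by move=> h; apply: (can_inj (mulKVmx uP)); apply/matrixP. Qed.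

(** (1 + k A)^-1 tends to the identity as k tends to 0, while its norm stays bounded by Mh; the
    difference is at most k d_i on the i-th eigencomponent. *)
Lemma norm_le_Mh (v : 'cV[R]_n) : Nr v <= Mh * Nr v.
Proof.
pose w i := (invmx P *m toC v) i 0 *: col i P.
have fcE G : fc G *m toC v = \sum_i G (d i)%:C *: w i.
  rewrite unlock /w -!mulmxA; move: (invmx P *m toC v) => y.
  apply/colP => a; rewrite mxE summxE; apply: eq_bigr => i _.
  by rewrite mul_diag_mx !mxE; ring.
have E0 : 0 <= \sum_i d i * N (w i).
  by rewrite sumr_ge0 // => i _; rewrite mulr_ge0 ?(ltW (d0 i)) // norm_ge0.
apply: (le_inv_nat E0) => nu nu0; set k : R := nu%:R^-1.
have k0 : 0 < k by rewrite invr_gt0 ltr0n.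
have h i : k%:C * (d i)%:C + 1 != 0.
  rewrite -rmorphM -(rmorph1 (real_complex R)) -rmorphD eq_complex /= eqxx andbT gt_eqF //.
  by rewrite addr_gt0 // mulr_gt0.
have -> : toC v = fc (fun z => (k%:C * z + 1)^-1) *m toC v
   + fc (fun z => k%:C * z / (k%:C * z + 1)) *m toC v.
  rewrite -mulmxDl fcalcD (eq_fcalc P (G := fun=> 1)) ?fcalc_cst ?mul1mx // => i.
  by field; exact: h.
apply: le_trans (normD normN _ _) _; apply: lerD.
  rewrite -[X in _ <= _ * N X](_ : toC v = _).
    exact: (fcalc_one_plus_inv uP d0 normN gamma_bd hD res v k0).
  rewrite -mulmxDl fcalcD (eq_fcalc P (G := fun=> 1)) ?fcalc_cst ?mul1mx // => i.
  by field; exact: h.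
rewrite fcE; apply: le_trans (norm_sum normN _ _ _) _; rewrite mulr_suml.
apply: ler_sum => i _; rewrite (normZ normN) [leRHS]mulrAC ler_wpM2r ?norm_ge0 //.
rewrite -rmorphM -(rmorph1 (real_complex R)) -rmorphD cmodM cmodV !cmod_real.
have kd : 0 < k * d i by rewrite mulr_gt0.
rewrite !gtr0_norm ?addr_gt0 // mulrC -/k [leRHS]mulrC.
rewrite ler_piMl ?(ltW kd) // invf_le1 ?addr_gt0 // lerDr ltW //.
Qed.

Variables (CQ Cr CL CS CW : R) (c : R).
Hypotheses (CQ0 : 0 <= CQ) (Cr0 : 0 <= Cr) (CL0 : 0 <= CL) (CS0 : 0 <= CS) (CW0 : 0 <= CW).
Hypotheses (c0 : 0 < c) (c1 : c <= 1).
Hypothesis hQ : forall z i j, sect delta z -> cmod (Q z i j) <= CQ / (1 + cmod z).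
Hypothesis hr : forall z (i : 'I_q.+1), sect delta z -> cmod (dgstab i z) <= Cr / (1 + cmod z).
Hypothesis hc : forall z, sect delta z -> cmod (dgstab (@ord0 q) z) * (1 + c * cmod z) <= 1.
Hypothesis hL : forall z (i j : 'I_q.+1), sect delta z ->
  cmod (dgloc i j z) <= CL * (cmod z / (1 + cmod z) ^+ 2).
Hypothesis hS : forall i j, cmod (Smx i j) <= CS /\ cmod (invmx Smx i j) <= CS.
Hypothesis hW : forall i j, cmod (Wmx i j) <= CW /\ cmod (invmx Wmx i j) <= CW.

(** The part [dgloc] decays at both ends and falls under [fcalc_bound]; the part split off is a
    resolvent on the negative axis. *)
Lemma local_bound (k : R) i j v : 0 < k ->
  N (fc (fun z => Q (k%:C * z) i j) *m toC v) <= (CL + CS) * (Mh * Nr v).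
Proof.
move=> k0; have -> : fc (fun z => Q (k%:C * z) i j) =
    fc (fun z => dgloc i j (k%:C * z)) + invmx Smx i j *: fc (fun z => (k%:C * z + 1)^-1).
  rewrite fcalcZ fcalcD; apply: eq_fcalc => a; by rewrite /dgloc subrK.
rewrite mulmxDl -scalemxAl mulrDl; apply: le_trans (normD normN _ _) _; apply: lerD.
  apply: (fcalc_bound uP d0 normN gamma_bd hD res theta_bd gamma_theta (sig := k)) => //.
    move=> a; apply: (divdiff_scale (f := dgloc i j)) => //.
    by apply: divdiff_dgloc => //; rewrite mulr_gt0.
  move=> z zs; have := hL i j (sectM k0 zs).
  by rewrite cmod_realM gtr0_norm.
rewrite (normZ normN); apply: ler_pM; rewrite ?cmod_ge0 ?norm_ge0 //.
  by case: (hS i j).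
exact: (fcalc_one_plus_inv uP d0 normN gamma_bd hD res v k0).
Qed.

Let nq : R := q.+1%:R.
Definition Cloc : R := nq * (CW * (1 + nq * (CS * (CL + CS)))).

Lemma Cloc_ge0 : 0 <= Cloc.
Proof. by rewrite !(mulr_ge0, addr_ge0) // ?ler0n. Qed.

(** z Q(k z) tends to a nonzero constant matrix at infinity, so it is written as k^-1 W^-1 (1 - S
    Q(k z)); the identity is then bounded by [norm_le_Mh]. *)
Lemma local_scaled_bound (k : R) i j v : 0 < k ->
  N (fc (fun z => z * Q (k%:C * z) i j) *m toC v) <= Cloc * (k^-1 * (Mh * Nr v)).
Proof.
move=> k0; have kn : k%:C != 0 :> R[i] by rewrite eq_complex /= eqxx andbT gt_eqF.
have -> : fc (fun z => z * Q (k%:C * z) i j) = k^-1%:C *: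
   \sum_b invmx Wmx i b *: ((b == j)%:R%:M - \sum_a Smx b a *: fc (fun z => Q (k%:C * z) a j)).
  have -> : \sum_b invmx Wmx i b *: ((b == j)%:R%:M - \sum_a Smx b a *: fc (fun z => Q (k%:C * z) a j))
     = fc (fun z => \sum_b invmx Wmx i b * ((b == j)%:R - \sum_a Smx b a * Q (k%:C * z) a j)).
    rewrite -fcalc_sum; apply: eq_bigr => b _; rewrite -fcalcZ -fcalcB; congr (_ *: (_ - _)).
      by rewrite fcalc_cst.
    by rewrite -fcalc_sum; apply: eq_bigr => a _; rewrite fcalcZ.
  rewrite fcalcZ; apply: eq_fcalc => a.
  have zs : sect delta (k%:C * (d a)%:C).
    by rewrite -rmorphM; apply: sect_real => //; rewrite mulr_gt0.
  have := dginv_scaled q delta0 zs => /matrixP/(_ i j); rewrite [in X in X -> _]mxE.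
  rewrite [in X in X -> _]mxE => e.
  have -> : \sum_b invmx Wmx i b * ((b == j)%:R - \sum_l Smx b l * Q (k%:C * (d a)%:C) l j) =
    \sum_b invmx Wmx i b * (1%:M - Smx *m Q (k%:C * (d a)%:C)) b j.
    apply: eq_bigr => b _; congr (_ * _); rewrite mxE; congr (_ + _).
      by rewrite mxE.
    by rewrite mxE; congr (- _); rewrite mxE.
  by rewrite -e fmorphV; field.
rewrite -scalemxAl (normZ normN) cmod_real gtr0_norm ?invr_gt0 // mulrCA.
rewrite ler_wpM2l ?invr_ge0 ?(ltW k0) // mulmx_suml.
apply: le_trans (norm_sum normN _ _ _) _.
apply: (@le_trans _ _ (\sum_(b < q.+1) (CW * (1 + nq * (CS * (CL + CS)))) * (Mh * Nr v))); last first.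
  by rewrite sumr_const card_ord -[X in X <= _]mulr_natl mulrA.
apply: ler_sum => b _; rewrite -scalemxAl (normZ normN) -mulrA.
apply: ler_pM; rewrite ?cmod_ge0 ?norm_ge0 //; first by case: (hW i b).
rewrite mulmxBl mulrDl mul1r; apply: le_trans (normB normN _ _) _; apply: lerD.
  rewrite mul_scalar_mx (normZ normN); case: (b == j); rewrite ?cmod1 ?cmod0 ?mul0r ?mul1r //.
  exact: norm_le_Mh.
rewrite mulmx_suml; apply: le_trans (norm_sum normN _ _ _) _.
apply: (@le_trans _ _ (\sum_(a < q.+1) (CS * (CL + CS)) * (Mh * Nr v))); last first.
  by rewrite sumr_const card_ord -[X in X <= _]mulr_natl mulrA.
apply: ler_sum => a _; rewrite -scalemxAl (normZ normN) -mulrA.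
apply: ler_pM; rewrite ?cmod_ge0 ?norm_ge0 //; first by case: (hS b a).
exact: local_bound.
Qed.

Variables (M : nat) (k : nat -> R) (kap : R).
Hypotheses (kap0 : 0 < kap) (k0 : forall m, (0 < m <= M)%N -> 0 < k m).
Hypothesis kk : forall m, (0 < m < M)%N -> k m <= kap * k m.+1 /\ k m.+1 <= kap * k m.
Local Notation len l m := (\sum_(l <= p < m.+1) k p).

Lemma len_gt0 l m : (0 < l)%N -> (l <= m <= M)%N -> 0 < len l m.
Proof.
move=> l0 /andP[lm mM]; rewrite big_nat_recr //= ltr_wpDl //; last first.
  by rewrite k0 // (leq_trans l0 lm) mM.
rewrite big_nat_cond sumr_ge0 // => p /andP[/andP[lp pm] _]; apply/ltW/k0.
by rewrite (leq_trans l0 lp) (leq_trans (ltnW pm)).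
Qed.

(** The response on I_m to the i-th moment of the load on I_l: exit from step l, passage through the
    steps between, and a last factor with a gain z, where g is an entry of Q or of (Q - 1) / z. *)
Definition propag (g : R[i] -> R[i]) l m (i : 'I_q.+1) (z : R[i]) : R[i] :=
  z * g ((k m)%:C * z) *
  ((\prod_(l.+1 <= p < m) dgstab (@ord0 q) ((k p)%:C * z)) * dgstab i ((k l)%:C * z)).

(** All factors, those of the end steps l and m included, contribute 1 / (1 + c k_p |z|), so
    [prod_ge_sqr] yields (1 + sig |z|)^2 with sig proportional to t_m - t_(l-1). The remaining |z|
    is paid for by 1 / sig. *)
Lemma propag_bound g Cg l m i v : 0 <= Cg -> (0 < l < m)%N -> (m <= M)%N ->
  (forall lam, 0 < lam -> divdiff delta lam (fun z => z * g z)) ->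
  (forall z, sect delta z -> cmod (g z) <= Cg / (1 + cmod z)) ->
  N (fc (propag g l m i) *m toC v) <= (Cg * Cr * ((1 + 2 * kap) / c)) * (Mh * Nr v / len l m).
Proof.
move=> Cg0 /andP[l0 lm] mM dg bg.
have m0 : (0 < m)%N by exact: leq_trans lm.
have km0 : 0 < k m by rewrite k0 // m0 mM.
have kl0 : 0 < k l by rewrite k0 // l0 (leq_trans (ltnW lm)).
have L0 : 0 < len l m by apply: len_gt0 => //; rewrite (ltnW lm) mM.
have kp1 : 0 < 1 + 2 * kap by rewrite ltr_pwDl // mulr_ge0 // ltW.
pose sig := (1 + 2 * kap)^-1 * (c * len l m).
have s0 : 0 < sig by rewrite mulr_gt0 ?invr_gt0 // mulr_gt0.
have -> : Cg * Cr * ((1 + 2 * kap) / c) * (Mh * Nr v / len l m) = (Cg * Cr / sig) * (Mh * Nr v).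
  by rewrite /sig; field; rewrite (gt_eqF L0) (gt_eqF c0) (gt_eqF kp1).
apply: (fcalc_bound uP d0 normN gamma_bd hD res theta_bd gamma_theta (sig := sig)) => //.
- by rewrite divr_ge0 ?(ltW s0) ?mulr_ge0.
- move=> a; rewrite /propag; apply: divdiffM.
    have e (z : R[i]) : z * g ((k m)%:C * z) = (k m)^-1%:C * ((k m)%:C * z * g ((k m)%:C * z)).
      by rewrite fmorphV; field; rewrite eq_complex /= eqxx andbT gt_eqF.
    apply: (@divdiff_ext _ _ _ (fun z => (k m)^-1%:C * ((k m)%:C * z * g ((k m)%:C * z)))).
    + by rewrite -e.
    + by move=> z _; rewrite -e.
    apply: divdiffZ; apply: (divdiff_scale (f := fun z => z * g z)) => //.
    by apply: dg; rewrite mulr_gt0.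
  apply: divdiffM; last first.
    apply: (divdiff_scale (f := dgstab i)) => //; apply: divdiff_dgstab => //.
    by rewrite mulr_gt0.
  (* Outside 1..M the sign of k_p is unknown; the factor is set to 1 there because [divdiff_prod]
     asks for every index. *)
  apply: (@divdiff_ext _ _ _ (fun z => \prod_(l.+1 <= p < m)
     (if (0 < p <= M)%N then dgstab (@ord0 q) ((k p)%:C * z) else 1))).
  + apply: eq_big_nat => p /andP[lp pm].
    by rewrite (leq_trans _ lp) // (leq_trans (ltnW pm)).
  + move=> z _; apply: eq_big_nat => p /andP[lp pm].
    by rewrite (leq_trans _ lp) // (leq_trans (ltnW pm)).
  apply: (@divdiff_prod _ _ _ _ _ _ (fun p z =>
     if (0 < p <= M)%N then dgstab (@ord0 q) ((k p)%:C * z) else 1)) => p.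
  case hp : (0 < p <= M)%N; last exact: divdiff_cst.
  apply: (divdiff_scale (f := dgstab (@ord0 q))); first exact: k0.
  by apply: divdiff_dgstab => //; rewrite mulr_gt0 // k0.
move=> z zs; set rho := cmod z; have r0 : 0 <= rho := cmod_ge0 _.
have sc p : (0 < p <= M)%N -> sect delta ((k p)%:C * z) by move=> hp; apply: sectM => //; exact: k0.
have cs p : (0 < p <= M)%N -> cmod ((k p)%:C * z) = k p * rho.
  by move=> hp; rewrite cmod_realM gtr0_norm // k0.
pose x p := c * k p * rho.
have x0 p : (0 < p <= M)%N -> 0 <= x p by move=> hp; rewrite !mulr_ge0 ?(ltW c0) // ltW // k0.
have pm : 0 < 1 + x m by rewrite ltr_pwDl // x0 // m0 mM.
have pl : 0 < 1 + x l by rewrite ltr_pwDl // x0 // l0 (leq_trans (ltnW lm)).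
have hmM : (0 < m <= M)%N by rewrite m0 mM.
have hlM : (0 < l <= M)%N by rewrite l0 (leq_trans (ltnW lm)).
(* Since c <= 1, the two end factors can be weakened to the same denominators as the stability
   functions. *)
have small p C : 0 <= C -> (0 < p <= M)%N -> C / (1 + k p * rho) <= C / (1 + x p).
  move=> C0 hp; rewrite ler_wpM2l // lef_pV2 ?posrE ?ltr_pwDl ?x0 ?mulr_ge0 ?(ltW (k0 hp)) //.
  by rewrite lerD2l /x -mulrA ler_piMl // mulr_ge0 // ltW // k0.
have b1 : cmod (g ((k m)%:C * z)) <= Cg / (1 + x m).
  by apply: le_trans (bg _ (sc _ hmM)) _; rewrite cs // small.
have b2 : cmod (dgstab i ((k l)%:C * z)) <= Cr / (1 + x l).
  by apply: le_trans (hr i (sc _ hlM)) _; rewrite cs // small.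
have pr0 : 0 < \prod_(l.+1 <= p < m) (1 + x p).
  rewrite big_nat_cond prodr_gt0 // => p /andP[/andP[lp pm'] _].
  by rewrite ltr_pwDl // x0 // (leq_trans _ lp) // (leq_trans (ltnW pm')).
have b3 : cmod (\prod_(l.+1 <= p < m) dgstab (@ord0 q) ((k p)%:C * z)) <=
    (\prod_(l.+1 <= p < m) (1 + x p))^-1.
  rewrite cmod_prod -prodfV big_nat_cond [leRHS]big_nat_cond; apply: ler_prod => p.
  move=> /andP[/andP[lp pm'] _]; have hp : (0 < p <= M)%N.
    by rewrite (leq_trans _ lp) // (leq_trans (ltnW pm')).
  rewrite cmod_ge0 /= -[leRHS]mul1r ler_pdivlMr ?ltr_pwDl ?x0 //.
  by have := hc (sc _ hp); rewrite cs // mulrA.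
have big : (1 + sig * rho) ^+ 2 <= (1 + x l) * (\prod_(l.+1 <= p < m) (1 + x p)) * (1 + x m).
  have -> : (1 + x l) * (\prod_(l.+1 <= p < m) (1 + x p)) * (1 + x m) =
     \prod_(l <= p < m.+1) (1 + x p).
    by rewrite big_nat_recr ?(ltnW lm) //= [in RHS]big_ltn.
  have -> : sig * rho = (1 + 2 * kap)^-1 * \sum_(l <= p < m.+1) x p.
    by rewrite /x -mulr_suml -mulr_sumr /sig !mulrA.
  apply: prod_ge_sqr => //.
    by move=> p /andP[lp pm']; apply: x0; rewrite (leq_trans l0 lp) (leq_trans pm').
  move=> p /andP[lp pm']; have [] := kk (_ : (0 < p < M)%N).
    by rewrite (leq_trans l0 lp) (leq_trans pm').
  move=> h1 h2; have cr : 0 <= c * rho by rewrite mulr_ge0 // ltW.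
  by split; [have := ler_wpM2r cr h1 | have := ler_wpM2r cr h2]; rewrite /x; lra.
rewrite /propag !cmodM -/rho.
apply: (@le_trans _ _ (rho * (Cg / (1 + x m)) * ((\prod_(l.+1 <= p < m) (1 + x p))^-1 * (Cr / (1 + x l))))).
  by apply: ler_pM; rewrite ?mulr_ge0 ?cmod_ge0 //; apply: ler_pM; rewrite ?cmod_ge0.
have sr : 0 < (1 + sig * rho) ^+ 2 by rewrite exprn_gt0 // ltr_pwDl // mulr_ge0 // ltW.
have -> : rho * (Cg / (1 + x m)) * ((\prod_(l.+1 <= p < m) (1 + x p))^-1 * (Cr / (1 + x l))) =
   Cg * Cr * rho / ((1 + x l) * (\prod_(l.+1 <= p < m) (1 + x p)) * (1 + x m)).
  by move: pr0; set Pr := \prod_(_ <= _ < _) _ => pr0; field; rewrite !gt_eqF.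
have -> : Cg * Cr / sig * (sig * rho / (1 + sig * rho) ^+ 2) = Cg * Cr * rho / (1 + sig * rho) ^+ 2.
  by move: sr; set Y := _ ^+ 2 => sr; field; rewrite (gt_eqF s0) (gt_eqF sr).
by rewrite ler_wpM2l ?mulr_ge0 // lef_pV2 ?posrE // (lt_le_trans sr).
Qed.

Variables (X F : nat -> 'I_q.+1 -> 'cV[R]_n) (u : nat -> 'cV[R]_n) (A : 'M[R]_n).
Hypothesis hA : toCM A = fc id.
Hypothesis hE : forall m (i : 'I_q.+1), (0 < m <= M)%N ->
  \sum_j stf R q i j *: X m j + k m *: \sum_j hilb R q.+1 i j *: (A *m X m j) =
  (i == 0%N :> nat)%:R *: u m + F m i.
Hypothesis hu1 : u 1%N = 0.
Hypothesis hu : forall m, (0 < m < M)%N -> u m.+1 = \sum_j X m j.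

(** In every eigencoordinate of A the step is a system of size q + 1 with matrix S + k_m d W. *)
Lemma step_repr m j : (0 < m <= M)%N ->
  toC (X m j) = fc (fun z => Q ((k m)%:C * z) j ord0) *m toC (u m) +
    \sum_i fc (fun z => Q ((k m)%:C * z) j i) *m toC (F m i).
Proof.
move=> hm; apply: eq_coord => a b; rewrite ord1 {b}.
have zs : sect delta ((k m)%:C * (d a)%:C).
  by rewrite -rmorphM; apply: sect_real => //; rewrite mulr_gt0 // k0.
pose co (v : 'cV[R]_n) := (invmx P *m toC v) a 0.
have coD v w : co (v + w) = co v + co w by rewrite /co toCD mulmxDr mxE.
have coZ t v : co (t *: v) = t%:C * co v by rewrite /co toCZ -scalemxAr mxE.
have co0 : co 0 = 0 by rewrite -(scale0r (0 : 'cV_n)) coZ mul0r.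
have coS (t : 'I_q.+1 -> R) v : co (\sum_i t i *: v i) = \sum_i (t i)%:C * co (v i).
  rewrite (big_morph co coD co0); apply: eq_bigr => i _; exact: coZ.
have coA v : co (A *m v) = (d a)%:C * co v.
  rewrite /co -[toC _]/(map_mx (real_complex R) _) map_mxM -[map_mx _ A]/(toCM A) hA.
  exact: fcalc_coord.
pose x : 'cV[R[i]]_q.+1 := \col_i co (X m i).
pose y : 'cV[R[i]]_q.+1 := \col_i ((i == ord0)%:R * co (u m) + co (F m i)).
have xy : dgmx q ((k m)%:C * (d a)%:C) *m x = y.
  apply/colP => i; have h := congr1 co (hE i hm); move: h.
  rewrite !coD !coZ !coS => h.
  rewrite [RHS]mxE -[(i == ord0)%:R](rmorph_nat (real_complex R)) -h.
  rewrite mxE mulr_sumr -big_split /=; apply: eq_bigr => l _.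
  by rewrite dgmxE coA [x l 0]mxE; ring.
have := congr1 (fun v => (Q ((k m)%:C * (d a)%:C) *m v) j 0) xy.
rewrite /= mulmxA (dginvVl q delta0 zs) mul1mx [x j 0]mxE -/(co _) => ->.
rewrite mulmxDr mulmx_sumr [RHS]mxE fcalc_coord summxE.
under [X in _ = _ + X]eq_bigr do rewrite fcalc_coord.
transitivity (\sum_l Q ((k m)%:C * (d a)%:C) j l * ((l == ord0)%:R * co (u m) + co (F m l))).
  by rewrite mxE; apply: eq_bigr => l _; rewrite [y l 0]mxE.
under [LHS]eq_bigr do rewrite mulrDr.
rewrite big_split /=; congr (_ + _).
rewrite (bigD1 ord0) //= big1 ?addr0 ?mul1r // => i i0.
by rewrite (negbTE i0) mul0r mulr0.
Qed.

Lemma stab_repr m : (0 < m < M)%N ->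
  toC (u m.+1) = fc (fun z => dgstab (@ord0 q) ((k m)%:C * z)) *m toC (u m) +
    \sum_i fc (fun z => dgstab i ((k m)%:C * z)) *m toC (F m i).
Proof.
move=> /andP[m0 mM]; have hm : (0 < m <= M)%N by rewrite m0 ltnW.
rewrite hu ?m0 // -[toC _]/(map_mx (real_complex R) _) map_mx_sum.
under eq_bigr do rewrite -[map_mx _ _]/(toC _) step_repr //.
rewrite big_split /= -mulmx_suml fcalc_sum exchange_big /=; congr (_ + _).
by apply: eq_bigr => i _; rewrite -mulmx_suml fcalc_sum.
Qed.

(** Discrete variation of constants; functions of A compose by multiplying the scalar functions, so
    each summand is again one function of A. *)
Lemma fcalc_unroll (rr : nat -> R[i] -> R[i]) (ss : nat -> 'I_q.+1 -> R[i] -> R[i])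
  (x : nat -> 'cV[R[i]]_n) (y : nat -> 'I_q.+1 -> 'cV[R[i]]_n) m :
  x 1%N = 0 ->
  (forall p, (0 < p < M)%N -> x p.+1 = fc (rr p) *m x p + \sum_i fc (ss p i) *m y p i) ->
  (0 < m <= M)%N ->
  x m = \sum_(1 <= l < m) \sum_i
    fc (fun z => (\prod_(l.+1 <= p < m) rr p z) * ss l i z) *m y l i.
Proof.
move=> x1 xS; elim: m => // m ih /andP[_ mM]; case: (posnP m) => [->|m0].
  by rewrite x1 big_geq.
rewrite xS ?m0 // ih ?m0 ?(ltnW mM) // [RHS]big_nat_recr //= mulmx_sumr; congr (_ + _).
  apply: eq_big_nat => l /andP[l0 lm]; rewrite mulmx_sumr; apply: eq_bigr => i _.
  rewrite mulmxA fcalcM //; congr (_ *m _); apply: eq_fcalc => b.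
  by rewrite [in RHS]big_nat_recr //=; ring.
apply: eq_bigr => i _; congr (_ *m _); apply: eq_fcalc => b.
by rewrite big_geq ?mul1r.
Qed.

Lemma prev_repr m : (0 < m <= M)%N ->
  toC (u m) = \sum_(1 <= l < m) \sum_i
    fc (fun z => (\prod_(l.+1 <= p < m) dgstab (@ord0 q) ((k p)%:C * z)) *
                 dgstab i ((k l)%:C * z)) *m toC (F l i).
Proof.
move=> hm; apply: (@fcalc_unroll (fun p z => dgstab (@ord0 q) ((k p)%:C * z))
  (fun p i z => dgstab i ((k p)%:C * z)) (fun p => toC (u p)) (fun l i => toC (F l i))) => //.
  by rewrite hu1 -[toC _]/(map_mx (real_complex R) _) map_mx0.
exact: stab_repr.
Qed.

Local Notation nsum l := (\sum_i Nr (F l i)).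
Let Kp := (1 + 2 * kap) / c.

Lemma nonlocal_bound g Cg m : 0 <= Cg -> (0 < m <= M)%N ->
  (forall lam, 0 < lam -> divdiff delta lam (fun z => z * g z)) ->
  (forall z, sect delta z -> cmod (g z) <= Cg / (1 + cmod z)) ->
  N (fc (fun z => z * g ((k m)%:C * z)) *m toC (u m)) <=
  (Cg * Cr * Kp) * \sum_(1 <= l < m) (Mh * nsum l / len l m).
Proof.
move=> Cg0 hm dg bg; rewrite prev_repr // mulmx_sumr mulr_sumr.
apply: le_trans (norm_sum normN _ _ _) _; rewrite big_nat_cond [leRHS]big_nat_cond.
apply: ler_sum => l /andP[/andP[l0 lm] _]; rewrite mulmx_sumr.
apply: le_trans (norm_sum normN _ _ _) _; rewrite !mulr_sumr mulr_suml mulr_sumr.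
apply: ler_sum => i _; rewrite mulmxA fcalcM //.
by apply: (propag_bound (g := g)) => //; [rewrite l0 | case/andP: hm].
Qed.

Let nqW : 0 <= nq * (CQ * CW).
Proof. by apply: mulr_ge0; [exact: ler0n | exact: mulr_ge0]. Qed.

Definition Cstep : R := (CQ + nq * (CQ * CW)) * Cr * Kp + (Cloc + (CL + CS)).

(** The term l = m of the history sum has length k_m, so the contributions of the past and of the
    current interval fit into a single sum. *)
Lemma combine_bound (a b : R) m : (0 < m <= M)%N -> 0 <= a <= (CQ + nq * (CQ * CW)) * Cr * Kp ->
  0 <= b <= Cloc + (CL + CS) ->
  a * (\sum_(1 <= l < m) (Mh * nsum l / len l m)) + b * ((k m)^-1 * (Mh * nsum m)) <=
  Cstep * \sum_(1 <= l < m.+1) (Mh * nsum l / len l m).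
Proof.
move=> /andP[m0 mM] /andP[a0 ha] /andP[b0 hb].
have E l : (0 < l)%N -> (l <= m)%N -> 0 <= Mh * nsum l / len l m.
  move=> l0 lm; rewrite mulr_sumr divr_ge0 //; first by rewrite sumr_ge0.
  by apply/ltW/len_gt0 => //; rewrite lm.
rewrite big_nat_recr //= big_nat1 /Cstep [(k m)^-1 * _]mulrC mulrDl mulrDr -addrA.
set S := \sum_(_ <= _ < _) _; set L := Mh * _ / _.
have S0 : 0 <= S by rewrite /S big_nat_cond sumr_ge0 // => l /andP[/andP[l0 lm] _]; apply: E => //; exact: ltnW.
have L0 : 0 <= L by have := E m m0 (leqnn m); rewrite big_nat1.
have := ler_wpM2r S0 ha; have := ler_wpM2r L0 hb.
have a1 := le_trans a0 ha; have b1 := le_trans b0 hb.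
have := mulr_ge0 a1 L0; have := mulr_ge0 b1 S0; rewrite mulrDr; lra.
Qed.

Lemma laplace_bound m j : (0 < m <= M)%N ->
  Nr (A *m X m j) <= Cstep * \sum_(1 <= l < m.+1) (Mh * nsum l / len l m).
Proof.
move=> hm; have km0 := k0 hm.
have Kp0 : 0 <= Kp by rewrite divr_ge0 ?(ltW c0) // addr_ge0 // mulr_ge0 // ltW.
have C10 : 0 <= CQ * Cr * Kp by exact: (mulr_ge0 (mulr_ge0 CQ0 Cr0) Kp0).
have C20 : 0 <= nq * (CQ * CW) * Cr * Kp by exact: (mulr_ge0 (mulr_ge0 nqW Cr0) Kp0).
have -> : toC (A *m X m j) = fc (fun z => z * Q ((k m)%:C * z) j ord0) *m toC (u m) +
    \sum_i fc (fun z => z * Q ((k m)%:C * z) j i) *m toC (F m i).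
  rewrite -[toC _]/(map_mx (real_complex R) _) map_mxM -[map_mx _ A]/(toCM A) hA.
  rewrite -[map_mx _ _]/(toC _) step_repr // mulmxDr mulmxA fcalcM // mulmx_sumr; congr (_ + _).
  by apply: eq_bigr => i _; rewrite mulmxA fcalcM.
apply: le_trans (normD normN _ _) _.
apply: le_trans (combine_bound (a := CQ * Cr * Kp) (b := Cloc) hm _ _); last first.
- by rewrite Cloc_ge0 lerDl addr_ge0.
- by rewrite C10 /= !mulrDl lerDl.
apply: lerD.
  apply: (nonlocal_bound (g := fun z => Q z j ord0)) => // [lam l0|z zs].
    exact: divdiff_dginv_scaled.
  exact: hQ.
apply: le_trans (norm_sum normN _ _ _) _; rewrite !mulr_sumr; apply: ler_sum => i _.
exact: local_scaled_bound.
Qed.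

(** Column 0 of S is e_0, that is, constants are reproduced; hence Q e_0 - e_0 = - z Q W e_0. An
    increment thus gains a factor z and can be treated like A u. *)
Lemma increment_bound m j : (0 < m <= M)%N ->
  (k m)^-1 * Nr (X m j - (j == ord0)%:R *: u m) <=
  Cstep * \sum_(1 <= l < m.+1) (Mh * nsum l / len l m).
Proof.
move=> hm; have km0 := k0 hm.
have kn : (k m)%:C != 0 :> R[i] by rewrite eq_complex /= eqxx andbT gt_eqF.
have Kp0 : 0 <= Kp by rewrite divr_ge0 ?(ltW c0) // addr_ge0 // mulr_ge0 // ltW.
have C10 : 0 <= CQ * Cr * Kp by exact: (mulr_ge0 (mulr_ge0 CQ0 Cr0) Kp0).
have C20 : 0 <= nq * (CQ * CW) * Cr * Kp by exact: (mulr_ge0 (mulr_ge0 nqW Cr0) Kp0).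
pose g z := \sum_b - Wmx b ord0 * Q z j b.
have gE z : sect delta z -> Q z j ord0 - (j == ord0)%:R = z * g z.
  move=> zs; have := dginvVl q delta0 zs => /matrixP/(_ j ord0).
  rewrite [RHS]mxE [LHS]mxE => <-; rewrite /g mulr_sumr.
  have -> : Q z j ord0 = \sum_b Q z j b * Smx b ord0.
    rewrite (bigD1 ord0) //= big1 ?addr0 => [|b b0].
      by rewrite !mxE /= mul0r add0r mulr1.
    by rewrite !mxE /= -val_eqE /= in b0 *; rewrite (negbTE b0) mul0r add0r mulr0.
  rewrite -sumrB; apply: eq_bigr => b _.
  have -> : dgmx q z b ord0 = Smx b ord0 + z * Wmx b ord0.
    by rewrite /dgmx mxE; congr (_ + _); rewrite mxE.
  ring.
have -> : (k m)^-1 * Nr (X m j - (j == ord0)%:R *: u m) =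
  N (fc (fun z => z * g ((k m)%:C * z)) *m toC (u m) +
    \sum_i (k m)^-1%:C *: (fc (fun z => Q ((k m)%:C * z) j i) *m toC (F m i))).
  have kN : (k m)^-1 = cmod (k m)^-1%:C by rewrite cmod_real gtr0_norm ?invr_gt0.
  rewrite [X in X * _ = _]kN -(normZ normN); congr (N _).
  rewrite -scaleN1r scalerA toCD toCZ step_repr // addrAC scalerDr scaler_sumr; congr (_ + _).
  have -> : (-1 * (j == ord0)%:R : R)%:C = - (j == ord0)%:R :> R[i].
    by rewrite mulN1r rmorphN rmorph_nat.
  rewrite scaleNr -[_%:R *: _]mul_scalar_mx -(fcalc_cst d uP) -mulmxBl fcalcB scalemxAl fcalcZ.
  congr (_ *m _); apply: eq_fcalc => a.
  rewrite gE; last by rewrite -rmorphM; apply: sect_real => //; rewrite mulr_gt0.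
  by rewrite fmorphV; field.
apply: le_trans (normD normN _ _) _.
apply: le_trans (combine_bound (a := nq * (CQ * CW) * Cr * Kp) (b := CL + CS) hm _ _); last first.
- by rewrite addr_ge0 //= lerDr Cloc_ge0.
- by rewrite C20 /= !mulrDl lerDr.
apply: lerD.
  apply: nonlocal_bound => //.
    move=> lam l0; apply: (@divdiff_ext _ _ _ (fun z => \sum_b - Wmx b ord0 * (z * Q z j b))).
    + by rewrite /g mulr_sumr; apply: eq_bigr => b _; ring.
    + by move=> z _; rewrite /g mulr_sumr; apply: eq_bigr => b _; ring.
    by apply: divdiff_sum => b; apply: divdiffZ; exact: divdiff_dginv_scaled.
  move=> z zs; apply: le_trans (cmod_sum _ _ _) _.
  apply: (@le_trans _ _ (\sum_(b < q.+1) CQ * CW / (1 + cmod z))).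
    apply: ler_sum => b _; rewrite cmodM cmodN mulrC mulrAC.
    by apply: ler_pM; rewrite ?cmod_ge0 //; [exact: hQ | case: (hW b ord0)].
  by rewrite sumr_const card_ord -[X in X <= _]mulr_natl mulrA.
apply: le_trans (norm_sum normN _ _ _) _; rewrite !mulr_sumr; apply: ler_sum => i _.
rewrite (normZ normN) cmod_real gtr0_norm ?invr_gt0 // mulrCA.
by rewrite ler_wpM2l ?invr_ge0 ?(ltW km0) //; exact: local_bound.
Qed.

End StepBounds.

(** The order of quantifiers matters: C comes from q, cos theta and kap before the space, the norm
    and the partition are given. *)
Theorem dg_step_bounds (R : realType) (q : nat) (theta kap : R) :
  0 < theta < pi / 2 -> 0 < kap ->
  exists2 C : R, 0 <= C &
  forall n (P : 'M[R[i]]_n) (d : 'I_n -> R) (N : 'cV[R[i]]_n -> R) (gamma Mh : R)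
    (D A : 'M[R]_n) (M : nat) (k : nat -> R)
    (X F : nat -> 'I_q.+1 -> 'cV[R]_n) (u : nat -> 'cV[R]_n),
  P \in unitmx -> (forall i, 0 < d i) -> is_norm N -> 0 < gamma < pi / 2 ->
  toCM D = - fcalc P d id -> resolvent_estimate N D gamma Mh -> gamma < theta ->
  (forall m, (0 < m <= M)%N -> 0 < k m) ->
  (forall m, (0 < m < M)%N -> k m <= kap * k m.+1 /\ k m.+1 <= kap * k m) ->
  toCM A = fcalc P d id ->
  (forall m (i : 'I_q.+1), (0 < m <= M)%N ->
    \sum_j stf R q i j *: X m j + k m *: \sum_j hilb R q.+1 i j *: (A *m X m j) =
    (i == 0%N :> nat)%:R *: u m + F m i) ->
  u 1%N = 0 -> (forall m, (0 < m < M)%N -> u m.+1 = \sum_j X m j) ->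
  forall m j, (0 < m <= M)%N ->
  let S := \sum_(1 <= l < m.+1)
             (Mh * (\sum_i N (toC (F l i))) / (\sum_(l <= p < m.+1) k p)) in
  N (toC (A *m X m j)) <= C * S /\
  (k m)^-1 * N (toC (X m j - (j == ord0)%:R *: u m)) <= C * S.
Proof.
move=> theta_bd kap0.
have delta0 : 0 < cos theta by exact: cos_theta_gt0.
have [CQ CQ0 hQ] := dginv_decay q delta0.
have [Cr Cr0 hr] := dgstab_decay q delta0.
have [c' c'0 hc'] := dgstab_contractive q delta0.
have [CL CL0 hL] := dgloc_bound q delta0.
have [S1 S10 hS1] := mxbd_ex (toCM (stf R q)).
have [S2 S20 hS2] := mxbd_ex (invmx (toCM (stf R q))).
have [W1 W10 hW1] := mxbd_ex (toCM (hilb R q.+1)).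
have [W2 W20 hW2] := mxbd_ex (invmx (toCM (hilb R q.+1))).
(* A smaller c keeps the contraction estimate, and c <= 1 is what the comparison of denominators
   needs. *)
pose c := Num.min c' 1.
have c0 : 0 < c by rewrite lt_min c'0 ltr01.
have c1 : c <= 1 by rewrite ge_min lexx orbT.
have hc z : sect (cos theta) z -> cmod (dgstab (@ord0 q) z) * (1 + c * cmod z) <= 1.
  move=> zs; apply: le_trans (hc' z zs); rewrite ler_wpM2l ?cmod_ge0 //.
  by rewrite lerD2l ler_wpM2r ?cmod_ge0 // ge_min lexx.
have hS i j : cmod (toCM (stf R q) i j) <= S1 + S2 /\ cmod (invmx (toCM (stf R q)) i j) <= S1 + S2.
  by split; [apply: le_trans (hS1 i j) _; rewrite lerDl | apply: le_trans (hS2 i j) _; rewrite lerDr].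
have hW i j : cmod (toCM (hilb R q.+1) i j) <= W1 + W2 /\
    cmod (invmx (toCM (hilb R q.+1)) i j) <= W1 + W2.
  by split; [apply: le_trans (hW1 i j) _; rewrite lerDl | apply: le_trans (hW2 i j) _; rewrite lerDr].
have S0 : 0 <= S1 + S2 by rewrite addr_ge0.
have W0 : 0 <= W1 + W2 by rewrite addr_ge0.
exists (Cstep q CQ Cr CL (S1 + S2) (W1 + W2) c kap).
  have n0 : 0 <= q.+1%:R :> R by exact: ler0n.
  rewrite /Cstep /Cloc; apply: addr_ge0; last first.
    by rewrite !addr_ge0 // mulr_ge0 // mulr_ge0 // addr_ge0 // mulr_ge0 // mulr_ge0 // addr_ge0.
  apply: mulr_ge0; last by rewrite divr_ge0 ?(ltW c0) // addr_ge0 // mulr_ge0 // ltW.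
  by rewrite mulr_ge0 // addr_ge0 // mulr_ge0 // mulr_ge0.
move=> n P d N gamma Mh D A M k X F u uP d0 normN gbd hD res gt k0 kk hA hE u1 hu m j hm S.
split.
  exact: (laplace_bound uP d0 normN gbd hD res theta_bd gt CQ0 Cr0 CL0 S0 W0 c0 c1
     hQ hr hc hL hS hW kap0 k0 kk hA hE u1 hu).
exact: (increment_bound uP d0 normN gbd hD res theta_bd gt CQ0 Cr0 CL0 S0 W0 c0 c1
     hQ hr hc hL hS hW kap0 k0 kk hA hE u1 hu).
Qed.

(** * Summation over the time steps *)

Section SchurBound.
Variable R : realType.

(* Young's inequality for the conjugate exponents r and r / (r - 1). *)
Lemma powR_tangent (r x y : R) : 1 <= r -> 0 <= x -> 0 <= y ->
  y `^ r + r * y `^ (r - 1) * (x - y) <= x `^ r.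
Proof.
move=> r1 x0 y0; have r0 : 0 < r by exact: lt_le_trans r1.
(* For r = 1 the conjugate exponent would be infinite, and the inequality is an equality. *)
have [->|rn] := eqVneq r 1; first by rewrite subrr powRr0 !powRr1 //; lra.
have r1' : 0 < r - 1 by rewrite subr_gt0 lt_neqAle eq_sym rn.
have hq : r^-1 + (r / (r - 1))^-1 = 1 by field; rewrite !gt_eqF.
have q0 : 0 < r / (r - 1) by rewrite divr_gt0.
have := conjugate_powR x0 (powR_ge0 y (r - 1)) r0 q0 hq.
have -> : (y `^ (r - 1)) `^ (r / (r - 1)) = y `^ r.
  by rewrite -powRrM; congr (_ `^ _); field; rewrite gt_eqF.
have e := mulr_powRB1 y0 r0.
move=> h; have := ler_wpM2l (ltW r0) h.
have -> : r * (x `^ r / r + y `^ r / (r / (r - 1))) = x `^ r + (r - 1) * y `^ r.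
  by field; rewrite !gt_eqF.
rewrite -e; move: (y `^ (r - 1)) (x `^ r) => Y X h2; lra.
Qed.

(** Jensen's inequality with total weight W <= L, by the tangent at S / L. The missing weight does
    no harm: it only leaves the nonnegative term (L - W) (r - 1) y^r. *)
Lemma powR_weighted_sum (I : eqType) (s : seq I) (w x : I -> R) (L r : R) :
  1 <= r -> 0 < L -> (forall l, l \in s -> 0 <= w l) -> (forall l, l \in s -> 0 <= x l) ->
  \sum_(l <- s) w l <= L ->
  L * ((\sum_(l <- s) w l * x l) / L) `^ r <= \sum_(l <- s) w l * x l `^ r.
Proof.
move=> r1 L0 w0 x0 wL; set S := \sum_(l <- s) w l * x l.
have S0 : 0 <= S by rewrite /S big_seq sumr_ge0 // => l ls; rewrite mulr_ge0 ?w0 ?x0.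
set y := S / L; have y0 : 0 <= y by rewrite divr_ge0 // ltW.
have W0 : 0 <= \sum_(l <- s) w l by rewrite big_seq sumr_ge0.
apply: (@le_trans _ _ (\sum_(l <- s) w l * (y `^ r + r * y `^ (r - 1) * (x l - y)))); last first.
  rewrite big_seq [leRHS]big_seq; apply: ler_sum => l ls.
  by apply: ler_wpM2l; [exact: w0 | apply: powR_tangent => //; exact: x0].
have -> : \sum_(l <- s) w l * (y `^ r + r * y `^ (r - 1) * (x l - y)) =
  (\sum_(l <- s) w l) * (y `^ r - r * y `^ (r - 1) * y) + r * y `^ (r - 1) * S.
  rewrite mulr_suml /S mulr_sumr -big_split /=; apply: eq_bigr => l _; ring.
have e := mulr_powRB1 y0 (lt_le_trans ltr01 r1).
have SE : S = y * L by rewrite /y mulfVK // gt_eqF.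
rewrite SE; have := powR_ge0 y r; move: e wL W0 r1; move: (\sum_(_ <- _) _) (y `^ (r - 1)) => W Y.
move=> <- wL W0 r1 P0; have := mulr_ge0 (mulr_ge0 P0 (_ : 0 <= L - W)) (_ : 0 <= r - 1).
by rewrite !subr_ge0 => /(_ wL r1); nra.
Qed.

(** Row sums enter through Jensen's inequality for fixed m, column sums after the order of summation
    is exchanged. *)
Lemma schur_bound (I : eqType) (s : seq I) (k x : I -> R) (w : I -> I -> R) (L r : R) :
  1 <= r -> 0 < L -> (forall l m, l \in s -> m \in s -> 0 <= w l m) ->
  (forall l, l \in s -> 0 <= x l) -> (forall m, m \in s -> 0 <= k m) ->
  (forall m, m \in s -> \sum_(l <- s) w l m <= L) ->
  (forall l, l \in s -> \sum_(m <- s) k m * w l m <= L * k l) ->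
  \sum_(m <- s) k m * ((\sum_(l <- s) w l m * x l) / L) `^ r <= \sum_(l <- s) k l * x l `^ r.
Proof.
move=> r1 L0 w0 x0 k0 row col; rewrite -(ler_pM2l L0) mulr_sumr.
apply: (@le_trans _ _ (\sum_(m <- s) k m * \sum_(l <- s) w l m * x l `^ r)).
  rewrite big_seq [leRHS]big_seq; apply: ler_sum => m ms; rewrite mulrCA.
  apply: ler_wpM2l; first exact: k0.
  by apply: powR_weighted_sum => // [l ls|]; [exact: w0 | exact: row].
under eq_bigr do rewrite mulr_sumr.
rewrite exchange_big /= mulr_sumr big_seq [leRHS]big_seq; apply: ler_sum => l ls.
under eq_bigr do rewrite mulrA.
by rewrite -mulr_suml mulrA ler_wpM2r ?powR_ge0 // col.
Qed.

Lemma ln_ratio_ge (a b : R) : 0 < a -> 0 < b -> (b - a) / b <= ln b - ln a.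
Proof.
move=> a0 b0; rewrite -ln_div ?posrE // -lerN2 -lnV ?posrE ?divr_gt0 // invf_div.
have -> : a / b = 1 + - ((b - a) / b) by field; rewrite gt_eqF.
apply: le_ln1Dx; rewrite ltrN2 ltr_pdivrMr // mul1r; lra.
Qed.

Variables (t : nat -> R) (M : nat).
Hypothesis t_incr : forall i j, (i < j <= M)%N -> t i < t j.

(** For l < m the l-th term is at most ln (t_m - t_(l-1)) - ln (t_m - t_l), which telescopes; the
    term l = m is 1. *)
Lemma row_log_sum m : (0 < m <= M)%N ->
  \sum_(1 <= l < m.+1) (t l - t l.-1) / (t m - t l.-1) <=
  1 + (ln (t m - t 0%N) - ln (t m - t m.-1)).
Proof.
move=> /andP[m0 mM]; have key j : (j < m)%N ->
    \sum_(1 <= l < j.+1) (t l - t l.-1) / (t m - t l.-1) <= ln (t m - t 0%N) - ln (t m - t j).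
  elim: j => [|j ih] jm; first by rewrite big_geq // subrr.
  rewrite big_nat_recr //=; have h1 := ih (ltnW jm).
  have := @ln_ratio_ge (t m - t j.+1) (t m - t j); rewrite !subr_gt0.
  rewrite !t_incr ?jm ?(ltnW jm) ?mM // => /(_ isT isT).
  rewrite (_ : t m - t j - (t m - t j.+1) = t j.+1 - t j); last by ring.
  move: h1; move: (\sum_(_ <= _ < _) _) (_ / _) => A B; lra.
case: m m0 mM key => // m _ mM key; rewrite big_nat_recr //= divff; last first.
  by rewrite gt_eqF // subr_gt0 t_incr // ltnSn mM.
by rewrite addrC lerD2l key.
Qed.

(** Here the first term, m = l, is 1, and the later ones are bounded by increments of ln (t_m -
    t_(l-1)). *)
Lemma column_log_sum l : (0 < l <= M)%N ->
  \sum_(l <= m < M.+1) (t m - t m.-1) / (t m - t l.-1) <=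
  1 + (ln (t M - t l.-1) - ln (t l - t l.-1)).
Proof.
move=> /andP[l0 lM]; have ll : (l.-1 < l)%N by rewrite prednK.
have key j : (l + j <= M)%N -> \sum_(l <= m < (l + j).+1) (t m - t m.-1) / (t m - t l.-1) <=
    1 + (ln (t (l + j)%N - t l.-1) - ln (t l - t l.-1)).
  elim: j => [|j ih].
    rewrite addn0 big_nat1 subrr addr0 divff // gt_eqF // subr_gt0 t_incr // ll.
    by rewrite lM.
  rewrite addnS => jM; rewrite big_nat_recr ?leqW ?leq_addr //=; have h1 := ih (ltnW jM).
  have := @ln_ratio_ge (t (l + j)%N - t l.-1) (t (l + j).+1 - t l.-1); rewrite !subr_gt0.
  rewrite !t_incr ?(ltnW jM) ?jM ?andbT //; first last.
  - by rewrite (leq_trans ll) // leq_addr.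
  - by rewrite (leq_trans ll) // leqW // leq_addr.
  move=> /(_ isT isT).
  rewrite (_ : t (l + j).+1 - t l.-1 - (t (l + j)%N - t l.-1) = t (l + j).+1 - t (l + j)%N); last by ring.
  move: h1; move: (\sum_(_ <= _ < _) _) (_ / _) => A B; lra.
by have := key (M - l)%N; rewrite subnKC // => /(_ (leqnn _)).
Qed.

End SchurBound.

Section TimeSums.
Variable R : realType.
Local Notation mu := (@lebesgue_measure R).

(** The tangent of x^r at the mean value is integrated; [scaled a b 0] serves as the constant
    function 1. *)
Lemma jensen_powR (a b r : R) (g : R -> R) : a < b -> 1 <= r ->
  mu.-integrable `]a, b]%classic (EFin \o g) ->
  mu.-integrable `]a, b]%classic (EFin \o (fun t => g t `^ r)) ->
  (forall t, 0 <= g t) ->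
  (b - a) * ((b - a)^-1 * Rintegral mu `]a, b]%classic g) `^ r <=
  Rintegral mu `]a, b]%classic (fun t => g t `^ r).
Proof.
move=> ab r1 ig igr g0; have d0 : 0 < b - a by rewrite subr_gt0.
set S := Rintegral mu _ g; set y := (b - a)^-1 * S.
have S0 : 0 <= S by apply: Rintegral_ge0.
have y0 : 0 <= y by rewrite mulr_ge0 // invr_ge0 ltW.
pose c (i : bool) := if i then y `^ r - r * y `^ (r - 1) * y else r * y `^ (r - 1).
pose h (i : bool) := if i then scaled a b 0 else g.
have ih i : mu.-integrable `]a, b]%classic (EFin \o h i).
  by case: i => //; exact: scaled_integrable.
have mab : @measurable _ (g_sigma_algebraType (R.-ocitv.-measurable)) `]a, b]%classic.
  exact: measurable_itv.
have -> : (b - a) * y `^ r = Rintegral mu `]a, b]%classic (fun t => \sum_i c i * h i t).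
  rewrite Rintegral_comb // big_bool /= scaled_Rintegral // -/S.
  have -> : S = y * (b - a) by rewrite /y mulrC mulVKf // gt_eqF.
  by rewrite divr1; ring.
apply: le_Rintegral => //; first exact: integrable_comb.
move=> t _; rewrite big_bool /= /scaled expr0 mulr1.
have := powR_tangent r1 (g0 t) y0; lra.
Qed.

Variables (M : nat) (tt : nat -> R) (T : R).
Hypothesis ttP : time_partition T M tt.
Local Notation k := (kstep tt).

Lemma sum_Rintegral_Im (h : R -> R) : mu.-integrable `]0, T]%classic (EFin \o h) ->
  \sum_(1 <= m < M.+1) Rintegral mu (Im_ tt m) h = Rintegral mu `]0, T]%classic h.
Proof.
move=> ih; have [t0 tM _] := ttP.
have key j : (j <= M)%N ->
    \sum_(1 <= m < j.+1) Rintegral mu (Im_ tt m) h = Rintegral mu `]0, tt j]%classic h.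
  elim: j => [_|j ihj jM]; first by rewrite big_geq // t0 set_itv_ge ?bnd_simp ?ltxx // Rintegral_set0.
  rewrite big_nat_recr //= ihj ?(ltnW jM) // /Im_ /=.
  rewrite -(@Rintegral_itvB _ h (BRight 0) (BRight (tt j.+1)) (tt j)).
  - by rewrite addrC subrK.
  - apply: integrableS ih; [exact: measurable_itv|exact: measurable_itv|].
    move=> t /=; rewrite !in_itv /= => /andP[-> h2] /=; apply: le_trans h2 _.
    by rewrite -tM; apply: (tt_le ttP); rewrite jM leqnn.
  - by rewrite bnd_simp -t0; apply: (tt_le ttP); rewrite leq0n (ltnW jM).
  - by rewrite bnd_simp; apply: (tt_le ttP); rewrite leqnSn jM.
by rewrite key // tM.
Qed.

Definition avg (g : R -> R) m : R := (k m)^-1 * Rintegral mu (Im_ tt m) g.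

Lemma avg_sum_powR (g : R -> R) r : 1 <= r -> (forall t, 0 <= g t) ->
  mu.-integrable `]0, T]%classic (EFin \o g) ->
  mu.-integrable `]0, T]%classic (EFin \o (fun t => g t `^ r)) ->
  \sum_(1 <= m < M.+1) k m * avg g m `^ r <= Rintegral mu `]0, T]%classic (fun t => g t `^ r).
Proof.
move=> r1 g0 ig igr; rewrite -sum_Rintegral_Im // big_nat_cond [leRHS]big_nat_cond.
apply: ler_sum => m /andP[hm _].
have sub h : mu.-integrable `]0, T]%classic (EFin \o h) ->
    mu.-integrable `]tt m.-1, tt m]%classic (EFin \o h).
  move=> ih; apply: integrableS ih; [exact: measurable_itv|exact: measurable_itv|].
  exact: (Im_sub ttP hm).
apply: jensen_powR => //; [|exact: sub|exact: sub].
by rewrite -subr_gt0; exact: (kstep_gt0 ttP hm).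
Qed.

Lemma avg_le (g : R -> R) G m : (0 < m <= M)%N -> (forall t, 0 <= g t) -> 0 <= G ->
  mu.-integrable `]0, T]%classic (EFin \o g) ->
  {ae mu, forall t, `]0, T]%classic t -> g t <= G} ->
  avg g m <= G.
Proof.
move=> hm g0 G0 ig gG; have k0 := kstep_gt0 ttP hm.
rewrite /avg mulrC ler_pdivrMr //.
have ab : tt m.-1 < tt m by rewrite -subr_gt0.
have cE : cst G = (fun t => G * scaled (tt m.-1) (tt m) 0 t).
  by apply/funext => t; rewrite /scaled expr0 mulr1.
have -> : G * k m = Rintegral mu (Im_ tt m) (cst G).
  rewrite cE RintegralZl; [|exact: measurable_Im|exact: scaled_integrable].
  by rewrite scaled_Rintegral // divr1.
have ic : mu.-integrable (Im_ tt m) (EFin \o cst G).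
  rewrite cE (_ : _ \o _ = (fun t => G%:E * (scaled (tt m.-1) (tt m) 0 t)%:E)%E) //.
  exact: (integrableZl (measurable_Im tt m) G (scaled_integrable _ _ _ _ _)).
have ig' : mu.-integrable (Im_ tt m) (EFin \o g).
  apply: integrableS ig; [exact: measurable_itv|exact: measurable_itv|exact: (Im_sub ttP hm)].
rewrite /Rintegral fine_le ?integrable_fin_num //; try exact: measurable_Im.
apply: ae_ge0_le_integral; first exact: measurable_Im.
- by move=> t _; rewrite lee_fin.
- by case/integrableP: ig'.
- by move=> t _; rewrite lee_fin.
- by case/integrableP: ic.
have [Z [mZ Z0 sub]] := gG; exists Z; split=> // t ht; apply: sub => h; apply: ht => It.
by rewrite lee_fin; apply: h; exact: (Im_sub ttP hm).
Qed.

(** The factor k_l turns integrals over I_l into means; with it, both the row sums and the columns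
    weighted by k_m become logarithmic sums. *)
Definition wt l m : R := if (l <= m)%N then k l / (tt m - tt l.-1) else 0.

Lemma wt_sum_row m (x : nat -> R) : (0 < m <= M)%N ->
  \sum_(1 <= l < M.+1) wt l m * x l =
  \sum_(1 <= l < m.+1) k l / (tt m - tt l.-1) * x l.
Proof.
move=> /andP[m0 mM]; rewrite [RHS](big_nat_widen _ _ M.+1) ?ltnS // [RHS]big_mkcond.
by apply: eq_bigr => l _; rewrite /wt /= ltnS; case: ifP; rewrite ?mul0r.
Qed.

Lemma wt_sum_column l (y : nat -> R) : (0 < l <= M)%N ->
  \sum_(1 <= m < M.+1) y m * wt l m =
  \sum_(l <= m < M.+1) y m * (k l / (tt m - tt l.-1)).
Proof.
move=> /andP[l0 lM]; rewrite [RHS](big_nat_widenl _ 1) // [RHS]big_mkcond.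
by apply: eq_bigr => m _; rewrite /wt /=; case: ifP; rewrite ?mulr0.
Qed.

Variables (c beta : R).
Hypotheses (c0 : 0 < c) (beta0 : 0 < beta) (T0 : 0 < T) (M0 : (0 < M)%N).
Hypothesis kmin_ge : c * kmax M tt `^ beta <= kmin M tt.
Hypothesis kmax_le : kmax M tt <= T / 4.

Lemma kstep_le_kmax m : (0 < m <= M)%N -> k m <= kmax M tt.
Proof. by move=> hm; apply: le_bigmax_seq; rewrite // mem_index_iota. Qed.

Lemma kmin_le_kstep m : (0 < m <= M)%N -> kmin M tt <= k m.
Proof. by move=> hm; apply: ge_bigmin_seq; rewrite // mem_index_iota. Qed.

Lemma kmax_gt0 : 0 < kmax M tt.
Proof.
have h : (0 < 1 <= M)%N by rewrite M0.
by apply: lt_le_trans (kstep_le_kmax h); exact: (kstep_gt0 ttP).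
Qed.

Lemma kmin_gt0 : 0 < kmin M tt.
Proof. by apply: lt_le_trans kmin_ge; rewrite mulr_gt0 // powR_gt0 // kmax_gt0. Qed.

Definition Llog : R := 1 + (ln T - ln (kmin M tt)).
(** With b, d, e standing for beta, c, T: logarithms of c k^beta <= k_min bound - ln k_min by - ln c
    - beta ln k, and the additive constants are absorbed since k <= T / 4 gives ln (T / k) >= ln
    4. *)
Definition Clog (b d e : R) : R := b + (1 + `|(1 - b) * ln e - ln d|) / ln 4.

Lemma Llog_le : Llog <= Clog beta c T * ln (T / kmax M tt).
Proof.
have K0 := kmax_gt0; have k0 := kmin_gt0.
have l4 : 0 < ln 4 :> R by rewrite ln_gt0 // ltr1n.
have h4 : ln 4 <= ln (T / kmax M tt).
  by rewrite ler_ln ?posrE ?divr_gt0 // ler_pdivlMr // mulrC -ler_pdivlMr.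
have h : ln c + beta * ln (kmax M tt) <= ln (kmin M tt).
  rewrite -ln_powR -lnM ?posrE ?powR_gt0 // ler_ln ?posrE //.
  by rewrite mulr_gt0 // powR_gt0.
rewrite /Llog /Clog mulrDl; move: h4; rewrite ln_div ?posrE // => h4.
set E := `|_|; have hE : (1 - beta) * ln T - ln c <= E by exact: ler_norm.
have E0 : 0 <= E by exact: normr_ge0.
apply: (@le_trans _ _ (beta * (ln T - ln (kmax M tt)) + (1 + E))); first by lra.
rewrite lerD2l mulrAC ler_pdivlMr // ler_wpM2l // addr_ge0 //.
Qed.

Lemma Llog_gt0 : 0 < Llog.
Proof.
have h : (0 < 1 <= M)%N by rewrite M0.
rewrite /Llog ltr_pwDl // subr_ge0 ler_ln ?posrE ?kmin_gt0 //.
apply: le_trans (kmin_le_kstep h) _; apply: le_trans (kstep_le_kmax h) _.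
apply: le_trans kmax_le _; rewrite ler_pdivrMr // ler_peMr ?(ltW T0) // ler1n //.
Qed.

Lemma ln_gap_le i j : (i < j <= M)%N -> ln (tt j - tt i) <= ln T.
Proof.
move=> /andP[ij jM]; have [t0 tM _] := ttP.
rewrite ler_ln ?posrE // ?subr_gt0 ?(tt_lt ttP) ?ij //.
have := tt_le ttP (_ : (j <= M <= M)%N); rewrite jM leqnn => /(_ isT).
have := tt_le ttP (_ : (0 <= i <= M)%N); rewrite leq0n (leq_trans (ltnW ij) jM) => /(_ isT).
rewrite t0 tM; lra.
Qed.

Lemma ln_kmin_le m : (0 < m <= M)%N -> ln (kmin M tt) <= ln (tt m - tt m.-1).
Proof.
move=> hm; rewrite ler_ln ?posrE ?kmin_gt0 //; first exact: kmin_le_kstep.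
exact: (kstep_gt0 ttP hm).
Qed.

Lemma wt_row m : (0 < m <= M)%N -> \sum_(1 <= l < M.+1) wt l m <= Llog.
Proof.
move=> hm; have := wt_sum_row (fun=> 1) hm.
under eq_bigr do rewrite mulr1; move=> ->; under eq_bigr do rewrite mulr1.
apply: le_trans (row_log_sum (tt_lt ttP) hm) _; rewrite lerD2l lerB //.
  by apply: ln_gap_le; case/andP: hm => -> ->.
exact: ln_kmin_le.
Qed.

Lemma wt_column l : (0 < l <= M)%N -> \sum_(1 <= m < M.+1) k m * wt l m <= Llog * k l.
Proof.
move=> hl; rewrite wt_sum_column // mulrC.
have -> : \sum_(l <= m < M.+1) k m * (k l / (tt m - tt l.-1)) =
    k l * \sum_(l <= m < M.+1) (tt m - tt m.-1) / (tt m - tt l.-1).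
  by rewrite mulr_sumr; apply: eq_bigr => m _; rewrite mulrCA.
rewrite ler_pM2l ?(kstep_gt0 ttP hl) //.
apply: le_trans (column_log_sum (tt_lt ttP) hl) _; rewrite lerD2l lerB //.
  by apply: ln_gap_le; case/andP: hl => l0 lM; rewrite prednK // lM leqnn.
exact: ln_kmin_le.
Qed.

Lemma wt_ge0 l m : (0 < l <= M)%N -> (0 < m <= M)%N -> 0 <= wt l m.
Proof.
move=> hl hm; rewrite /wt; case: ifP => // lm; rewrite divr_ge0 ?ltW ?(kstep_gt0 ttP hl) //.
rewrite subr_gt0 (tt_lt ttP) //; case/andP: hl => l0 lM; case/andP: hm => m0 mM.
by rewrite mM andbT (leq_trans _ lm) // prednK.
Qed.

Definition hist (g : R -> R) m : R :=
  \sum_(1 <= l < m.+1) Rintegral mu (Im_ tt l) g / (tt m - tt l.-1).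

Lemma histE g m : (0 < m <= M)%N -> hist g m = \sum_(1 <= l < M.+1) wt l m * avg g l.
Proof.
move=> hm; rewrite wt_sum_row // /hist; apply: eq_big_nat => l /andP[l0 lm].
have h : (0 < l <= M)%N by case/andP: hm => _ mM; rewrite l0 (leq_trans _ mM).
have := kstep_gt0 ttP h; rewrite /avg => kl.
by rewrite mulrACA mulfV ?mul1r ?gt_eqF // mulrC.
Qed.

Lemma avg_ge0 g m : (forall t, 0 <= g t) -> (0 < m <= M)%N -> 0 <= avg g m.
Proof.
move=> g0 hm; rewrite mulr_ge0 ?invr_ge0 ?(ltW (kstep_gt0 ttP hm)) //.
exact: Rintegral_ge0.
Qed.

Lemma hist_powR_sum g r : 1 <= r -> (forall t, 0 <= g t) ->
  mu.-integrable `]0, T]%classic (EFin \o g) ->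
  mu.-integrable `]0, T]%classic (EFin \o (fun t => g t `^ r)) ->
  \sum_(1 <= m < M.+1) k m * (hist g m / Llog) `^ r <=
  Rintegral mu `]0, T]%classic (fun t => g t `^ r).
Proof.
move=> r1 g0 ig igr; apply: le_trans (avg_sum_powR r1 g0 ig igr).
have -> : \sum_(1 <= m < M.+1) k m * (hist g m / Llog) `^ r =
   \sum_(1 <= m < M.+1) k m * ((\sum_(1 <= l < M.+1) wt l m * avg g l) / Llog) `^ r.
  by apply: eq_big_nat => m hm; rewrite histE.
apply: schur_bound => //; first exact: Llog_gt0.
- by move=> l m; rewrite !mem_index_iota; exact: wt_ge0.
- by move=> l; rewrite mem_index_iota; exact: avg_ge0.
- by move=> m; rewrite mem_index_iota => hm; apply/ltW/(kstep_gt0 ttP hm).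
- by move=> m; rewrite mem_index_iota; exact: wt_row.
- by move=> l; rewrite mem_index_iota; exact: wt_column.
Qed.

Lemma hist_le g G m : (0 < m <= M)%N -> (forall t, 0 <= g t) -> 0 <= G ->
  mu.-integrable `]0, T]%classic (EFin \o g) ->
  {ae mu, forall t, `]0, T]%classic t -> g t <= G} ->
  hist g m <= Llog * G.
Proof.
move=> hm g0 G0 ig gG; rewrite histE //; apply: le_trans (ler_wpM2r G0 (wt_row hm)).
rewrite mulr_suml big_nat_cond [leRHS]big_nat_cond; apply: ler_sum => l /andP[hl _].
by apply: ler_wpM2l; [exact: wt_ge0 | exact: avg_le].
Qed.

End TimeSums.

(** For a zero measure the essential supremum of a constant would be - infinity. *)
Lemma lebesgue_measure_setT_gt0 (R : realType) : (0 < @lebesgue_measure R [set: R])%E.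
Proof.
have := @lebesgue_measure_itv R `]-oo, +oo[; rewrite set_itvE => ->.
by rewrite ltNye /= lt0y.
Qed.

Section DiscreteNorms.
Variables (R : realType) (n q : nat) (N : 'cV[R[i]]_n -> R).
Hypothesis normN : is_norm N.
Variables (M : nat) (tt : nat -> R) (T : R).
Hypothesis ttP : time_partition T M tt.
Local Notation mu := (@lebesgue_measure R).
Local Notation k := (kstep tt).

Lemma measurable_norm_scaled (a b : R) (p : 'I_q.+1 -> nat) (c : 'I_q.+1 -> R)
    (v : 'I_q.+1 -> 'cV[R]_n) (D : set R) :
  measurable_fun D (fun t => N (toC (\sum_j (c j * scaled a b (p j) t) *: v j))).
Proof.
apply: (measurable_norm normN) => i.
have -> : (fun t => (\sum_j (c j * scaled a b (p j) t) *: v j) i 0) =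
    (fun t => \sum_j (c j * v j i 0) * scaled a b (p j) t).
  by apply/funext => t; rewrite summxE; apply: eq_bigr => j _; rewrite mxE; ring.
apply: measurable_sum => j; apply: measurable_funM; first exact: measurable_cst.
exact: scaled_measurable.
Qed.

Lemma powR_integral_le (a b r B : R) (h : R -> R) : a < b -> 0 < r ->
  measurable_fun `]a, b]%classic h -> (forall t, `]a, b]%classic t -> 0 <= h t <= B) ->
  Rintegral mu `]a, b]%classic (fun t => h t `^ r) <= (b - a) * B `^ r.
Proof.
move=> ab r0 mh hB; pose s t : R := B `^ r * scaled a b 0 t.
have mab : @measurable _ (g_sigma_algebraType (R.-ocitv.-measurable)) `]a, b]%classic.
  exact: measurable_itv.
have is_ : mu.-integrable `]a, b]%classic (EFin \o s).
  rewrite (_ : _ \o _ = (fun t => (B `^ r)%:E * (scaled a b 0 t)%:E)%E) //.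
  exact: (integrableZl mab (B `^ r) (scaled_integrable _ _ _ _ _)).
have le t : `]a, b]%classic t -> h t `^ r <= s t.
  move=> /hB/andP[h0 h1]; rewrite /s /scaled expr0 mulr1.
  by rewrite ge0_ler_powR ?nnegrE ?(ltW r0) // (le_trans h0).
have ih : mu.-integrable `]a, b]%classic (EFin \o (fun t => h t `^ r)).
  apply: (le_integrable mab _ _ is_).
    by apply/measurable_EFinP; exact: measurableT_comp (measurable_powR r) mh.
  move=> t Dt; rewrite /= lee_fin !ger0_norm ?powR_ge0 ?le //.
  by apply: le_trans (le _ Dt); exact: powR_ge0.
have -> : (b - a) * B `^ r = Rintegral mu `]a, b]%classic s.
  rewrite /s RintegralZl //; last exact: scaled_integrable.
  by rewrite scaled_Rintegral // divr1 mulrC.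
exact: le_Rintegral.
Qed.

Lemma Ls_time_powR (h : nat -> R -> R) (B : nat -> R) r : 0 < r ->
  (forall m, (0 < m <= M)%N -> measurable_fun (Im_ tt m) (h m)) ->
  (forall m t, (0 < m <= M)%N -> Im_ tt m t -> 0 <= h m t <= B m) ->
  Ls_time r%:E M tt h <= (\sum_(1 <= m < M.+1) k m * B m `^ r) `^ r^-1.
Proof.
move=> r0 mh hB; rewrite /Ls_time.
have le : \sum_(1 <= m < M.+1) Rintegral mu (Im_ tt m) (fun t => h m t `^ r) <=
    \sum_(1 <= m < M.+1) k m * B m `^ r.
  rewrite big_nat_cond [leRHS]big_nat_cond; apply: ler_sum => m /andP[hm _].
  apply: powR_integral_le => //; [|exact: mh|by move=> t; exact: hB].
  by rewrite -subr_gt0; exact: (kstep_gt0 ttP hm).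
have h0 : 0 <= \sum_(1 <= m < M.+1) Rintegral mu (Im_ tt m) (fun t => h m t `^ r).
  by apply: sumr_ge0 => m _; apply: Rintegral_ge0 => t _; exact: powR_ge0.
by rewrite ge0_ler_powR ?nnegrE ?invr_ge0 ?(ltW r0) // (le_trans h0).
Qed.

Lemma Ls_time_sup (h : nat -> R -> R) B : 0 <= B ->
  (forall m t, (0 < m <= M)%N -> Im_ tt m t -> h m t <= B) ->
  Ls_time +oo%E M tt h <= B.
Proof.
move=> B0 hB; rewrite /Ls_time big_nat_cond; apply: bigmax_le => // m /andP[hm _].
apply: ge_sup => [|_ [t It <-]]; last exact: hB.
exists (h m (tt m)), (tt m) => //; rewrite /Im_ /= in_itv /= lexx andbT.
by rewrite -subr_gt0; exact: (kstep_gt0 ttP hm).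
Qed.

Lemma ls_jump_powR (a B : nat -> R) r : 0 < r ->
  (forall m, (0 < m <= M)%N -> 0 <= a m <= B m) ->
  ls_jump r%:E M tt a <= (\sum_(1 <= m < M.+1) k m * B m `^ r) `^ r^-1.
Proof.
move=> r0 aB; rewrite /ls_jump.
have le : \sum_(1 <= m < M.+1) k m * a m `^ r <= \sum_(1 <= m < M.+1) k m * B m `^ r.
  rewrite big_nat_cond [leRHS]big_nat_cond; apply: ler_sum => m /andP[hm _].
  rewrite ler_wpM2l ?(ltW (kstep_gt0 ttP hm)) //; have /andP[a0 ab] := aB _ hm.
  by rewrite ge0_ler_powR ?nnegrE ?(ltW r0) // (le_trans a0).
have h0 : 0 <= \sum_(1 <= m < M.+1) k m * a m `^ r.
  rewrite big_nat_cond; apply: sumr_ge0 => m /andP[hm _].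
  by rewrite mulr_ge0 ?powR_ge0 // ltW // (kstep_gt0 ttP hm).
by rewrite ge0_ler_powR ?nnegrE ?invr_ge0 ?(ltW r0) // (le_trans h0).
Qed.

Lemma ls_jump_sup (a : nat -> R) B : 0 <= B ->
  (forall m, (0 < m <= M)%N -> a m <= B) -> ls_jump +oo%E M tt a <= B.
Proof.
by move=> B0 aB; rewrite /ls_jump big_nat_cond; apply: bigmax_le => // m /andP[hm _]; exact: aB.
Qed.

End DiscreteNorms.

Section StabilityFromHistory.
Variables (R : realType) (M : nat) (tt : nat -> R) (T c beta : R).
Hypotheses (ttP : time_partition T M tt) (c0 : 0 < c) (beta0 : 0 < beta) (T0 : 0 < T).
Hypotheses (M0 : (0 < M)%N) (kmin_ge : c * kmax M tt `^ beta <= kmin M tt).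
Hypothesis kmax_le : kmax M tt <= T / 4.
Local Notation mu := (@lebesgue_measure R).
Variables (g : R -> R) (h1 h2 : nat -> R -> R) (a : nat -> R) (C0 Mh : R).
Hypotheses (g0 : forall t, 0 <= g t) (C00 : 0 <= C0) (Mh0 : 0 < Mh).
Hypothesis ig : mu.-integrable `]0, T]%classic (EFin \o g).
Hypothesis mh1 : forall m, (0 < m <= M)%N -> measurable_fun (Im_ tt m) (h1 m).
Hypothesis mh2 : forall m, (0 < m <= M)%N -> measurable_fun (Im_ tt m) (h2 m).
Local Notation B m := (C0 * (Mh * hist tt g m)).
Hypothesis h1B : forall m t, (0 < m <= M)%N -> Im_ tt m t -> 0 <= h1 m t <= B m.
Hypothesis h2B : forall m t, (0 < m <= M)%N -> Im_ tt m t -> 0 <= h2 m t <= B m.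
Hypothesis aB : forall m, (0 < m <= M)%N -> 0 <= a m <= B m.

(** The 3 counts the three terms on the left; the 1 keeps the constant positive even if C0 = 0, so
    that an infinite right side stays infinite. *)
Definition Cfinal (C0 b d e : R) : R := 3 * C0 * Clog b d e + 1.

Let lnK0 : 0 < ln (T / kmax M tt).
Proof.
apply: ln_gt0; rewrite ltr_pdivlMr ?mul1r; last exact: (kmax_gt0 ttP M0).
by apply: le_lt_trans kmax_le _; rewrite ltr_pdivrMr // ltr_pMr // ltr1n.
Qed.

Lemma Cfinal_ge : 3 * (C0 * Mh * Llog M tt T) <= Cfinal C0 beta c T * Mh * ln (T / kmax M tt).
Proof.
have := Llog_le ttP c0 T0 M0 kmin_ge kmax_le.
move=> /(ler_wpM2l (mulr_ge0 C00 (ltW Mh0))); have := mulr_gt0 Mh0 lnK0.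
rewrite /Cfinal; move: (ln _) (Clog _ _ _) (Llog _ _ _) => l K L; nra.
Qed.

Lemma Clog_gt0 : 0 < Clog beta c T.
Proof.
have l4 : 0 < ln 4 :> R by rewrite ln_gt0 // ltr1n.
by rewrite /Clog addr_gt0 // divr_gt0 // ltr_pwDl.
Qed.

Lemma Cfinal_gt0 : 0 < Cfinal C0 beta c T.
Proof. by rewrite /Cfinal ltr_wpDl // !mulr_ge0 // ltW // Clog_gt0. Qed.

Lemma Ls_sum_le s : (1 <= s)%E ->
  ((Ls_time s M tt h1 + Ls_time s M tt h2 + ls_jump s M tt a)%:E <=
   (Cfinal C0 beta c T * Mh * ln (T / kmax M tt))%:E * Ls_I s T g)%E.
Proof.
have L0 := Llog_gt0 ttP c0 T0 M0 kmin_ge kmax_le.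
have Ck0 : 0 < Cfinal C0 beta c T * Mh * ln (T / kmax M tt).
  by rewrite !mulr_gt0 // Cfinal_gt0.
pose Kc := C0 * Mh * Llog M tt T.
have Kc0 : 0 <= Kc by rewrite !mulr_ge0 // ltW.
have BE m : B m = Kc * (hist tt g m / Llog M tt T) by rewrite /Kc; field; rewrite gt_eqF.
have hist0 m : (0 < m <= M)%N -> 0 <= hist tt g m.
  move=> hm; rewrite (histE ttP g hm) big_nat_cond sumr_ge0 // => l /andP[hl _].
  by rewrite mulr_ge0 ?(wt_ge0 ttP) // (avg_ge0 ttP).
have triple (x y : R) : x * y + x * y + x * y = 3 * x * y by ring.
case: s => [r r1||//].
  rewrite lee_fin in r1; have r0 : 0 < r by exact: lt_le_trans r1.
  pose Ssum := \sum_(1 <= m < M.+1) kstep tt m * (B m) `^ r.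
  have i1 := Ls_time_powR ttP r0 mh1 h1B; have i2 := Ls_time_powR ttP r0 mh2 h2B.
  have i3 := ls_jump_powR ttP r0 aB.
  (* Only integrability of g is assumed; if g^r is not integrable, the right side is +oo. *)
  have [igr|nigr] := pselect (mu.-integrable `]0, T]%classic (EFin \o (fun t => g t `^ r))).
    pose I := Rintegral mu `]0, T]%classic (fun t => g t `^ r).
    have I0 : 0 <= I by apply: Rintegral_ge0 => t _; exact: powR_ge0.
    have Sle : Ssum <= Kc `^ r * I.
      apply: le_trans (ler_wpM2l (powR_ge0 _ _)
        (hist_powR_sum ttP c0 T0 M0 kmin_ge kmax_le r1 g0 ig igr)).
      rewrite /Ssum mulr_sumr big_nat_cond [leRHS]big_nat_cond le_eqVlt; apply/orP; left.
      apply/eqP; apply: eq_bigr => m /andP[hm _].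
      by rewrite BE powRM ?(ltW L0) ?divr_ge0 ?hist0 ?(ltW L0) // mulrCA.
    have Sp : Ssum `^ r^-1 <= Kc * I `^ r^-1.
      have -> : Kc * I `^ r^-1 = (Kc `^ r * I) `^ r^-1.
        by rewrite powRM ?powR_ge0 // -powRrM mulfV ?gt_eqF // powRr1.
      have S0 : 0 <= Ssum.
        rewrite /Ssum big_nat_cond sumr_ge0 // => m /andP[hm _].
        by rewrite mulr_ge0 ?powR_ge0 // ltW // (kstep_gt0 ttP hm).
      by rewrite ge0_ler_powR ?nnegrE ?invr_ge0 ?(ltW r0) // (le_trans S0).
    have -> : Ls_I r%:E T g = (I `^ r^-1)%:E.
      rewrite /Ls_I -poweR_EFin /I /Rintegral fineK //.
      by apply: integrable_fin_num => //; exact: measurable_itv.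
    rewrite -EFinM lee_fin.
    apply: le_trans (lerD (lerD (le_trans i1 Sp) (le_trans i2 Sp)) (le_trans i3 Sp)) _.
    have CG := ler_wpM2r (powR_ge0 I r^-1) Cfinal_ge.
    by rewrite triple; exact: CG.
  have -> : Ls_I r%:E T g = +oo%E.
    rewrite /Ls_I; set J := integral _ _ _; have -> : J = +oo%E.
      apply/eqP; apply: contra_notT nigr => fin; apply/integrableP; split.
        apply/measurable_EFinP; apply: measurableT_comp (measurable_powR r) _.
        by apply/measurable_EFinP; case/integrableP: ig.
      under eq_integral do rewrite /= ger0_norm ?powR_ge0 //.
      by rewrite ltey.
    by rewrite poweRyr // gt_eqF ?invr_gt0.
  by rewrite gt0_muley ?lte_fin // leey.
move=> _; set F := Ls_I _ _ _.
have muT := lebesgue_measure_setT_gt0 R.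
(* Nonnegativity excludes - infinity, and the value +oo is trivial; what remains is a finite bound
   that holds almost everywhere. *)
have F0 : (0 <= F)%E.
  by apply: ess_sup_gee => //; apply: nearW => t; case: ifP => // _; rewrite lee_fin.
pose gE t : \bar R := if t \in `]0, T] then (g t)%:E else 0%E.
have gF : {ae mu, forall t, (gE t <= F)%E}.
  exact: ess_sup_ge.
case: F F0 gF => [G G0 gF|_ _|//]; last by rewrite gt0_muley ?lte_fin // leey.
rewrite lee_fin in G0; rewrite -EFinM lee_fin.
have hG m : (0 < m <= M)%N -> B m <= Kc * G.
  move=> hm; rewrite /Kc [leLHS]mulrA -[leRHS]mulrA; apply: ler_wpM2l; first by rewrite mulr_ge0 // ltW.
  apply: (hist_le ttP c0 T0 M0 kmin_ge hm g0 G0 ig).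
  have [Z [mZ Z0 sub]] := gF; exists Z; split=> // t ht; apply: sub => h; apply: ht => It.
  have {}h : (gE t <= G%:E)%E := h.
  have It' : t \in `]0, T] := It.
  by rewrite -lee_fin; move: h; rewrite /gE It'.
have KG0 : 0 <= Kc * G by rewrite mulr_ge0.
have i1 : Ls_time +oo%E M tt h1 <= Kc * G.
  apply: (Ls_time_sup ttP) => // m t hm It; case/andP: (h1B hm It) => _ h.
  by apply: le_trans h (hG _ hm).
have i2 : Ls_time +oo%E M tt h2 <= Kc * G.
  apply: (Ls_time_sup ttP) => // m t hm It; case/andP: (h2B hm It) => _ h.
  by apply: le_trans h (hG _ hm).
have i3 : ls_jump +oo%E M tt a <= Kc * G.
  apply: ls_jump_sup => // m hm; case/andP: (aB hm) => _ h.
  by apply: le_trans h (hG _ hm).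
have CG := ler_wpM2r G0 Cfinal_ge.
by apply: le_trans (lerD (lerD i1 i2) i3) _; rewrite triple; exact: CG.
Qed.

End StabilityFromHistory.

(** * The stability estimate *)

Section Assembly.
Variables (R : realType) (H : lmodType R) (n q : nat).
Variables (ip : H -> H -> R) (e : 'I_n -> H) (K : 'M[R]_n) (N : 'cV[R[i]]_n -> R).
Hypotheses (ipP : is_inner_product ip) (eP : lin_indep e) (KP : sym_posdef K).
Hypothesis normN : is_norm N.
Variables (M : nat) (tt : nat -> R) (f : R -> H) (U : nat -> 'I_q.+1 -> 'cV[R]_n) (T : R).
Hypothesis ttP : time_partition T M tt.
Local Notation G := (gram ip e).
Local Notation mu := (@lebesgue_measure R).
Local Notation k := (kstep tt).
Local Notation X := (stepX tt U).
Local Notation Nr v := (N (toC v)).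
Hypothesis intf : forall a, mu.-integrable `]0, T] (fun t => (ip (f t) (e a))%:E).

Definition load_norm (t : R) : R := Nr (proj_coord ip e (f t)).

Lemma load_norm_ge0 t : 0 <= load_norm t. Proof. exact: norm_ge0. Qed.

Lemma proj_coord_integrable (D : set R) a :
  @measurable _ (g_sigma_algebraType (R.-ocitv.-measurable)) D ->
  (forall b, mu.-integrable D (EFin \o (fun t => ip (f t) (e b)))) ->
  mu.-integrable D (EFin \o (fun t => proj_coord ip e (f t) a 0)).
Proof.
move=> mD ih.
rewrite (_ : (fun t => _) = (fun t => \sum_b invmx G a b * ip (f t) (e b))).
  exact: integrable_comb.
by apply/funext => t; rewrite /proj_coord mxE; apply: eq_bigr => b _; rewrite mxE.
Qed.

Lemma load_norm_integrable : mu.-integrable `]0, T]%classic (EFin \o load_norm).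
Proof.
apply: (norm_integrable normN); first exact: measurable_itv.
by move=> a; apply: proj_coord_integrable; [exact: measurable_itv | exact: intf].
Qed.

Lemma norm_stepF_le m i : (0 < m <= M)%N ->
  Nr (stepF ip e tt f m i) <= Rintegral mu (Im_ tt m) load_norm.
Proof.
move=> hm.
have -> : stepF ip e tt f m i = \col_a Rintegral mu (Im_ tt m)
   (fun t => (scaled (tt m.-1) (tt m) i t *: proj_coord ip e (f t)) a 0).
  by apply/colP => a; rewrite !mxE; apply: eq_Rintegral => t _; rewrite [RHS]mxE.
apply: (norm_integral_le normN (measurable_Im tt m)).
- move=> a; rewrite (_ : (fun t => _) =
     (fun t => scaled (tt m.-1) (tt m) i t * proj_coord ip e (f t) a 0)).
    apply: integrable_scaledM; apply: proj_coord_integrable; first exact: measurable_Im.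
    by move=> b; exact: (int_ip ttP intf).
  by apply/funext => t; rewrite mxE.
- apply: integrableS load_norm_integrable; [exact: measurable_itv|exact: measurable_itv|].
  exact: (Im_sub ttP hm).
- move=> t; rewrite /Im_ /= in_itv /= => /(scaled_bd i)/andP[s0 s1].
  by rewrite toCZ (normZ normN) cmod_real ger0_norm // ler_piMl // norm_ge0.
Qed.

Lemma kstep_telescope l m : (0 < l <= m)%N ->
  \sum_(l <= p < m.+1) k p = tt m - tt l.-1.
Proof.
move=> /andP[l0]; elim: m => [|m ih]; first by rewrite leqn0 => /eqP l00; rewrite l00 in l0.
rewrite leq_eqVlt => /predU1P[->|lm]; first by rewrite big_nat1.
by rewrite big_nat_recr ?(ltnW lm) //= ih // /kstep /=; ring.
Qed.

Lemma norm_comb_le (c : 'I_q.+1 -> R) (v : 'I_q.+1 -> 'cV[R]_n) :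
  Nr (\sum_j c j *: v j) <= \sum_j `|c j| * Nr (v j).
Proof.
rewrite -[toC _]/(map_mx (real_complex R) _) map_mx_sum.
apply: le_trans (norm_sum normN _ _ _) _; apply: ler_sum => j _.
by rewrite -[map_mx _ _]/(toC _) toCZ (normZ normN) cmod_real.
Qed.

Lemma dgjumpE m : (0 < m <= M)%N -> dgjump tt U m = X m ord0 - prevu tt U m.
Proof.
move=> hm; have left : dgval U m (tt m.-1) = X m ord0.
  rewrite (dgval_stepX U ttP) // (bigD1 ord0) //= big1 ?addr0 => [|j j0].
    by rewrite scaled_left eqxx scale1r.
  by rewrite scaled_left -val_eqE /= in j0 *; rewrite (negbTE j0) scale0r.
rewrite /dgjump /prevu -left; case: leqP => // m1.
have -> : m = 1%N by case: m hm m1 {left} => [|[|]].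
by rewrite subr0.
Qed.

Variables (C1 Mh : R).
Hypotheses (C10 : 0 <= C1) (Mh0 : 0 < Mh).
Local Notation B m := (C1 * (Mh * hist tt load_norm m)).
Hypothesis laplace_le : forall m j, (0 < m <= M)%N -> Nr (invmx G *m K *m X m j) <= B m.
Hypothesis increment_le : forall m j, (0 < m <= M)%N ->
  (k m)^-1 * Nr (X m j - (j == ord0)%:R *: prevu tt U m) <= B m.
Let q1 : R := q.+1%:R.
Let C2 := q1 ^+ 2 * C1.

Let q1_ge1 : 1 <= q1. Proof. by rewrite ler1n. Qed.

Let B0 m : (0 < m <= M)%N -> 0 <= B m.
Proof. by move=> hm; apply: le_trans (laplace_le ord0 hm); exact: norm_ge0. Qed.

Let B2E m : C2 * (Mh * hist tt load_norm m) = q1 ^+ 2 * B m.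
Proof. by rewrite /C2 -mulrA. Qed.

(** The coefficient j = 0 drops out of the derivative, and for j > 0 the increment bound concerns
    the coefficient itself. One factor q + 1 bounds j, the other counts the summands. *)
Lemma derivative_le m t : (0 < m <= M)%N -> Im_ tt m t ->
  0 <= Nr (dgder U m t) <= C2 * (Mh * hist tt load_norm m).
Proof.
move=> hm It; rewrite norm_ge0 //= (dgder_stepX U ttP) // B2E scaler_sumr.
have k0 := kstep_gt0 ttP hm.
under eq_bigr do rewrite scalerA.
apply: le_trans (norm_comb_le _ _) _.
apply: (@le_trans _ _ (\sum_(j < q.+1) q1 * B m)); last first.
  by rewrite sumr_const card_ord -[X in X <= _]mulr_natl mulrA expr2.
apply: ler_sum => j _; have [->|j0] := eqVneq j ord0.
  by rewrite /= mul0r mulr0 normr0 mul0r mulr_ge0 ?B0 // (le_trans ler01).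
have := increment_le j hm; rewrite (negbTE j0) scale0r subr0 => h.
have /andP[s0 s1] : 0 <= scaled (tt m.-1) (tt m) j.-1 t <= 1.
  by apply: scaled_bd; move: It; rewrite /Im_ /= in_itv.
rewrite ger0_norm ?mulr_ge0 ?invr_ge0 ?(ltW k0) // mulrAC [leLHS]mulrC.
apply: ler_pM; rewrite ?mulr_ge0 ?invr_ge0 ?(ltW k0) ?norm_ge0 //.
apply: (@le_trans _ _ (j%:R * 1)); first by rewrite ler_wpM2l.
by rewrite mulr1 ler_nat ltnW.
Qed.

Lemma laplacian_le m t : (0 < m <= M)%N -> Im_ tt m t ->
  0 <= Nr (dlap G K *m dgval U m t) <= C2 * (Mh * hist tt load_norm m).
Proof.
move=> hm It; rewrite norm_ge0 //= (dgval_stepX U ttP) // B2E mulmx_sumr.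
under eq_bigr do rewrite -scalemxAr.
apply: le_trans (norm_comb_le _ _) _.
apply: (@le_trans _ _ (\sum_(j < q.+1) B m)); last first.
  rewrite sumr_const card_ord -[X in X <= _]mulr_natl ler_wpM2r ?B0 // expr2.
  by rewrite ler_peMl // (le_trans ler01).
apply: ler_sum => j _.
have /andP[s0 s1] : 0 <= scaled (tt m.-1) (tt m) j t <= 1.
  by apply: scaled_bd; move: It; rewrite /Im_ /= in_itv.
rewrite ger0_norm //; apply: (@le_trans _ _ (Nr (dlap G K *m X m j))).
  by rewrite ler_piMl // norm_ge0.
rewrite /dlap mulNmx -scaleN1r toCZ (normZ normN) cmod_real normrN1 mul1r.
exact: laplace_le.
Qed.

Lemma jump_le m : (0 < m <= M)%N ->
  0 <= Nr ((k m)^-1 *: dgjump tt U m) <= C2 * (Mh * hist tt load_norm m).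
Proof.
move=> hm; rewrite norm_ge0 //= dgjumpE // B2E toCZ (normZ normN) cmod_real.
rewrite gtr0_norm ?invr_gt0 ?(kstep_gt0 ttP hm) //.
have := increment_le ord0 hm; rewrite eqxx scale1r => h; apply: le_trans h _.
rewrite ler_peMl ?B0 // expr2; have := q1_ge1; nra.
Qed.

Lemma measurable_derivative m : (0 < m <= M)%N ->
  measurable_fun (Im_ tt m) (fun t => Nr (dgder U m t)).
Proof.
move=> hm; rewrite (_ : (fun t => _) = fun t => Nr (\sum_(j < q.+1) ((k m)^-1 * j%:R *
   scaled (tt m.-1) (tt m) j.-1 t) *: X m j)).
  exact: (measurable_norm_scaled normN _ _ (fun j => j.-1) (fun j => (k m)^-1 * j%:R)).
apply/funext => t; rewrite (dgder_stepX U ttP) // scaler_sumr; congr (N (toC _)).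
by apply: eq_bigr => j _; rewrite scalerA mulrA.
Qed.

Lemma measurable_laplacian m : (0 < m <= M)%N ->
  measurable_fun (Im_ tt m) (fun t => Nr (dlap G K *m dgval U m t)).
Proof.
move=> hm; rewrite (_ : (fun t => _) = fun t => Nr (\sum_(j < q.+1) (1 *
   scaled (tt m.-1) (tt m) j t) *: (dlap G K *m X m j))).
  exact: (measurable_norm_scaled normN _ _ (fun j => j) (fun=> 1)).
apply/funext => t; rewrite (dgval_stepX U ttP) // mulmx_sumr; congr (N (toC _)).
by apply: eq_bigr => j _; rewrite -scalemxAr mul1r.
Qed.

Lemma stability_of_step_bounds (s : \bar R) (c beta : R) : (1 <= s)%E ->
  0 < c -> 0 < T -> (0 < M)%N ->
  c * kmax M tt `^ beta <= kmin M tt -> kmax M tt <= T / 4 -> 0 < beta ->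
  ((Ls_time s M tt (fun m t => Nr (dgder U m t))
    + Ls_time s M tt (fun m t => Nr (dlap G K *m dgval U m t))
    + ls_jump s M tt (fun m => Nr ((kstep tt m)^-1 *: dgjump tt U m)))%:E
   <= (Cfinal (q.+1%:R ^+ 2 * C1) beta c T * Mh * ln (T / kmax M tt))%:E
      * Ls_I s T load_norm)%E.
Proof.
move=> s1 c0 T0 M0 kmin_ge kmax_le beta0.
apply: (Ls_sum_le ttP c0 beta0 T0 M0 kmin_ge kmax_le load_norm_ge0 _ Mh0 load_norm_integrable
  measurable_derivative measurable_laplacian derivative_le laplacian_le jump_le s1).
by rewrite mulr_ge0 // exprn_ge0 // ler0n.
Qed.

End Assembly.

Theorem theorem14 (R : realType) (q : nat) (s : \bar R) (gamma kappa c beta T : R) :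
  (1 <= s)%E -> 0 < gamma < pi / 2 ->
  0 < kappa -> 0 < c -> 0 < beta -> 0 < T ->
  exists C : R, 0 < C /\
  forall (n : nat) (H : lmodType R) (ip : H -> H -> R) (e : 'I_n -> H)
         (K : 'M[R]_n) (N : 'cV[R[i]]_n -> R) (Mh : R)
         (M : nat) (tt : nat -> R) (f : R -> H)
         (U : nat -> 'I_q.+1 -> 'cV[R]_n),
    is_inner_product ip -> lin_indep e ->
    sym_posdef K ->
    is_norm N ->
    resolvent_estimate N (dlap (gram ip e) K) gamma Mh ->
    (0 < M)%N -> time_partition T M tt ->
    c * kmax M tt `^ beta <= kmin M tt ->
    (forall m, (1 <= m < M)%N ->
       kappa^-1 <= kstep tt m / kstep tt m.+1 <= kappa) ->
    kmax M tt <= T / 4 ->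
    (forall i : 'I_n,
       lebesgue_measure.-integrable `]0, T] (fun t => (ip (f t) (e i))%:E)) ->
    (forall Phi : nat -> 'I_q.+1 -> 'cV[R]_n,
       Bform (gram ip e) K M tt U Phi = load ip e M tt f Phi) ->
    ((Ls_time s M tt (fun m t => N (toC (dgder U m t)))
      + Ls_time s M tt (fun m t => N (toC (dlap (gram ip e) K *m dgval U m t)))
      + ls_jump s M tt (fun m => N (toC ((kstep tt m)^-1 *: dgjump tt U m))))%:E
     <= (C * Mh * ln (T / kmax M tt))%:E
        * Ls_I s T (fun t => N (toC (proj_coord ip e (f t)))))%E.
Proof.
move=> s1 gbd kappa0 c0 beta0 T0.
(* Any angle strictly between gamma and pi / 2 would do; it must depend on gamma only. *)
pose theta := (gamma + pi / 2) / 2.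
have [tbd gt] : 0 < theta < pi / 2 /\ gamma < theta.
  rewrite /theta; move: gbd => /andP[]; move: (pi / 2) => p g0 g1; split; last by lra.
  by apply/andP; split; lra.
have [C0 C00 steps] := dg_step_bounds q tbd kappa0.
(* Each of the q + 1 moments of P_h f on I_l is at most the integral of its norm. *)
pose C1 := C0 * q.+1%:R.
have C10 : 0 <= C1 by rewrite mulr_ge0 // ler0n.
exists (Cfinal (q.+1%:R ^+ 2 * C1) beta c T); split.
  by apply: Cfinal_gt0 => //; rewrite mulr_ge0 // exprn_ge0 // ler0n.
move=> n H ip e K N Mh M tt f U ipP eP KP normN res M0 ttP kmin_ge ratio kmax_le intf galerkin.
have [P [d [uP d0 dE]]] := simultaneous_diag (gram_posdef ipP eP) KP.
have hA : toCM (invmx (gram ip e) *m K) = fcalc P d id by rewrite unlock.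
have hD : toCM (dlap (gram ip e) K) = - fcalc P d id.
  by rewrite -hA; exact: (map_mxN (real_complex R)).
have kk m : (0 < m < M)%N ->
    kstep tt m <= kappa * kstep tt m.+1 /\ kstep tt m.+1 <= kappa * kstep tt m.
  move=> hm; have km : 0 < kstep tt m.+1 by apply: (kstep_gt0 ttP); case/andP: hm.
  have := ratio m hm; rewrite ler_pdivrMr // ler_pdivlMr // => /andP[h1 ->]; split=> //.
  by rewrite -ler_pdivrMl.
have u1 : prevu tt U 1 = 0 by [].
have uS m : (0 < m < M)%N -> prevu tt U m.+1 = \sum_j stepX tt U m j.
  case: m => // m hm; rewrite /prevu /=.
  rewrite (dgval_stepX U ttP); last by case/andP: hm => _ /ltnW.
  apply: eq_bigr => j _; rewrite scaled_right ?scale1r //.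
  by rewrite lt_eqF //; apply: (tt_lt ttP); rewrite ltnSn; case/andP: hm => _ /ltnW.
have {}steps := steps n P d N gamma Mh _ _ M (kstep tt) (stepX tt U)
  (fun m i => stepF ip e tt f m i) (prevu tt U) uP d0 normN gbd hD res gt
  (fun m hm => kstep_gt0 ttP hm) kk hA
  (fun m i hm => step_equation ipP eP KP ttP intf galerkin i hm) u1 uS.
have MN v : 0 <= Mh * N (toC v) := Mh_norm_ge0 uP d0 normN gbd hD res v.
pose g := load_norm ip e N f.
have g0 t : 0 <= g t := load_norm_ge0 ip e normN f t.
(* One vector of nonzero norm forces Mh >= 1. Otherwise the norm vanishes on all real vectors, and
   Mh may be of any sign. *)
have [[v v0]|triv] := pselect (exists v, N (toC v) != 0).
  have Mh1 : 1 <= Mh.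
    rewrite -(ler_pM2r (_ : 0 < N (toC v))); last by rewrite lt_neqAle eq_sym v0 norm_ge0.
    by rewrite mul1r; exact: (norm_le_Mh uP d0 normN gbd hD res).
  have Mh0 : 0 < Mh by exact: lt_le_trans Mh1.
  have Sle m : (0 < m <= M)%N -> C0 * \sum_(1 <= l < m.+1)
      (Mh * (\sum_(i < q.+1) N (toC (stepF ip e tt f l i))) / (\sum_(l <= p < m.+1) kstep tt p)) <=
      C1 * (Mh * hist tt g m).
    move=> hm; rewrite /C1 -mulrA ler_wpM2l // /hist !mulr_sumr big_nat_cond [leRHS]big_nat_cond.
    apply: ler_sum => l /andP[/andP[l0 lm] _].
    have hl : (0 < l <= M)%N by case/andP: hm => _ mM; rewrite l0 (leq_trans _ mM).
    rewrite kstep_telescope ?l0 // [q.+1%:R * _]mulrCA mulrA -[leRHS]mulrA [leRHS]mulrA.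
    rewrite mulrA ler_wpM2r //.
      rewrite invr_ge0 subr_ge0; apply: (tt_le ttP); case/andP: hm => _ mM.
      by rewrite mM andbT (leq_trans (leq_pred _)).
    rewrite -mulrA ler_wpM2l ?(ltW Mh0) // mulr_natl.
    rewrite -[X in _ *+ X]card_ord -sumr_const; apply: ler_sum => i _.
    exact: (norm_stepF_le normN ttP intf).
  apply: (stability_of_step_bounds normN ttP intf C10 Mh0 _ _ s1 c0 T0 M0 kmin_ge kmax_le beta0) => m j hm;
    have [h1 h2] := steps m j hm.
    exact: le_trans h1 (Sle m hm).
  exact: le_trans h2 (Sle m hm).
have N0 v : N (toC v) = 0 by apply: contrapT => /eqP h; apply: triv; exists v.
have hist0 m : (0 < m <= M)%N -> 0 <= hist tt g m.
  move=> hm; rewrite /hist big_nat_cond sumr_ge0 // => l /andP[/andP[l0 lm] _].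
  rewrite divr_ge0 //; first by apply: Rintegral_ge0 => t _; exact: g0.
  rewrite subr_ge0; apply: (tt_le ttP); case/andP: hm => _ mM.
  by rewrite mM andbT (leq_trans (leq_pred _)).
have g_eq0 : (fun t => N (toC (proj_coord ip e (f t)))) = fun=> 0.
  by apply/funext => t; rewrite N0.
have L0 : Ls_I s T (fun t => N (toC (proj_coord ip e (f t)))) = 0%E.
  rewrite g_eq0; case: s s1 => [r r1|_|//].
    rewrite lee_fin in r1; have rn : r != 0 by rewrite gt_eqF // (lt_le_trans _ r1).
    rewrite /Ls_I integral0_eq ?poweR0r ?invr_eq0 // => t _.
    by rewrite powR0.
  rewrite /Ls_I (_ : (fun _ => _) = cst 0%E) ?ess_sup_cst //; last first.
    by apply/funext => t; case: ifP.
  exact: lebesgue_measure_setT_gt0.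
(* In the trivial case the right side is 0 for every Mh, so the estimate is proved with 1 in its
   place. *)
rewrite L0 mule0 -(mule0 (Cfinal (q.+1%:R ^+ 2 * C1) beta c T * 1 * ln (T / kmax M tt))%:E) -L0.
apply: (stability_of_step_bounds normN ttP intf C10 ltr01 _ _ s1 c0 T0 M0 kmin_ge kmax_le beta0)
  => m j hm; rewrite N0 ?mulr0.
  by rewrite mulr_ge0 // mul1r hist0.
by rewrite mulr_ge0 // mul1r hist0.
Qed.
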